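(* Let $H$ be a separable real Hilbert space and let $A$ be a self-adjoint nonnegative (possibly unbounded) linear operator on $H$ with dense domain $D(A)$. Assume that there exist a countable (not necessarily complete) orthonormal system $\{e_k\}_{k\ge 1}$ in $H$ and an increasing unbounded sequence $\{\lambda_k\}_{k\ge 1}$ of positive real numbers such that $Ae_k=\lambda_k^2e_k$ for every $k\ge 1$. Let $\omega:[0,+\infty)\to[0,+\infty)$ be a continuous increasing function such that $\omega(0)=0$, $\omega(a+b)\le\omega(a)+\omega(b)$ for every $a\ge 0$, $b\ge 0$, and such that the function $\sigma\mapsto\sigma/\omega(\sigma)$ is nondecreasing. Let $\varphi:[0,+\infty)\to[1,+\infty)$ be a function such that $$\lim_{\sigma\to+\infty}\sigma\left[\varphi\left(\frac{\sigma}{\sqrt{\omega(1/\sigma)}}\right)\right]^{-1}=+\infty .$$ Then there exist a function $m:[0,+\infty)\to[0,3/2]$, a real number $T_0>0$, and a function $u:[0,T_0]\to H$ such that (i) $m$ is $\omega$-continuous; (ii) $(u(0),u'(0))\in\mathcal{G}_{\varphi,r,3/4}(A)\times\mathcal{G}_{\varphi,r,1/4}(A)$ for every $r>0$; (iii) $u\in C^1([0,T_0];D(A^{1/4}))\cap C^0([0,T_0];D(A^{3/4}))$ is a solution of $$u''(t)+m\left(|A^{1/2}u(t)|^2\right)Au(t)=0;$$ (iv) for every $t\in(0,T_0]$ we have that $(u(t),u'(t))\notin V_\beta$ for every $\beta\ge 1$; (v) there exists a sequence $\tau_k\to0^+$ such that $|A^{(\beta+1)/2}u(\tau_k)|$ is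 unbounded (in $k$) for every $\beta>1/2$.
   Context: $|x|$ denotes the norm of $x\in H$. A function $f:X\to\mathbb{R}$ with $X\subseteq\mathbb{R}$ is $\omega$-continuous if there is a constant $L\in\mathbb{R}$ with $|f(a)-f(b)|\le L\,\omega(|a-b|)$ for all $a,b\in X$. The powers $A^\beta$ ($\beta\ge0$), with domains $D(A^\beta)$, are those given by the spectral theorem. The quantity $|A^\beta x|$ is regarded as an element of $[0,+\infty]$, equal to $+\infty$ when $x\notin D(A^\beta)$. The phase spaces are $V_\beta:=D(A^{(\beta+1)/2})\times D(A^{\beta/2})$. Spaces $\mathcal{G}_{\varphi,r,\beta}(A)$ (for $r>0$, $\beta>0$): if $u=\sum_k u_k e_k$ lies in the closed span of orthonormal eigenvectors $e_k$ with $Ae_k=\lambda_k^2e_k$, set $$\|u\|^2_{\varphi,r,\beta}:=\sum_{k}\lambda_k^{4\beta}u_k^2\exp\left(r\varphi(\lambda_k)\right),$$ and $\mathcal{G}_{\varphi,r,\beta}(A):=\{u\in H:\|u\|^2_{\varphi,r,\beta}<+\infty\}$. (For a general $A$ and general $u\in H$ the sum is replaced by the corresponding spectral integral given by the spectral theorem.) The differential equation is understood in the usual weak sense (as an equality in the dual space $D(A^{-1/4})$ of $D(A^{1/4})$). *)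

(* Defs.v *)
From HB Require Import structures.
From mathcomp Require Import all_boot all_order all_algebra.
From mathcomp Require Import all_classical all_reals all_analysis.

Set Implicit Arguments.
Unset Strict Implicit.
Unset Printing Implicit Defensive.

Import Order.TTheory GRing.Theory Num.Theory.
Import numFieldNormedType.Exports.

Local Open Scope classical_set_scope.
Local Open Scope ring_scope.

(* A complete normed module whose norm comes from an inner product is a real
   Hilbert space. *)
Definition inner_product (R : realType) (H : completeNormedModType R)
    (ip : H -> H -> R) : Prop :=
  [/\ forall (a : R) (x y z : H), ip (a *: x + y) z = a * ip x z + ip y z,
      forall x y : H, ip x y = ip y x &
      forall x : H, ip x x = `|x| ^+ 2].

Definition separable (T : topologicalType) : Prop :=
  exists2 S : set T, countable S & dense S.

(* An unbounded operator is a pair (D, A) of a domain and a total function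
   whose values outside D are irrelevant. *)
Definition linear_operator (R : realType) (H : completeNormedModType R)
    (D : set H) (A : H -> H) : Prop :=
  D 0 /\ forall (a : R) (x y : H), D x -> D y ->
    D (a *: x + y) /\ A (a *: x + y) = a *: A x + A y.

Definition adjoint_graph (R : realType) (H : completeNormedModType R)
    (ip : H -> H -> R) (D : set H) (A : H -> H) (y z : H) : Prop :=
  forall x, D x -> ip (A x) y = ip x z.

Definition self_adjoint (R : realType) (H : completeNormedModType R)
    (ip : H -> H -> R) (D : set H) (A : H -> H) : Prop :=
  dense D /\
  forall y z, adjoint_graph ip D A y z <-> (D y /\ A y = z).

Definition nonnegative_operator (R : realType) (H : completeNormedModType R)
    (ip : H -> H -> R) (D : set H) (A : H -> H) : Prop :=
  forall x, D x -> 0 <= ip (A x) x.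

Definition projection_valued_measure (R : realType)
    (H : completeNormedModType R) (ip : H -> H -> R)
    (E : set (measurableTypeR R) -> H -> H) : Prop :=
  [/\ forall B, measurable B ->
        (forall (a : R) x y, E B (a *: x + y) = a *: E B x + E B y) /\
        (forall x y, ip (E B x) y = ip x (E B y)),
      forall B C x, measurable B -> measurable C ->
        E (B `&` C) x = E B (E C x),
      forall x, E setT x = x &
      forall (F : nat -> set (measurableTypeR R)) x,
        (forall n, measurable (F n)) -> trivIset setT F ->
        (fun n => \sum_(i < n) E (F i) x) @ \oo --> E (\bigcup_n F n) x].

Definition spectral_scalar_measure (R : realType)
    (H : completeNormedModType R) (ip : H -> H -> R)
    (E : set (measurableTypeR R) -> H -> H) (x : H)
    (B : set (measurableTypeR R)) : \bar R := (ip (E B x) x)%:E.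

Definition spectral_domain (R : realType) (H : completeNormedModType R)
    (ip : H -> H -> R) (E : set (measurableTypeR R) -> H -> H)
    (f : R -> R) : set H :=
  [set x | (\int[spectral_scalar_measure ip E x]_s ((f s) ^+ 2)%:E < +oo)%E].

(* The integral of f with respect to the signed measure <E(.) x, z>, obtained
   by polarization from the measures <E(.) y, y>. *)
Definition spectral_form (R : realType) (H : completeNormedModType R)
    (ip : H -> H -> R) (E : set (measurableTypeR R) -> H -> H)
    (f : R -> R) (x z : H) : R :=
  4%:R^-1 *
  (fine (\int[spectral_scalar_measure ip E (x + z)%R]_s (f s)%:E)%E -
   fine (\int[spectral_scalar_measure ip E (x - z)%R]_s (f s)%:E)%E).

(* y is the value at x of the operator "integral of f dE", on its maximal
   domain. Testing on the (dense) domain keeps all the integrals finite. *)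
Definition spectral_integral_graph (R : realType)
    (H : completeNormedModType R) (ip : H -> H -> R)
    (E : set (measurableTypeR R) -> H -> H) (f : R -> R) (x y : H) : Prop :=
  spectral_domain ip E f x /\
  forall z, spectral_domain ip E f z -> ip y z = spectral_form ip E f x z.

(* E is the resolution of the identity that the spectral theorem attaches to
   A: A is the integral of s dE(s), with equality of domains. *)
Definition spectral_resolution (R : realType) (H : completeNormedModType R)
    (ip : H -> H -> R) (D : set H) (A : H -> H)
    (E : set (measurableTypeR R) -> H -> H) : Prop :=
  projection_valued_measure ip E /\
  forall x y, (D x /\ A x = y) <-> spectral_integral_graph ip E id x y.

(* The operators below are the powers A^b of the nonnegative operator whose
   spectral resolution is E; E vanishes on the negative half-line, so the
   values of powR there play no role. *)
Definition Apow_dom (R : realType) (H : completeNormedModType R)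
    (ip : H -> H -> R) (E : set (measurableTypeR R) -> H -> H)
    (b : R) : set H :=
  spectral_domain ip E (fun s => s `^ b).

Definition Apow (R : realType) (H : completeNormedModType R)
    (ip : H -> H -> R) (E : set (measurableTypeR R) -> H -> H)
    (b : R) (x : H) : H :=
  xget 0 [set y | spectral_integral_graph ip E (fun s => s `^ b) x y].

Definition Apow_norm (R : realType) (H : completeNormedModType R)
    (ip : H -> H -> R) (E : set (measurableTypeR R) -> H -> H)
    (b : R) (x : H) : \bar R :=
  if `[< Apow_dom ip E b x >] then (`|Apow ip E b x|)%:E else +oo%E.

Definition phase_space (R : realType) (H : completeNormedModType R)
    (ip : H -> H -> R) (E : set (measurableTypeR R) -> H -> H)
    (b : R) : set (H * H) :=
  Apow_dom ip E ((b + 1) / 2) `*` Apow_dom ip E (b / 2).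

(* The eigenvalue lambda^2 corresponds to the spectral variable s, so lambda
   is the square root of s. *)
Definition gevrey_norm2 (R : realType) (H : completeNormedModType R)
    (ip : H -> H -> R) (E : set (measurableTypeR R) -> H -> H)
    (phi : R -> R) (r b : R) (x : H) : \bar R :=
  (\int[spectral_scalar_measure ip E x]_s
     ((Num.sqrt s `^ (4 * b) * expR (r * phi (Num.sqrt s)))%R)%:E)%E.

Definition gevrey (R : realType) (H : completeNormedModType R)
    (ip : H -> H -> R) (E : set (measurableTypeR R) -> H -> H)
    (phi : R -> R) (r b : R) : set H :=
  [set x | (gevrey_norm2 ip E phi r b x < +oo)%E].

Definition omega_continuous (R : realType) (X : set R) (omega f : R -> R) :
    Prop :=
  exists L : R, forall a b, X a -> X b -> `|f a - f b| <= L * omega `|a - b|.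

Definition graph_norm (R : realType) (H : completeNormedModType R)
    (ip : H -> H -> R) (E : set (measurableTypeR R) -> H -> H)
    (b : R) (x : H) : \bar R :=
  (`|x|%:E + Apow_norm ip E b x)%E.

Definition C0_dom (R : realType) (H : completeNormedModType R)
    (ip : H -> H -> R) (E : set (measurableTypeR R) -> H -> H)
    (I : set R) (b : R) (u : R -> H) : Prop :=
  (forall t, I t -> Apow_dom ip E b (u t)) /\
  forall t, I t ->
    graph_norm ip E b (u s - u t) @[s --> within I (nbhs t)] --> 0%E.

(* u belongs to C^1(I; D(A^b)), with derivative u' (one-sided at the
   endpoints of I) *)
Definition C1_dom (R : realType) (H : completeNormedModType R)
    (ip : H -> H -> R) (E : set (measurableTypeR R) -> H -> H)
    (I : set R) (b : R) (u u' : R -> H) : Prop :=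
  [/\ C0_dom ip E I b u, C0_dom ip E I b u' &
      forall t, I t ->
        graph_norm ip E b ((s - t)^-1 *: (u s - u t) - u' t)
          @[s --> within I t^'] --> 0%E].

(* the norm of the dual space D(A^{-b}) of D(A^b) *)
Definition dual_norm (R : realType) (H : completeNormedModType R)
    (ip : H -> H -> R) (E : set (measurableTypeR R) -> H -> H)
    (b : R) (l : H -> R) : \bar R :=
  ereal_sup [set `|l v|%:E | v in [set v | (graph_norm ip E b v <= 1)%E]].

(* l is the derivative at t, in D(A^{-b}), of w : I -> H, where H is embedded
   in D(A^{-b}) by x |-> <x, .> *)
Definition dual_derivative (R : realType) (H : completeNormedModType R)
    (ip : H -> H -> R) (E : set (measurableTypeR R) -> H -> H)
    (I : set R) (b : R) (w : R -> H) (t : R) (l : H -> R) : Prop :=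
  dual_norm ip E b (fun v => ip ((s - t)^-1 *: (w s - w t)) v - l v)
    @[s --> within I t^'] --> 0%E.

(* the extension of A to a map from D(A^{3/4}) to D(A^{-1/4}) *)
Definition A_weak (R : realType) (H : completeNormedModType R)
    (ip : H -> H -> R) (E : set (measurableTypeR R) -> H -> H)
    (x v : H) : R :=
  ip (Apow ip E (3 / 4) x) (Apow ip E (1 / 4) v).

(* u'' + m(|A^{1/2} u|^2) A u = 0 in D(A^{-1/4}) at every time of I; l stands
   for u''(t) *)
Definition weak_kirchhoff_solution (R : realType)
    (H : completeNormedModType R) (ip : H -> H -> R)
    (E : set (measurableTypeR R) -> H -> H) (I : set R) (m : R -> R)
    (u u' : R -> H) : Prop :=
  forall t, I t -> exists2 l : H -> R,
    dual_derivative ip E I (1 / 4) u' t l &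
    forall v, Apow_dom ip E (1 / 4) v ->
      l v + m (`|Apow ip E (1 / 2) (u t)| ^+ 2) * A_weak ip E (u t) v = 0.

(* Main.v *)
(** The solution is a superposition [u t = \sum_k w k t *: e (n k)] along a sparse
    subsequence of eigenvectors, where each [w k] solves the linear equation
    [w'' + l_k^2 c(t) w = 0] for one and the same coefficient [c], vanishing at 0
    like a modulus of continuity.

    On each of a sequence of disjoint time blocks shrinking to 0 the coefficient
    is [delta_k] plus an oscillation of amplitude comparable to
    [delta_k = omega (1 / sigma_k)] at frequency [sigma_k], resonating with the
    mode of eigenvalue [l_k^2], [l_k = sigma_k / sqrt delta_k].  The k-th mode
    is of Gevrey size before its block and is amplified by the factor
    [exp (sigma_k |block| / const)] there; elsewhere [c] is monotone or Lipschitz,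
    so that its energy changes by a factor depending only on the previous modes,
    which a sufficiently large [l_k] absorbs.  The final sizes are normalised so
    that [u] stays in [D(A^(3/4))] but just barely, for every positive time.

    The 0-th mode has [w = w' = 1] at time 0 and dominates the others, so that
    the energy [|A^(1/2) u|^2] increases at least linearly near 0.  Hence time is
    a Lipschitz function of the energy, and [m] is [c] composed with it: the
    linear equation becomes the Kirchhoff equation and [m] inherits the modulus
    [omega] of [c]. *)

Require Import Defs.
From HB Require Import structures.
From mathcomp Require Import all_boot all_order all_algebra.
From mathcomp Require Import all_classical all_reals all_analysis.
From mathcomp Require Import finmap measurable_realfun ring lra.

Set Implicit Arguments.
Unset Strict Implicit.
Unset Printing Implicit Defensive.

Import Order.TTheory GRing.Theory Num.Theory.
Import numFieldNormedType.Exports.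
Import HBNNSimple.

Local Open Scope classical_set_scope.
Local Open Scope ring_scope.

(** * Energy estimates and the linear equation *)

(** The coefficient is only known through its modulus, so it cannot be differentiated; energies with
    weights monotone in time are compared instead. Where [c] grows, [w'^2 + l^2 c w^2] does not
    decrease and [w'^2 / c + l^2 w^2] does not increase. At the end of a block the two differ by the
    factor [delta_k]. This gap explains the two different exponents of the conclusion. At a fixed
    positive time the lower bound has lost the factor [delta_k], and only [l_k^2 (w'^2 + l_k^2 w^2)]
    stays away from 0, which excludes [V_1]. At a well chosen time inside the block nothing is lost,
    and every exponent beyond 1/2 blows up along these times. The loss is affordable because
    [l_k delta_k = sigma_k sqrt delta_k] tends to infinity, [omega] being at least linear near 0.
    The choice [delta_k = omega (1 / sigma_k)] is the largest amplitude, up to constants, that the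
    modulus allows at frequency [sigma_k]. On the operator side the powers are spectral integrals,
    so the functional calculus is developed far enough to make them act diagonally on the chosen
    eigenvectors. *)

Lemma is_derive_local (R : realType) (h : R -> R) (t d : R) :
  is_derive t 1 h d -> forall e, 0 < e -> exists2 r, 0 < r &
  forall s, `|s - t| < r -> `|h s - h t - d * (s - t)| <= e * `|s - t|.
Proof.
move=> [dh dE] e e0.
have := dh; rewrite /derivable => /cvgrPdist_le /(_ e e0).
rewrite -/(derive h t 1) dE => -[r /= r0 Hr].
exists r => // s str.
have [->|st] := eqVneq s t; first by rewrite !subrr mulr0 subr0 normr0 mulr0.
have := Hr (s - t); rewrite /= sub0r normrN => /(_ str).
rewrite subr_eq0 => /(_ st) /=.
rewrite [_ *: 1]mulr1 subrK /= => H.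
have st0 : s - t != 0 by rewrite subr_eq0.
have -> : h s - h t - d * (s - t) = - ((d - (s - t)^-1 * (h s - h t)) * (s - t)).
  by field.
by rewrite normrN normrM ler_wpM2r.
Qed.

Lemma derive_ge0_le (R : realType) (f df : R -> R) (a b : R) :
  a <= b -> (forall t, a <= t <= b -> is_derive t 1 f (df t)) ->
  (forall t, a <= t <= b -> 0 <= df t) -> f a <= f b.
Proof.
move=> ab fd df0.
have [||c] := @MVT_segment R f df a b ab.
- by move=> x /[!in_itv]/= /andP[/ltW ax /ltW xb]; apply: fd; rewrite ax.
- apply: derivable_within_continuous => x /[!in_itv]/= xab.
  by have [] := fd x xab.
by rewrite in_itv/= -(subr_ge0 (f a)) => /df0 c0 ->; rewrite mulr_ge0// subr_ge0.
Qed.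

(** Real induction on the supremum of the points where [G] is at least [G a]: the local comparison
    first puts the supremum into this set, then moves past it. No continuity of [G] is involved,
    because monotone weights may jump. *)
Lemma local_monotone (R : realType) (G : R -> R) (a b : R) : a <= b ->
  (forall t, a <= t <= b -> exists2 d, 0 < d & forall s, a <= s <= b ->
     `|s - t| < d -> (t <= s -> G t <= G s) /\ (s <= t -> G s <= G t)) ->
  G a <= G b.
Proof.
move=> ab loc.
pose S := [set t | a <= t <= b /\ G a <= G t].
have Sa : S a by split; rewrite ?lexx.
have hS : has_sup S by split; [exists a | exists b => t [] /andP[]].
have aS : a <= sup S by apply: ub_le_sup => //; case: hS.
have Sb : sup S <= b by apply: ge_sup; [exists a | move=> t [] /andP[]].
have [d d0 Hd] := loc (sup S) ltac:(by rewrite aS).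
have [s Ss ds] : exists2 s, S s & sup S - d < s.
  exact: sup_adherent.
have sS : s <= sup S by apply: ub_le_sup => //; case: hS.
have SS : S (sup S).
  split; first by rewrite aS.
  have [sab Gs] := Ss; apply: (le_trans Gs).
  by apply: (Hd s sab _).2 => //; rewrite ler0_norm ?subr_le0// opprB ltrBlDr -ltrBlDl.
have [ltb|leb] := ltP (sup S) b; last first.
  suff -> : b = sup S by exact: SS.2.
  by apply/eqP; rewrite eq_le leb Sb.
pose s1 := Num.min b (sup S + d / 2).
have Ss1 : sup S < s1 by rewrite /s1 lt_min ltb/= ltrDl divr_gt0.
suff : S s1 by move=> /(ub_le_sup _) => /(_ (proj2 hS)); rewrite leNgt Ss1.
have s1ab : a <= s1 <= b by rewrite (le_trans aS (ltW Ss1))/= ge_min lexx.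
split => //; apply: (le_trans SS.2).
apply: (Hd s1 s1ab _).1; last exact: ltW.
rewrite ger0_norm ?subr_ge0 1?ltW// ltrBlDl gt_min; apply/orP; right.
by rewrite ltrD2l ltr_pdivrMr// ltr_pMr// ltr1n.
Qed.

(* The weights [r] and [r * c] are only required to be monotone: [c] itself is
   never differentiated. *)
Lemma energy_monotone (R : realType) (L : R) (c u u' r q : R -> R) (a b : R) :
  0 <= L -> a <= b ->
  (forall t, a <= t <= b -> is_derive t 1 u (u' t)) ->
  (forall t, a <= t <= b -> is_derive t 1 u' (- (L * c t * u t))) ->
  (forall t, a <= t <= b -> q t = r t * c t) ->
  (forall s t, a <= s -> s <= t -> t <= b -> r s <= r t /\ q s <= q t) ->
  r a * u' a ^+ 2 + L * q a * u a ^+ 2 <= r b * u' b ^+ 2 + L * q b * u b ^+ 2.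
Proof.
move=> L0 ab du du' qE rq.
apply/ler_addgt0Pr => e e0.
(* The slope [d] absorbs the first-order error made below when the weights are frozen; over the
   whole interval it costs at most [e]. *)
pose d := e / (b - a + 1).
have d0 : 0 < d by rewrite divr_gt0// ltr_wpDl// subr_ge0.
pose F t := r t * u' t ^+ 2 + L * q t * u t ^+ 2.
suff H : F a + d * a <= F b + d * b.
  have de : d * (b - a) <= e.
    rewrite /d mulrAC ler_pdivrMr; last by rewrite ltr_wpDl// subr_ge0.
    by rewrite ler_wpM2l ?ltW// ltrDl.
  rewrite /F in H; lra.
apply: (@local_monotone _ (fun t => F t + d * t)) => // t tab.
pose h s := r t * u' s ^+ 2 + L * q t * u s ^+ 2.
have dh : is_derive t 1 h 0.
  have := du t tab; have := du' t tab => ? ?.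
  apply: is_derive_eq.
  rewrite /GRing.scale/= qE//; ring.
have [del del0 Hdel] := is_derive_local dh d0.
exists del => // s sab /Hdel; rewrite mul0r subr0 => Hst.
have hle s' : r t <= r s' -> q t <= q s' -> h s <= r s' * u' s ^+ 2 + L * q s' * u s ^+ 2.
  by move=> rr qq; rewrite lerD// ler_wpM2r// ?sqr_ge0// ler_wpM2l.
have hle' s' : r s' <= r t -> q s' <= q t -> r s' * u' s ^+ 2 + L * q s' * u s ^+ 2 <= h s.
  by move=> rr qq; rewrite lerD// ler_wpM2r// ?sqr_ge0// ler_wpM2l.
have /andP[ta tb] := tab; have /andP[sa sb] := sab.
have Ft : F t = h t by [].
move: Hst; rewrite ler_norml => /andP[H1 H2]; split => st.
  have [rr qq] := rq _ _ ta st sb.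
  have := hle _ rr qq; rewrite -/(F s).
  move: H1 H2; rewrite ger0_norm ?subr_ge0// Ft => H1 H2 H3; lra.
have [rr qq] := rq _ _ sa st tb.
have := hle' _ rr qq; rewrite -/(F s).
move: H1 H2; rewrite ler0_norm ?subr_le0// Ft => H1 H2 H3; lra.
Qed.

(** Gronwall in both time directions: [E' = 2 u u' (k^2 - L c)], where the last factor is at most
    [k^2] in absolute value and [|2 k u u'| <= E], hence [|E'| <= k E]. Taking [d = k] and [d = - k]
    in [key] gives the two directions. *)
Lemma energy_growth (R : realType) (L k : R) (c u u' : R -> R) (a b : R) :
  0 < k -> a <= b ->
  (forall t, a <= t <= b -> is_derive t 1 u (u' t)) ->
  (forall t, a <= t <= b -> is_derive t 1 u' (- (L * c t * u t))) ->
  (forall t, a <= t <= b -> 0 <= L * c t <= 2 * k ^+ 2) ->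
  let E t := u' t ^+ 2 + k ^+ 2 * u t ^+ 2 in
  E b <= E a * expR (k * (b - a)) /\ E a <= E b * expR (k * (b - a)).
Proof.
move=> k0 ab du du' Lc E.
have key (d : R) : `|d| = k -> d * E a * expR (d * a) <= d * E b * expR (d * b).
  move=> dk.
  apply: (@derive_ge0_le _ (fun t => d * E t * expR (d * t))
    (fun t => (d ^+ 2 * E t + d * (2 * u t * u' t * (k ^+ 2 - L * c t))) * expR (d * t))) => // t tab.
    have := du t tab; have := du' t tab => ? ?.
    apply: is_derive_eq.
    rewrite /GRing.scale/= /E; ring.
  rewrite mulr_ge0// ?expR_ge0//.
  have d2 : d ^+ 2 = k ^+ 2 by rewrite -dk real_normK// num_real.
  set w := k ^+ 2 - L * c t.
  have wk : `|w| <= k ^+ 2.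
    rewrite ler_norml /w; have /andP[] := Lc t tab; lra.
  have uu : `|2 * u t * u' t * k| <= E t.
    rewrite ler_norml /E; apply/andP; split.
      have := sqr_ge0 (u' t + k * u t); rewrite sqrrD exprMn; lra.
    have := sqr_ge0 (u' t - k * u t); rewrite sqrrB exprMn; lra.
  suff : `|d * (2 * u t * u' t * w)| <= d ^+ 2 * E t.
    rewrite ler_norml => /andP[]; lra.
  rewrite normrM dk d2 normrM mulrA.
  have -> : k * `|2 * u t * u' t| = `|2 * u t * u' t * k|.
    by rewrite [RHS]normrM (gtr0_norm k0) mulrC.
  by rewrite mulrC; apply: ler_pM.
split.
  have := key (- k); rewrite normrN (gtr0_norm k0) => /(_ erefl).
  rewrite !mulNr lerN2 -!mulrA ler_pM2l// => H.
  rewrite -(ler_pM2r (expR_gt0 (- (k * b)))) (le_trans H)//.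
  rewrite -mulrA -expRD le_eqVlt; apply/orP; left; apply/eqP.
  by congr (_ * expR _); ring.
have := key k; rewrite (gtr0_norm k0) => /(_ erefl).
rewrite -!mulrA ler_pM2l// => H.
rewrite -(ler_pM2r (expR_gt0 (k * a))) (le_trans H)//.
rewrite -mulrA -expRD le_eqVlt; apply/orP; left; apply/eqP.
by congr (_ * expR _); ring.
Qed.

(** * Picard iteration for the scalar linear equation *)

Lemma geometric_limit (R : realType) (x : nat -> R) (C : R) :
  (forall n, `|x n.+1 - x n| <= C / 2 ^+ n) ->
  exists l, forall n, `|l - x n| <= 2 * C / 2 ^+ n.
Proof.
move=> xC.
have C0 : 0 <= C by have := le_trans (normr_ge0 _) (xC 0%N); rewrite expr0 divr1.
have tw n : (2 : R) ^+ n != 0 by rewrite expf_neq0.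
have tail n m : (n <= m)%N -> `|x m - x n| <= 2 * C / 2 ^+ n - 2 * C / 2 ^+ m.
  move=> /subnK <-; elim: (m - n)%N => [|k IH].
    by rewrite add0n !subrr normr0.
  rewrite addSn; have := xC (k + n)%N; move: IH.
  rewrite !ler_norml => /andP[h1 h2] /andP[h3 h4].
  have e : 2 * C / 2 ^+ (k + n) - 2 * C / 2 ^+ (k + n).+1 = C / 2 ^+ (k + n).
    rewrite exprS; field; exact: tw.
  by apply/andP; split; move: e h1 h2 h3 h4; set p := _ / _ in |- *; lra.
pose S := range (fun n => x n - 2 * C / 2 ^+ n).
have ubS n : ubound S (x n + 2 * C / 2 ^+ n).
  move=> _ [m _ <-].
  have p k : 0 <= 2 * C / 2 ^+ k by rewrite divr_ge0 ?mulr_ge0 ?exprn_ge0.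
  have := p n; have := p m.
  have [nm|/ltnW nm] := leqP n m; have := tail _ _ nm;
    rewrite ler_norml => /andP[]; lra.
exists (sup S) => n; rewrite ler_norml; apply/andP; split.
  have : x n - 2 * C / 2 ^+ n <= sup S.
    by apply: ub_le_sup; [exists (x 0%N + 2 * C / 2 ^+ 0); exact: ubS | exists n].
  lra.
have : sup S <= x n + 2 * C / 2 ^+ n.
  by apply: ge_sup; [exists (x n - 2 * C / 2 ^+ n); exists n | exact: ubS].
lra.
Qed.

Lemma geometric_small (R : realType) (C e : R) : 0 < e -> exists n : nat, C / 2 ^+ n < e.
Proof.
move=> e0; have [n Hn] : exists n : nat, C / e < n%:R.
  by exists (Num.bound `|C / e|); rewrite (le_lt_trans (ler_norm _))// archi_boundP.
exists n; rewrite ltr_pdivrMr ?exprn_gt0// mulrC -ltr_pdivrMr//.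
by rewrite (lt_le_trans Hn)// -natrX ler_nat ltnW// ltn_expl.
Qed.

(* Integrating from -1 makes 0 an interior point, so that the fundamental theorem
   of calculus gives a two-sided derivative there. *)
Definition primitive (R : realType) (f : R -> R) (t : R) : R :=
  (\int[@lebesgue_measure R]_(s in `[-1, t]) f (Num.max 0 s))
  - \int[@lebesgue_measure R]_(s in `[-1, 0]) f (Num.max 0 s).

(** Continuity on the half-line, expressed on the whole line through the extension by the constant
    [f 0]. *)
Definition cont0 (R : realType) (f : R -> R) := continuous (fun s : R => f (Num.max 0 s) : R).

Section primitive_theory.
Variable R : realType.
Implicit Types f g : R -> R.

Lemma primitive0 f : primitive f 0 = 0.
Proof. exact: subrr. Qed.

Lemma primitive_derive f (t : R) : cont0 f -> 0 <= t -> is_derive t 1 (primitive f) (f t).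
Proof.
move=> cf t0.
have [||||dF F'] := @continuous_FTC1_closed R (fun s => f (Num.max 0 s)) (-1) t (t + 1).
- by rewrite ltrDl.
- apply: continuous_compact_integrable; first exact: segment_compact.
  by move=> x; apply: continuous_subspaceT.
- by rewrite (lt_le_trans _ t0)// ltrN10.
- exact: cf.
rewrite /primitive; apply: is_derive_eq.
  apply: is_deriveB; first exact: derivableP.
rewrite -derive1E F' subr0; congr f.
by apply/max_idPr.
Qed.

Lemma primitive_cont0 f : cont0 f -> cont0 (primitive f).
Proof.
move=> cf t.
apply: (@continuous_comp _ _ _ (fun s : R => Num.max 0 s : R) (primitive f)).
  by apply: continuous_max; [exact: cst_continuous|move=> ?; exact: cvg_id].
apply/differentiable_continuous/derivable1_diffP.
by have [] : is_derive (Num.max 0 t) 1 (primitive f) (f (Num.max 0 t));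
  first by apply: primitive_derive => //; rewrite le_max lexx.
Qed.

(** In the sup norm weighted by [expR (k * s)], each integration gains a factor [1 / k]. This makes
    the Picard map a contraction on the whole half-line at once. *)
Lemma primitive_exp_bound f g (K k t : R) : cont0 f -> cont0 g -> 0 < k -> 0 <= t ->
  (forall s, 0 <= s -> `|f s - g s| <= K * expR (k * s)) ->
  `|primitive f t - primitive g t| <= K / k * expR (k * t).
Proof.
move=> cf cg k0 t0 fg.
have K0 : 0 <= K.
  by have := le_trans (normr_ge0 _) (fg 0 (lexx 0)); rewrite mulr0 expR0 mulr1.
have key f1 g1 : cont0 f1 -> cont0 g1 ->
    (forall s, 0 <= s -> `|f1 s - g1 s| <= K * expR (k * s)) ->
    primitive f1 t - primitive g1 t <= K / k * expR (k * t).
  move=> cf1 cg1 fg1.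
  have : K / k * expR (k * 0) - (primitive f1 0 - primitive g1 0)
      <= K / k * expR (k * t) - (primitive f1 t - primitive g1 t).
    apply: (@derive_ge0_le _ (fun t => K / k * expR (k * t) - (primitive f1 t - primitive g1 t))
      (fun t => K * expR (k * t) - (f1 t - g1 t)) 0 t t0).
      move=> s /andP[s0 _].
      have := primitive_derive cf1 s0; have := primitive_derive cg1 s0.
      move: (primitive f1) (primitive g1) => F G dG dF.
      by apply: is_derive_eq; rewrite /GRing.scale/=; field; exact: lt0r_neq0.
    by move=> s /andP[s0 _]; have := fg1 _ s0; rewrite ler_norml => /andP[]; lra.
  rewrite !primitive0 mulr0 expR0 mulr1 !subr0 => H.
  have : 0 <= K / k by rewrite divr_ge0// ltW.
  lra.
rewrite ler_norml; apply/andP; split; last exact: key.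
rewrite lerNl opprB; apply: key => // s s0; rewrite distrC; exact: fg.
Qed.

End primitive_theory.

Lemma cont0_mul (R : realType) (f g : R -> R) : cont0 f -> cont0 g ->
  cont0 (fun s => f s * g s).
Proof. by move=> cf cg t; apply: cvgM; [exact: cf|exact: cg]. Qed.

Lemma cont0_derive (R : realType) (f f' : R -> R) :
  (forall t : R, 0 <= t -> is_derive t 1 f (f' t)) -> cont0 f.
Proof.
move=> df t.
apply: (@continuous_comp _ _ _ (fun s : R => Num.max 0 s : R) f).
  by apply: continuous_max; [exact: cst_continuous|move=> ?; exact: cvg_id].
apply/differentiable_continuous/derivable1_diffP.
by have [] : is_derive (Num.max 0 t) 1 f (f' (Num.max 0 t));
  first by apply: df => //; rewrite le_max lexx.
Qed.

Lemma primitive_zero (R : realType) (t : R) : primitive (fun=> 0) t = 0.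
Proof. by rewrite /primitive /Rintegral /= !integral0 subrr. Qed.

Section linear_ode.
Variables (R : realType) (L u0 u1 : R) (c : R -> R).
Hypotheses (L0 : 0 <= L) (cc : cont0 c) (c1 : forall t : R, 0 <= t -> `|c t| <= 1).

Let rhs (f : R -> R) := fun s : R => - L * (c s * f s).
Let picard (f : R -> R) (t : R) : R := u0 + u1 * t + primitive (primitive (rhs f)) t.
(** Chosen so that two integrations turn the factor [L] into [L / k ^+ 2 <= 1 / 2]. *)
Let k := 1 + 2 * L.

Let k0 : 0 < k. Proof. by rewrite /k ltr_pwDl// mulr_ge0. Qed.

Let rhs_cont f : cont0 f -> cont0 (rhs f).
Proof.
move=> cf; apply: cont0_mul; last exact: cont0_mul.
by move=> t; exact: cst_continuous.
Qed.

Let picard_derive f (t : R) : cont0 f -> 0 <= t ->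
  is_derive t 1 (picard f) (u1 + primitive (rhs f) t).
Proof.
move=> cf t0.
have ? := primitive_derive (primitive_cont0 (rhs_cont cf)) t0.
rewrite /picard; apply: is_derive_eq.
by rewrite /GRing.scale/=; ring.
Qed.

Let picard_cont f : cont0 f -> cont0 (picard f).
Proof. by move=> cf; apply: cont0_derive => t; exact: picard_derive. Qed.

Let picard_contract f g K : cont0 f -> cont0 g ->
  (forall s : R, 0 <= s -> `|f s - g s| <= K * expR (k * s)) ->
  forall s : R, 0 <= s -> `|picard f s - picard g s| <= K / 2 * expR (k * s).
Proof.
move=> cf cg fg.
have K0 : 0 <= K.
  by have := le_trans (normr_ge0 _) (fg 0 (lexx 0)); rewrite mulr0 expR0 mulr1.
move=> s s0.
have -> : picard f s - picard g s =
    primitive (primitive (rhs f)) s - primitive (primitive (rhs g)) s.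
  by rewrite /picard opprD addrACA subrr add0r.
have rr : forall s : R, 0 <= s -> `|rhs f s - rhs g s| <= L * K * expR (k * s).
  move=> r r0; rewrite /rhs -mulrBr -mulrBr normrM normrN (ger0_norm L0) normrM.
  rewrite -mulrA ler_wpM2l// -[leRHS]mul1r ler_pM// ?c1// ?fg//.
have := primitive_exp_bound (primitive_cont0 (rhs_cont cf)) (primitive_cont0 (rhs_cont cg)) k0 s0
  (fun r r0 => primitive_exp_bound (rhs_cont cf) (rhs_cont cg) k0 r0 rr).
move=> /le_trans; apply; rewrite ler_wpM2r ?expR_ge0//.
rewrite -mulrA -mulrA mulrCA ler_wpM2l// -invfM ler_pdivrMr ?mulr_gt0//.
rewrite mulrC ler_pdivlMr// /k.
have := mulr_ge0 L0 L0; have := L0; nra.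
Qed.

Let U n := iter n picard (fun=> 0).

Let U_cont n : cont0 (U n).
Proof.
elim: n => [|n IH] /=; last exact: picard_cont.
by move=> t; exact: cst_continuous.
Qed.

Let K := `|u0| + `|u1|.

Let U_step n (s : R) : 0 <= s -> `|U n.+1 s - U n s| <= K * expR (k * s) / 2 ^+ n.
Proof.
suff H : forall s : R, 0 <= s -> `|U n.+1 s - U n s| <= (K / 2 ^+ n) * expR (k * s).
  by move=> s0; rewrite mulrAC; exact: H.
elim: n => [|n IH] {}s s0.
  rewrite /= expr0 divr1 subr0 /picard.
  have -> : rhs (fun=> 0) = fun=> 0 by apply/funext => ?; rewrite /rhs !mulr0.
  have -> : primitive (fun=> 0) = fun=> (0 : R).
    by apply/funext => r; exact: primitive_zero.
  rewrite primitive_zero.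
  rewrite addr0 (le_trans (ler_normD _ _))// /K mulrDl lerD//.
    by rewrite ler_peMr// -expR0 ler_expR mulr_ge0// ltW.
  rewrite normrM ler_wpM2l// ger0_norm// (le_trans _ (expR_ge1Dx _))//.
  rewrite /k mulrDl mul1r; have := mulr_ge0 L0 s0; lra.
rewrite exprSr invfM mulrA.
exact: (@picard_contract (U n.+1) (U n) _ (@U_cont n.+1) (@U_cont n) IH).
Qed.

Lemma linear_ode_exists : exists u u' : R -> R, [/\ u 0 = u0, u' 0 = u1,
  forall t : R, 0 <= t -> is_derive t 1 u (u' t) &
  forall t : R, 0 <= t -> is_derive t 1 u' (- (L * c t * u t))].
Proof.
have lim (s : R) : exists l, 0 <= s -> forall n, `|l - U n s| <= 2 * (K * expR (k * s)) / 2 ^+ n.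
  have [s0|s0] := leP 0 s; last by exists 0.
  by have [l Hl] := geometric_limit (fun n => U_step n s0); exists l.
have [V HV] := choice lim.
have K0 : 0 <= K by rewrite addr_ge0.
have cV : cont0 V.
  move=> t; apply/cvgrPdist_lt => e e0.
  set b := Num.max 0 t.
  have [n Hn] := geometric_small (2 * (K * expR (k * (b + 1)))) (divr_gt0 e0 (ltr0n _ 3)).
  have Hs s : 0 <= s -> s <= b + 1 -> `|V s - U n s| < e / 3.
    move=> s0 sb; apply: le_lt_trans Hn; apply: le_trans (HV s s0 n) _.
    rewrite ler_wpM2r ?invr_ge0 ?exprn_ge0// ler_wpM2l// ler_wpM2l// ler_expR.
    by rewrite ler_wpM2l// ltW.
  have /cvgrPdist_lt /(_ _ (divr_gt0 e0 (ltr0n _ 3))) := @U_cont n t.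
  have Ht : \forall s \near (t : R), s <= (t : R) + 1.
    by apply: lt_le_nbhsl; rewrite ltrDl.
  move=> HU; near=> s.
  have s1 : Num.max 0 s <= b + 1.
    rewrite ge_max; apply/andP; split; first by rewrite addr_ge0// le_max lexx.
    apply: le_trans (_ : t + 1 <= _); last by rewrite lerD2r /b le_max lexx orbT.
    by near: s.
  have h1 := Hs (Num.max 0 s) ltac:(by rewrite le_max lexx) s1.
  have h2 := Hs b ltac:(by rewrite le_max lexx) ltac:(by rewrite lerDl).
  have h3 : `|U n b - U n (Num.max 0 s)| < e / 3 by near: s.
  move: h1 h2 h3; rewrite !ltr_norml => /andP[? ?] /andP[? ?] /andP[? ?].
  by rewrite -/b; lra.
have fixV (t : R) : 0 <= t -> V t = picard V t.
  move=> t0; apply/eqP; rewrite -subr_eq0 -normr_le0; apply/ler_addgt0Pr => e e0; rewrite add0r.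
  have [n Hn] := geometric_small (2 * (K * expR (k * t))) (divr_gt0 e0 (ltr0n _ 2)).
  have h1 := le_lt_trans (HV t t0 n) Hn.
  have h2 : `|V t - U n.+1 t| <= e / 2.
    apply: le_trans (HV t t0 n.+1) _; apply: ltW; apply: le_lt_trans Hn.
    rewrite ler_wpM2l ?mulr_ge0 ?expR_ge0//.
    by rewrite lef_pV2 ?posrE ?exprn_gt0// ler_weXn2l// ler1n.
  have h3 : `|picard V t - U n.+1 t| <= e / 2.
    apply: le_trans (@picard_contract V (U n) (2 * K / 2 ^+ n) cV (@U_cont n) _ t t0) _.
      by move=> s s0; have := HV s s0 n; rewrite mulrA mulrAC.
    apply: ltW; apply: le_lt_trans Hn.
    have : 0 <= 2 * K / 2 ^+ n * expR (k * t).
      by rewrite mulr_ge0 ?expR_ge0// divr_ge0 ?mulr_ge0 ?exprn_ge0.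
    rewrite (_ : 2 * (K * expR (k * t)) / 2 ^+ n = 2 * K / 2 ^+ n * expR (k * t)); last by ring.
    rewrite (_ : 2 * K / 2 ^+ n / 2 * expR (k * t) = 2 * K / 2 ^+ n * expR (k * t) / 2); last by ring.
    lra.
  move: h2 h3; move: (picard V t) (V t) (U n.+1 t) => p v q.
  by rewrite !ler_norml => /andP[? ?] /andP[? ?]; lra.
(* [V] is controlled at nonnegative times only. There [picard V] agrees with it, and its integral
   formula provides a two-sided derivative at 0. *)
exists (picard V), (fun t => u1 + primitive (rhs V) t).
split.
- by rewrite /picard primitive0 mulr0 !addr0.
- by rewrite primitive0 addr0.
- by move=> t t0; exact: picard_derive.
- move=> t t0; have ? := primitive_derive (rhs_cont cV) t0.
  apply: is_derive_eq; rewrite /rhs (fixV t t0); ring.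
Unshelve. all: by end_near. Qed.

End linear_ode.

(** Data at an interior time are needed because a mode is prescribed at the start of its block. They
    are matched by Cramer's rule in a fundamental system whose Wronskian is 1. *)
Lemma linear_ode_at (R : realType) (L s v0 v1 : R) (c : R -> R) :
  0 <= L -> cont0 c -> (forall t : R, 0 <= t -> `|c t| <= 1) -> 0 <= s ->
  exists u u' : R -> R, [/\ u s = v0, u' s = v1,
    forall t : R, 0 <= t -> is_derive t 1 u (u' t) &
    forall t : R, 0 <= t -> is_derive t 1 u' (- (L * c t * u t))].
Proof.
move=> L0 cc c1 s0.
have [X [X' [X0 X'0 dX dX']]] := linear_ode_exists 1 0 L0 cc c1.
have [Y [Y' [Y0 Y'0 dY dY']]] := linear_ode_exists 0 1 L0 cc c1.
have W : X s * Y' s - X' s * Y s = 1.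
  pose w t := X t * Y' t - X' t * Y t.
  have dw (t : R) : 0 <= t -> is_derive t 1 w 0.
    move=> t0; have ? := dX t t0; have ? := dX' t t0.
    have ? := dY t t0; have ? := dY' t t0.
    by apply: is_derive_eq; rewrite /GRing.scale/=; ring.
  have le1 : w 0 <= w s.
    by apply: (@derive_ge0_le _ w (fun=> 0)) => // t /andP[t0 _]; exact: dw.
  have le2 : - w 0 <= - w s.
    apply: (@derive_ge0_le _ (fun t => - w t) (fun=> - 0)) => // t /andP[t0 _].
    by have ? := dw t t0; exact: is_derive_eq.
  have : w 0 = 1 by rewrite /w X0 Y0 Y'0 X'0; ring.
  by move: le1 le2; rewrite /w => ? ? ?; lra.
pose a := v0 * Y' s - v1 * Y s; pose b := v1 * X s - v0 * X' s.
exists (fun t => a * X t + b * Y t), (fun t => a * X' t + b * Y' t); split.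
- by rewrite -[RHS]mulr1 -W /a /b; ring.
- by rewrite -[RHS]mulr1 -W /a /b; ring.
- move=> t t0; have ? := dX t t0; have ? := dY t t0.
  by apply: is_derive_eq; rewrite /GRing.scale/=; ring.
- move=> t t0; have ? := dX' t t0; have ? := dY' t t0.
  by apply: is_derive_eq; rewrite /GRing.scale/=; ring.
Qed.

(** * The resonant coefficient *)

Section resonance.
Variable R : realType.
Implicit Types x y t : R.

(* [resonant] solves [w'' + hill w = 0] and its amplitude grows like
   [exp (x / 16)]. *)
Definition hill x : R := 1 - sin x * cos x / 2 - sin x ^+ 4 / 64.
Definition growth x : R := (x - sin x * cos x) / 16.
Definition resonant x : R := sin x * expR (growth x).
Definition resonant' x : R := (cos x + sin x ^+ 3 / 8) * expR (growth x).

Lemma sqr_sincos x : sin x ^+ 2 = 1 - cos x ^+ 2.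
Proof. by rewrite -[1](cos2Dsin2 x); ring. Qed.

Lemma derive_growth x : is_derive x 1 growth (sin x ^+ 2 / 8).
Proof.
rewrite /growth; apply: is_derive_eq; rewrite /GRing.scale/=.
have := sqr_sincos x; rewrite !expr2 => E.
have -> : sin x * - sin x = - (sin x * sin x) by ring.
by rewrite E; field.
Qed.

Lemma derive_resonant x : is_derive x 1 resonant (resonant' x).
Proof.
have ? := derive_growth x.
by rewrite /resonant /resonant'; apply: is_derive_eq; rewrite /GRing.scale/=; field.
Qed.

Lemma derive_resonant' x : is_derive x 1 resonant' (- (hill x * resonant x)).
Proof.
have ? := derive_growth x.
by rewrite /resonant'; apply: is_derive_eq; rewrite /GRing.scale/= /hill /resonant; field.
Qed.

Lemma sincos_le x : `|sin x * cos x| <= 1 / 2.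
Proof.
have := cos2Dsin2 x; rewrite ler_norml.
have := sqr_ge0 (sin x + cos x); have := sqr_ge0 (sin x - cos x).
by rewrite sqrrB sqrrD; lra.
Qed.

Lemma sin_sqr_le1 x : 0 <= sin x ^+ 2 <= 1.
Proof. by rewrite sqr_ge0/=; have := sqr_ge0 (cos x); have := cos2Dsin2 x; lra. Qed.

Lemma hill_bounds x : 1 / 2 <= hill x <= 3 / 2.
Proof.
have := sincos_le x; rewrite ler_norml => /andP[? ?].
have /andP[h0 h1] := sin_sqr_le1 x.
have : sin x ^+ 4 <= 1 by rewrite -[4%N]/(2 * 2)%N exprM expr_le1.
have : 0 <= sin x ^+ 4 by rewrite -[4%N]/(2 * 2)%N exprM exprn_ge0.
rewrite /hill; lra.
Qed.

Lemma hill_lipschitz x y : `|hill x - hill y| <= `|x - y|.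
Proof.
wlog xy : x y / y <= x.
  by move=> H; have [/H//|/ltW/H] := leP y x; rewrite distrC (distrC x).
pose d t := - (cos t ^+ 2 - sin t ^+ 2) / 2 - sin t ^+ 3 * cos t / 16.
have dh t : is_derive t 1 hill (d t).
  by rewrite /hill; apply: is_derive_eq; rewrite /GRing.scale/= /d; field.
have d1 t : `|d t| <= 1.
  have := cos2Dsin2 t; have /andP[h0 h1] := sin_sqr_le1 t.
  have := sincos_le t; rewrite ler_norml => /andP[k1 k2] E.
  have : `|sin t ^+ 3 * cos t| <= 1 / 2.
    rewrite exprSr -mulrA normrM (ger0_norm h0) -[leRHS]mul1r ler_pM//.
    exact: sincos_le.
  rewrite !ler_norml /d => /andP[? ?].
  by have := sqr_ge0 (cos t); lra.
have h1 : y + hill y <= x + hill x.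
  apply: (@derive_ge0_le _ (fun t : R => t + hill t) (fun t => 1 + d t)) => // t _.
  by have := d1 t; rewrite ler_norml => /andP[]; lra.
have h2 : y - hill y <= x - hill x.
  apply: (@derive_ge0_le _ (fun t : R => t - hill t) (fun t => 1 - d t)) => // t _.
  by have := d1 t; rewrite ler_norml => /andP[]; lra.
rewrite (ger0_norm (_ : 0 <= x - y)) ?subr_ge0// ler_norml; apply/andP; split; lra.
Qed.

Lemma growth_le x y : x <= y -> growth x <= growth y.
Proof.
move=> xy; apply: (@derive_ge0_le _ growth (fun t => sin t ^+ 2 / 8)) => // t _.
  exact: derive_growth.
by rewrite divr_ge0// sqr_ge0.
Qed.

Lemma sin_natpi (n : nat) : sin (n%:R * pi) = 0 :> R.
Proof.
elim: n => [|n IH]; first by rewrite mul0r sin0.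
by rewrite -natr1 mulrDl mul1r sinDpi IH oppr0.
Qed.

Lemma hill_zero x : sin x = 0 -> hill x = 1.
Proof. by move=> s; rewrite /hill s expr0n/=; ring. Qed.

Lemma resonant_energy_le x : resonant x ^+ 2 + resonant' x ^+ 2 <= 3 * expR (growth x) ^+ 2.
Proof.
rewrite /resonant /resonant' !exprMn -mulrDl ler_wpM2r ?sqr_ge0//.
have /andP[h0 h1] := sin_sqr_le1 x.
have h3 := sincos_le x; have h4 := cos2Dsin2 x.
rewrite sqrrD.
have : `|cos x * (sin x ^+ 3 / 8) *+ 2| <= 1 / 8.
  have -> : cos x * (sin x ^+ 3 / 8) *+ 2 = (sin x * cos x) * (sin x ^+ 2 / 4) by field.
  rewrite normrM (_ : 1 / 8 = (1 / 2) * (1 / 4)); last by field.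
  apply: ler_pM => //; rewrite ger0_norm ?divr_ge0//.
  lra.
rewrite ler_norml => /andP[_].
have : (sin x ^+ 3 / 8) ^+ 2 <= 1 / 8.
  rewrite exprMn -exprM mulnC exprM.
  have : (sin x ^+ 2) ^+ 3 <= 1 by rewrite expr_le1.
  rewrite (_ : 8^-1 ^+ 2 = 1 / 64); last by field.
  lra.
lra.
Qed.

End resonance.

(** * The coefficient as a staircase carrying resonant ripples *)

Section coefficient.
Variables (R : realType) (sigma delta : nat -> R) (N : nat -> nat).

(** The ratio of consecutive time scales must be small enough for the growth on a block of length
    about [rho ^+ k / 2] to beat the crude energy bound on the time before it, which lasts
    [2 * rho ^+ k.+1 = rho ^+ k / 32]. *)
Let rho : R := 1 / 64.

Hypothesis sigma_gt0 : forall k, 0 < sigma k.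
Hypothesis delta_gt0 : forall k, 0 < delta k.
Hypothesis delta_le : forall k, delta k <= rho ^+ k.+1.
Hypothesis delta_nincr : forall j k, (j <= k)%N -> delta k <= delta j.
Hypothesis N_le : forall k, (N k)%:R * pi <= sigma k * rho ^+ k / 2.

(** The interval from [rho ^+ k.+1] to twice that value leaves the staircase enough room to reach
    [delta k <= rho ^+ k.+1] with slope 1. *)
Definition block_start k : R := 2 * rho ^+ k.+1.
(** A whole number of half-periods, so that [sin] vanishes and [hill] equals 1 at both ends: the
    bump glues continuously to 0. *)
Definition block_end k : R := block_start k + (N k)%:R * pi / sigma k.

(* A nondecreasing 1-Lipschitz staircase, equal to [delta k] on
   [[2 * rho ^+ k.+1, rho ^+ k]]. *)
Definition profile (t : R) : R :=
  sup (range (fun k => Num.max 0 (Num.min (delta k) (t - rho ^+ k.+1)))).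

Definition in_block k (t : R) := block_start k <= t <= block_end k.

Definition bump k (t : R) : R := delta k * (hill (sigma k * (t - block_start k)) - 1).

(** Blocks are disjoint, so the index picked by [xget] is the only possible one; the test after it
    discards the default 0 returned when [t] lies in no block. *)
Definition ripple (t : R) : R :=
  let k := xget 0%N [set k | in_block k t] in
  if in_block k t then bump k t else 0.

Definition coef t := profile t + ripple t.

Let rho_gt0 : 0 < rho. Proof. by rewrite divr_gt0. Qed.

Let rhoX_gt0 k : 0 < rho ^+ k. Proof. exact: exprn_gt0. Qed.

Lemma rhoS k : rho ^+ k = 64 * rho ^+ k.+1.
Proof. by rewrite exprS /rho; field. Qed.

Let rho_nincr j k : (j <= k)%N -> rho ^+ k <= rho ^+ j.
Proof. by move=> jk; rewrite ler_wiXn2l// /rho; lra. Qed.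

Let term_ub t : ubound (range (fun k => Num.max 0 (Num.min (delta k) (t - rho ^+ k.+1))))
  (delta 0).
Proof.
move=> _ [k _ <-]; rewrite ge_max (ltW (delta_gt0 0)) ge_min.
by rewrite delta_nincr.
Qed.

Let term_le t k : Num.max 0 (Num.min (delta k) (t - rho ^+ k.+1)) <= profile t.
Proof. by apply: ub_le_sup; [exists (delta 0) | exists k]. Qed.

Let profile_le t x :
  (forall k, Num.max 0 (Num.min (delta k) (t - rho ^+ k.+1)) <= x) -> profile t <= x.
Proof. by move=> H; apply: ge_sup; [eexists; exists 0%N | move=> _ [k _ <-]]. Qed.

Lemma profile_ge0 t : 0 <= profile t.
Proof. by apply: le_trans (term_le t 0); rewrite le_max lexx. Qed.

Lemma profile_le_delta0 t : profile t <= delta 0.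
Proof. by apply: profile_le => k; apply: term_ub; exists k. Qed.

Lemma profile_ndecr s t : s <= t -> profile s <= profile t.
Proof.
move=> st; apply: profile_le => k; apply: le_trans (term_le t k).
rewrite ge_max !le_max lexx/=; apply/orP; right.
by rewrite le_min !ge_min lexx/= lerD2r st orbT.
Qed.

Lemma profile_lip s t : s <= t -> profile t <= profile s + (t - s).
Proof.
move=> st; apply: profile_le => k; rewrite ge_max; apply/andP; split.
  by rewrite addr_ge0 ?profile_ge0 ?subr_ge0.
rewrite -lerBlDr; apply: le_trans (term_le s k).
rewrite le_max; apply/orP; right.
rewrite le_min lerBlDr; apply/andP; split.
  by rewrite ge_min lerDl subr_ge0 st.
have : Num.min (delta k) (t - rho ^+ k.+1) <= t - rho ^+ k.+1 by rewrite ge_min lexx orbT.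
lra.
Qed.

Lemma profile_block k t : block_start k <= t -> t <= rho ^+ k -> profile t = delta k.
Proof.
move=> st tk; apply/eqP; rewrite eq_le; apply/andP; split; last first.
  apply: le_trans (term_le t k); rewrite le_max; apply/orP; right.
  rewrite le_min lexx/=; have := delta_le k.
  by move: st; rewrite /block_start; lra.
apply: profile_le => j; rewrite ge_max (ltW (delta_gt0 k))/= ge_min.
have [kj|jk] := leqP k j; first by rewrite delta_nincr.
apply/orP; right; have := rho_nincr jk.
by have := delta_gt0 k; move: tk; lra.
Qed.

Lemma profile_ge_block k t : block_start k <= t -> delta k <= profile t.
Proof.
move=> kt; rewrite -(@profile_block k (block_start k)) ?profile_ndecr//.
by rewrite /block_start (rhoS k); have := rhoX_gt0 k.+1; lra.
Qed.

Lemma profile_le_block k t : t <= rho ^+ k -> profile t <= delta k.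
Proof.
move=> kt; rewrite -(@profile_block k (rho ^+ k)) ?profile_ndecr//.
by rewrite /block_start (rhoS k); have := rhoX_gt0 k.+1; lra.
Qed.

Lemma block_le k : block_start k <= block_end k.
Proof. by rewrite lerDl divr_ge0 ?mulr_ge0 ?pi_ge0// ltW. Qed.

Lemma block_end_le k : block_end k <= rho ^+ k.
Proof.
have : (N k)%:R * pi / sigma k <= rho ^+ k / 2.
  by rewrite ler_pdivrMr// (le_trans (N_le k))//; lra.
rewrite /block_end /block_start (rhoS k); have := rhoX_gt0 k.+1; lra.
Qed.

Lemma block_disjoint j k t : in_block j t -> in_block k t -> j = k.
Proof.
wlog jk : j k / (j < k)%N.
  move=> H jt kt; case: (ltngtP j k) => // jk; first exact: H.
  by apply/esym; exact: H.
move=> /andP[h1 _] /andP[_ h2].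
have e1 := le_trans h2 (block_end_le k); have e2 := rho_nincr jk.
by exfalso; move: h1; rewrite /block_start; have := rhoX_gt0 j.+1; lra.
Qed.

Lemma ripple_in k t : in_block k t -> ripple t = bump k t.
Proof.
move=> kt; rewrite /ripple.
have H : in_block (xget 0%N [set k | in_block k t]) t.
  by apply: (@xgetPex _ 0%N [set k | in_block k t]); exists k.
by rewrite H (block_disjoint H kt).
Qed.

Lemma ripple_out t : (forall k, ~~ in_block k t) -> ripple t = 0.
Proof. by move=> out; rewrite /ripple (negbTE (out _)). Qed.

Lemma bump_start k : bump k (block_start k) = 0.
Proof. by rewrite /bump subrr mulr0 hill_zero ?sin0// subrr mulr0. Qed.

Lemma bump_end k : bump k (block_end k) = 0.
Proof.
rewrite /bump /block_end [block_start k + _]addrC addrK [sigma k * _]mulrC divfK ?lt0r_neq0//.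
by rewrite hill_zero ?sin_natpi// subrr mulr0.
Qed.

Lemma bump_lip k s t : `|bump k s - bump k t| <= delta k * sigma k * `|s - t|.
Proof.
rewrite /bump -mulrBr normrM gtr0_norm// -mulrA ler_wpM2l ?(ltW (delta_gt0 k))//.
have -> x y : hill x - 1 - (hill y - 1) = hill x - hill y :> R by ring.
rewrite (le_trans (hill_lipschitz _ _))// -mulrBr normrM gtr0_norm//.
by have -> : s - block_start k - (t - block_start k) = s - t by ring.
Qed.

Lemma bump_osc k s t : `|bump k s - bump k t| <= delta k.
Proof.
rewrite /bump -mulrBr normrM gtr0_norm// -[leRHS]mulr1 ler_wpM2l ?(ltW (delta_gt0 k))//.
have /andP[? ?] := hill_bounds (sigma k * (s - block_start k)).
have /andP[? ?] := hill_bounds (sigma k * (t - block_start k)).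
by rewrite ler_norml; apply/andP; split; lra.
Qed.

Lemma ripple_transitionP k t : block_end k.+1 <= t -> t <= block_start k -> ripple t = 0.
Proof.
move=> h1 h2.
have [[j jt]|no] := pselect (exists j, in_block j t); last first.
  by apply: ripple_out => j; apply/negP => jt; apply: no; exists j.
rewrite (ripple_in jt); have /andP[j1 j2] := jt.
have [jk|kj|jk] := ltngtP j k.
- exfalso; have := rho_nincr jk; move: j1 h2; rewrite /block_start (rhoS k).
  by have := rhoX_gt0 k.+1; lra.
- move: kj; rewrite leq_eqVlt => /orP[/eqP kj|kj].
    have -> : t = block_end j by apply/eqP; rewrite eq_le j2 -kj h1.
    exact: bump_end.
  exfalso; have := le_trans j2 (block_end_le j); have := rho_nincr kj.
  have := le_trans (block_le k.+1) h1; rewrite /block_start.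
  by have := rhoX_gt0 k.+2; lra.
- have -> : t = block_start j by apply/eqP; rewrite eq_le j1 jk h2.
  exact: bump_start.
Qed.

(** Two points not in the same block are joined through block endpoints lying between them, where
    the bumps vanish; each point pays [W] once, whence the factor 2. The lower limit [lo] allows two
    uses: with a Lipschitz modulus away from 0, and with [omega] on the whole half-line. *)
Lemma ripple_modulus (lo : R) (W : R -> R) :
  (forall s t, 0 <= s -> s <= t -> W s <= W t) -> (forall s, 0 <= s -> 0 <= W s) ->
  (forall k s t, lo <= s -> lo <= t -> in_block k s -> in_block k t ->
     `|bump k s - bump k t| <= W `|s - t|) ->
  forall s t, lo <= s -> lo <= t -> `|ripple s - ripple t| <= 2 * W `|s - t|.
Proof.
move=> W_ndecr W_ge0 HW s t los lot.
have W0 := W_ge0 _ (normr_ge0 (s - t)).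
have single k a b : lo <= a -> lo <= b -> in_block k a -> ~~ in_block k b ->
    `|bump k a| <= W `|a - b|.
  move=> loa lob ka; have /andP[a1 a2] := ka.
  rewrite /in_block negb_and -!ltNge => /orP[b1|b1].
    rewrite -[bump k a]subr0 -(bump_start k).
    apply: (le_trans (HW k a _ loa (le_trans lob (ltW b1)) ka _)).
      by rewrite /in_block lexx block_le.
    apply: W_ndecr => //; rewrite !ger0_norm ?subr_ge0//.
      by rewrite lerD2l lerN2 ltW.
    by apply: le_trans a1; exact: ltW.
  rewrite -[bump k a]subr0 -(bump_end k).
  apply: (le_trans (HW k a _ loa (le_trans loa a2) ka _)).
    by rewrite /in_block lexx block_le.
  apply: W_ndecr => //; rewrite !ler0_norm ?subr_le0//.
    by rewrite lerN2 lerD2l lerN2 ltW.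
  by apply: le_trans a2 _; exact: ltW.
have zero k a b : lo <= a -> lo <= b -> in_block k a -> ~~ in_block k b ->
    `|ripple a| <= W `|a - b|.
  by move=> ? ? ka kb; rewrite (ripple_in ka); exact: single.
have [[j js]|nos] := pselect (exists j, in_block j s).
  have [jt|jt] := boolP (in_block j t).
    rewrite (ripple_in js) (ripple_in jt) (le_trans (HW _ _ _ los lot js jt))//; lra.
  have h1 := zero _ _ _ los lot js jt.
  have [[k kt]|not] := pselect (exists k, in_block k t).
    have ks : ~~ in_block k s.
      by apply/negP => ks; move: jt; rewrite (block_disjoint js ks) kt.
    have h2 := zero _ _ _ lot los kt ks; rewrite distrC in h2.
    rewrite (le_trans (ler_normB _ _))//; lra.
  rewrite [ripple t]ripple_out ?subr0; first by lra.
  by move=> k; apply/negP => kt; apply: not; exists k.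
rewrite [ripple s]ripple_out ?sub0r ?normrN; last first.
  by move=> k; apply/negP => ks; apply: nos; exists k.
have [[k kt]|not] := pselect (exists k, in_block k t).
  have ks : ~~ in_block k s by apply/negP => ks; apply: nos; exists k.
  have h2 := zero _ _ _ lot los kt ks; rewrite distrC in h2; lra.
rewrite ripple_out ?normr0; first by lra.
by move=> k; apply/negP => kt; apply: not; exists k.
Qed.

Lemma coef_profile t : profile t / 2 <= coef t <= 3 / 2 * profile t.
Proof.
rewrite /coef; have p0 := profile_ge0 t.
have [[j jt]|no] := pselect (exists j, in_block j t); last first.
  rewrite ripple_out ?addr0; first by apply/andP; split; lra.
  by move=> k; apply/negP => kt; apply: no; exists k.
rewrite (ripple_in jt) /bump; have /andP[j1 j2] := jt.
rewrite (profile_block j1 (le_trans j2 (block_end_le j))).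
have /andP[h1 h2] := hill_bounds (sigma j * (t - block_start j)).
have := delta_gt0 j => d0; apply/andP; split; nra.
Qed.

Lemma coef_block k t : in_block k t ->
  coef t = delta k * hill (sigma k * (t - block_start k)).
Proof.
move=> kt; rewrite /coef (ripple_in kt) /bump; have /andP[j1 j2] := kt.
by rewrite (profile_block j1 (le_trans j2 (block_end_le k))); ring.
Qed.

Lemma coef_transition k t : block_end k.+1 <= t -> t <= block_start k -> coef t = profile t.
Proof. by move=> h1 h2; rewrite /coef (ripple_transitionP h1 h2) addr0. Qed.

Lemma coef_bounds t : 0 <= coef t <= 1.
Proof.
have /andP[h1 h2] := coef_profile t; have p0 := profile_ge0 t.
have := le_trans (profile_le_delta0 t) (delta_le 0); rewrite expr1 /rho.
move=> ?; apply/andP; split; lra.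
Qed.

Lemma coef_lip k : (forall j, (j <= k)%N -> sigma j <= sigma k) ->
  forall s t, block_start k <= s -> s <= t ->
  `|coef s - coef t| <= (1 + 2 * sigma k) * (t - s).
Proof.
move=> sigma_ndecr s t ks st.
have h : `|ripple s - ripple t| <= 2 * (sigma k * `|s - t|).
  apply: (@ripple_modulus (block_start k) (fun x => sigma k * x)) => //; last exact: le_trans st.
  - by move=> a b _ ab; rewrite ler_wpM2l// ltW.
  - by move=> a a0; rewrite mulr_ge0// ltW.
  - move=> j a b ka kb /andP[_ ja] _.
    have jk : (j <= k)%N.
      rewrite leqNgt; apply/negP => kj.
      have := le_trans ka (le_trans ja (block_end_le j)); have := rho_nincr kj.
      by rewrite /block_start; have := rhoX_gt0 k.+1; lra.
    rewrite (le_trans (bump_lip j a b))// ler_wpM2r//.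
    rewrite -[leRHS]mul1r ler_pM ?sigma_ndecr// ?(ltW (delta_gt0 j)) ?(ltW (sigma_gt0 j))//.
    rewrite (le_trans (delta_le j))// exprn_ile1// /rho; lra.
have := profile_ndecr st; have := profile_lip st.
move: h; rewrite (ler0_norm (_ : s - t <= 0)) ?subr_le0// opprB /coef.
rewrite !ler_norml => /andP[? ?] ? ?; apply/andP; split; lra.
Qed.

Variable omega : R -> R.
Hypothesis omega_ge0 : forall s, 0 <= s -> 0 <= omega s.
Hypothesis omega_ndecr : forall a b, 0 <= a -> a <= b -> omega a <= omega b.
Hypothesis omega_ratio : forall a b, 0 < a -> a <= b -> a / omega a <= b / omega b.
Hypothesis omega1_gt0 : 0 < omega 1.
Hypothesis deltaE : forall k, delta k = omega (1 / sigma k).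
Hypothesis omega_gt0 : forall s, 0 < s -> 0 < omega s.

(** A bump has slope at most [delta k * sigma k] and oscillation at most
    [delta k = omega (1 / sigma k)]. At distances up to [1 / sigma k] the slope bound is below
    [omega] because [s / omega s] is nondecreasing; at larger distances the oscillation bound
    suffices. The term [(omega 1)^-1] pays for the staircase, which is 1-Lipschitz with oscillation
    at most 1. *)
Lemma coef_modulus s t : 0 <= s -> 0 <= t ->
  `|coef s - coef t| <= ((omega 1)^-1 + 2) * omega `|s - t|.
Proof.
wlog st : s t / s <= t.
  by move=> H s0 t0; have [/H|/ltW/H] := leP s t; [|rewrite distrC (distrC t)]; exact.
move=> s0 t0.
have h : `|ripple s - ripple t| <= 2 * omega `|s - t|.
  apply: (@ripple_modulus 0 omega) => // k a b a0 b0 ka kb.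
  have [ab0|ab0] := eqVneq a b; first by rewrite ab0 !subrr normr0 omega_ge0.
  have abgt : 0 < `|a - b| by rewrite normr_gt0 subr_eq0.
  have [ab|ab] := leP `|a - b| (1 / sigma k); last first.
    rewrite (le_trans (bump_osc k a b))// deltaE omega_ndecr ?divr_ge0 1?ltW//.
  rewrite (le_trans (bump_lip k a b))//.
  have := omega_ratio abgt ab; rewrite -deltaE.
  rewrite ler_pdivrMr ?omega_gt0// mul1r => /(ler_wpM2l (ltW (mulr_gt0 (delta_gt0 k) (sigma_gt0 k)))).
  move=> /le_trans; apply; rewrite le_eqVlt; apply/orP; left; apply/eqP.
  by field; rewrite !lt0r_neq0.
have p : `|profile s - profile t| <= (omega 1)^-1 * omega `|s - t|.
  have d0 : `|profile s - profile t| <= `|s - t|.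
    have h1 := profile_ndecr st; have h2 := profile_lip st.
    by rewrite !ler0_norm ?subr_le0//; lra.
  have d1 : `|profile s - profile t| <= 1.
    have := profile_ge0 s; have := profile_ge0 t.
    have := profile_le_delta0 s; have := profile_le_delta0 t.
    have := delta_le 0; rewrite expr1 /rho ler_norml => *; apply/andP; split; lra.
  have [e0|e0] := eqVneq s t; first by rewrite e0 !subrr normr0 mulr_ge0 ?invr_ge0 ?omega_ge0.
  have gt0 : 0 < `|s - t| by rewrite normr_gt0 subr_eq0.
  have [le1|gt1] := leP `|s - t| 1.
    apply: (le_trans d0); have := omega_ratio gt0 le1.
    by rewrite ler_pdivrMr ?omega_gt0// mul1r.
  apply: (le_trans d1); rewrite mulrC ler_pdivlMr// mul1r omega_ndecr// ltW//.
rewrite /coef opprD addrACA (le_trans (ler_normD _ _))// mulrDl lerD//.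
Qed.

End coefficient.

(** * A single mode *)

(** The logarithm of [c] has Lipschitz constant at most [M / m], so an exponential weight of that
    rate makes [c] monotone in either direction, as [energy_monotone] requires. *)
Lemma exp_weight_monotone (R : realType) (c : R -> R) (a b m M : R) : 0 < m ->
  (forall s t, a <= s -> s <= t -> t <= b -> m <= c s /\ m <= c t /\ `|c s - c t| <= M * (t - s)) ->
  forall s t, a <= s -> s <= t -> t <= b ->
  (expR (M / m * s) * c s <= expR (M / m * t) * c t) /\
  (expR (- (M / m * t)) * c t <= expR (- (M / m * s)) * c s).
Proof.
move=> m0 Hc s t sa st tb; have [ms [mt]] := Hc _ _ sa st tb.
rewrite ler_norml => /andP[h1 h2].
have e1 : 1 + M / m * (t - s) <= expR (M / m * (t - s)) by exact: expR_ge1Dx.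
have [M0|Mn] := leP 0 (M * (t - s)); last first.
  by have := le_trans h1 h2; lra.
have key x y : m <= y -> x - y <= M * (t - s) -> x <= expR (M / m * (t - s)) * y.
  move=> my xy; apply: le_trans (_ : (1 + M / m * (t - s)) * y <= _); last first.
    by rewrite ler_wpM2r//; lra.
  rewrite mulrDl mul1r -lerBlDl (le_trans xy)//.
  have -> : M / m * (t - s) * y = M * (t - s) * (y / m) by ring.
  by rewrite ler_peMr// ler_pdivlMr// mul1r.
have h3 : c t - c s <= M * (t - s) by lra.
split.
  have -> : M / m * t = M / m * s + M / m * (t - s) by ring.
  by rewrite expRD -[leRHS]mulrA ler_pM2l ?expR_gt0// key.
have -> : - (M / m * s) = - (M / m * t) + M / m * (t - s) by ring.
by rewrite expRD -[leRHS]mulrA ler_pM2l ?expR_gt0// key.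
Qed.

Section component.
Variables (R : realType) (lam sig del s e s0 m M P : R) (N : nat) (c : R -> R).
Hypotheses (cc : cont0 c) (c01 : forall t, 0 <= c t <= 1).
Hypotheses (sig0 : 0 < sig) (del0 : 0 < del) (del1 : del <= 1).
Hypothesis lamE : lam ^+ 2 * del = sig ^+ 2.
Hypotheses (s_ge0 : 0 <= s) (eE : e = s + N.+1%:R * pi / sig) (es0 : e <= s0) (s01 : s0 <= 1).
Hypothesis c_block : forall t, s <= t <= e -> c t = del * hill (sig * (t - s)).
Hypothesis c_before : forall t, 0 <= t <= s -> c t <= 2 * del.
Hypothesis c_ndecr : forall a b, e <= a -> a <= b -> b <= s0 -> c a <= c b.
Hypotheses (m0 : 0 < m) (m1 : m <= 1) (M0 : 0 <= M).
Hypothesis c_lip : forall a b, s0 <= a -> a <= b ->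
  m <= c a /\ m <= c b /\ `|c a - c b| <= M * (b - a).
Hypothesis P0 : 0 < P.

(** The data are imposed at the start [s] of the block, where the solution can be taken explicit. It
    is then followed backwards to 0 by Gronwall, and forwards through the monotone range [[e, s0]]
    and the Lipschitz range [[s0, 1]]. The upper bounds carry [P ^+ 2 / del] and the lower one
    [P ^+ 2], as they come from the energies with weights [1 / c] and 1, which differ by [del] at
    time [e]. At [tau] the potential part alone reaches the size of the upper bound. *)
Lemma component_exists : exists u u' : R -> R, [/\
  forall t : R, 0 <= t -> is_derive t 1 u (u' t),
  forall t : R, 0 <= t -> is_derive t 1 u' (- (lam ^+ 2 * c t * u t)),
  forall t, 0 <= t <= s ->
    u' t ^+ 2 + lam ^+ 2 * u t ^+ 2 <= P ^+ 2 / del * expR (sig * s - N.+1%:R * pi / 8),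
  forall t, s <= t <= 1 ->
    u' t ^+ 2 + lam ^+ 2 * u t ^+ 2 <= P ^+ 2 / del * (3 * expR (M / m) / m) &
  (forall t, e <= t <= 1 ->
    P ^+ 2 * expR (- (M / m)) <= u' t ^+ 2 + lam ^+ 2 * u t ^+ 2) /\
  exists2 tau, s <= tau <= e & P ^+ 2 / del * (3 / 4) <= lam ^+ 2 * u tau ^+ 2].
Proof.
set n := N.+1%:R * pi : R.
have n0 : 0 < n by rewrite mulr_gt0 ?pi_gt0// ltr0n.
(* Normalised so that [u' e ^+ 2 = P ^+ 2] at the end of the block, where [growth] equals
   [n / 16]. *)
pose A := P / (sig * expR (n / 16)).
have A0 : 0 < A by rewrite divr_gt0// mulr_gt0// expR_gt0.
have AP : A * sig * expR (n / 16) = P.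
  by rewrite /A; field; rewrite !gt_eqF ?expR_gt0.
have L0 : 0 <= lam ^+ 2 by exact: sqr_ge0.
have c1 (t : R) : 0 <= t -> `|c t| <= 1.
  by move=> _; have /andP[? ?] := c01 t; rewrite ger0_norm.
have [u [u' [us u's du du']]] := linear_ode_at 0 (A * sig) L0 cc c1 s_ge0.
have se : s <= e by rewrite eE lerDl divr_ge0 ?ltW.
have s1 : s <= 1 by rewrite (le_trans se)// (le_trans es0).
have delV : del^-1 >= 1 by rewrite invf_ge1.
have e_ge0 := le_trans s_ge0 se.
(* By uniqueness the solution is the explicit resonant one on [[s, e]]. *)
pose f t := A * resonant (sig * (t - s)); pose f' t := A * sig * resonant' (sig * (t - s)).
have uf t : s <= t <= e -> u t = f t /\ u' t = f' t.
  move=> /andP[st te].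
  have dz (r : R) : s <= r <= t -> is_derive r 1 (fun r => u r - f r) (u' r - f' r).
    move=> /andP[sr rt]; have ? := du r (le_trans s_ge0 sr).
    have ? : is_derive r 1 (fun r => sig * (r - s)) sig.
      by apply: is_derive_eq; rewrite /GRing.scale/=; ring.
    have ? := @is_derive1_comp _ (@resonant R) (fun r => sig * (r - s)) r _ _ (derive_resonant _) _.
    by rewrite /f; apply: is_derive_eq; rewrite /GRing.scale/= /f'; ring.
  have dz' (r : R) : s <= r <= t -> is_derive r 1 (fun r => u' r - f' r)
      (- (lam ^+ 2 * c r * (u r - f r))).
    move=> /andP[sr rt]; have ? := du' r (le_trans s_ge0 sr).
    have ? : is_derive r 1 (fun r => sig * (r - s)) sig.
      by apply: is_derive_eq; rewrite /GRing.scale/=; ring.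
    have ? := @is_derive1_comp _ (@resonant' R) (fun r => sig * (r - s)) r _ _ (derive_resonant' _) _.
    rewrite /f'; apply: is_derive_eq; rewrite /GRing.scale/= /f.
    rewrite (c_block (t := r)) ?sr ?(le_trans rt te)// mulrA lamE; ring.
  have Lc (r : R) : s <= r <= t -> 0 <= lam ^+ 2 * c r <= 2 * sig ^+ 2.
    move=> /andP[sr rt]; rewrite (c_block (t := r)) ?sr ?(le_trans rt te)// mulrA lamE.
    have /andP[? ?] := hill_bounds (sig * (r - s)).
    by have := sqr_ge0 sig => ?; apply/andP; split; nra.
  have [+ _] := energy_growth sig0 st dz dz' Lc.
  have -> : u s - f s = 0 by rewrite us /f subrr mulr0 /resonant sin0 mul0r mulr0 subrr.
  have -> : u' s - f' s = 0.
    rewrite u's /f' subrr mulr0 /resonant' /growth sin0 cos0 mul0r subrr mul0r expR0.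
    by rewrite expr0n/=; ring.
  rewrite expr0n/= mulr0 addr0 mul0r => z0.
  have h1 := sqr_ge0 (u' t - f' t); have h2 : 0 <= sig ^+ 2 * (u t - f t) ^+ 2.
    by rewrite mulr_ge0 ?sqr_ge0.
  have z1 : (u' t - f' t) ^+ 2 = 0 by lra.
  have : sig ^+ 2 * (u t - f t) ^+ 2 = 0 by lra.
  move/eqP; rewrite mulf_eq0 sqrf_eq0 (gt_eqF sig0)/= sqrf_eq0 subr_eq0 => /eqP ->.
  by move/eqP: z1; rewrite sqrf_eq0 subr_eq0 => /eqP ->.
have phase t : s <= t <= e -> sig * (t - s) <= n.
  move=> /andP[st te]; rewrite mulrC -ler_pdivlMr//.
  by move: te; rewrite eE -/n; lra.
have growth_n : growth n = n / 16 by rewrite /growth /n sin_natpi mul0r subr0.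
have onblock t : s <= t <= e -> u' t ^+ 2 + sig ^+ 2 * u t ^+ 2 <= 3 * P ^+ 2.
  move=> ste; have [-> ->] := uf t ste; rewrite /f /f' -AP.
  set x := sig * (t - s).
  have gx : expR (growth x) <= expR (n / 16).
    by rewrite -growth_n ler_expR growth_le// phase.
  have : expR (growth x) ^+ 2 <= expR (n / 16) ^+ 2.
    by rewrite ler_pXn2r ?nnegrE ?expR_ge0.
  have := resonant_energy_le x; set r := resonant x; set r' := resonant' x => h1 h2.
  have -> : (A * sig * r') ^+ 2 + sig ^+ 2 * (A * r) ^+ 2 = (A * sig) ^+ 2 * (r ^+ 2 + r' ^+ 2).
    by ring.
  rewrite [in leRHS]exprMn [leRHS]mulrCA ler_wpM2l ?sqr_ge0//; lra.
have ge3 x : 0 <= x -> 3 * x <= x * (3 * expR (M / m) / m).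
  move=> x0; rewrite mulrC ler_wpM2l//.
  rewrite -mulrA ler_peMr//.
  have h1 : 1 <= expR (M / m) by rewrite -expR0 ler_expR divr_ge0// ltW.
  by rewrite ler_pdivlMr// mul1r (le_trans m1).
have P20 : 0 < P ^+ 2 by rewrite exprn_gt0.
have e_in : s <= e <= e by rewrite se lexx.
have sige : sig * (e - s) = n.
  by rewrite eE -/n addrAC subrr add0r mulrC divfK// gt_eqF.
have ue : u e = 0 by have [-> _] := uf e e_in; rewrite /f sige /resonant /n sin_natpi mul0r mulr0.
have u'e : u' e ^+ 2 = P ^+ 2.
  have [_ ->] := uf e e_in; rewrite /f' sige /resonant' growth_n /n sin_natpi expr0n/= mul0r addr0 -/n.
  have : cos n ^+ 2 = 1 by have := cos2Dsin2 n; rewrite /n sin_natpi expr0n/= addr0.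
  by rewrite -AP !exprMn => ->; rewrite mul1r.
have ce : c e = del by rewrite c_block// sige hill_zero ?mulr1// /n sin_natpi.
have cge t : e <= t -> t <= s0 -> del <= c t.
  by move=> et ts; rewrite -ce c_ndecr.
have du1 a b : e <= a -> forall t : R, a <= t <= b -> is_derive t 1 u (u' t).
  by move=> ea t /andP[at_ _]; apply: du; rewrite (le_trans e_ge0)// (le_trans ea).
have du1' a b : e <= a -> forall t : R, a <= t <= b -> is_derive t 1 u' (- (lam ^+ 2 * c t * u t)).
  by move=> ea t /andP[at_ _]; apply: du'; rewrite (le_trans e_ge0)// (le_trans ea).
(* On [[e, s0]] the coefficient is nondecreasing: the energy with weight 1
   increases, the one with weight 1/c decreases. *)
have lowE t : e <= t -> t <= s0 -> P ^+ 2 <= u' t ^+ 2 + lam ^+ 2 * c t * u t ^+ 2.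
  move=> et ts; have := @energy_monotone R (lam ^+ 2) c u u' (fun=> 1) c e t L0 et
    (du1 _ _ (lexx e)) (du1' _ _ (lexx e)).
  rewrite !mul1r ue u'e expr0n/= mulr0 addr0; apply => [r|a b ea ab bt].
    by rewrite mul1r.
  by split => //; apply: c_ndecr => //; exact: le_trans bt ts.
have upE t : e <= t -> t <= s0 -> (c t)^-1 * u' t ^+ 2 + lam ^+ 2 * u t ^+ 2 <= P ^+ 2 / del.
  move=> et ts; have := @energy_monotone R (lam ^+ 2) c u u' (fun t => - (c t)^-1) (fun=> - 1) e t L0 et
    (du1 _ _ (lexx e)) (du1' _ _ (lexx e)).
  have cp a : e <= a -> a <= t -> 0 < c a.
    by move=> ea at_; apply: (lt_le_trans del0); apply: cge => //; exact: le_trans at_ ts.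
  rewrite ue u'e expr0n/= mulr0 addr0 ce => H.
  have {}H := H _ _.
  have : - del^-1 * P ^+ 2 <= - (c t)^-1 * u' t ^+ 2 + lam ^+ 2 * - 1 * u t ^+ 2.
    apply: H => [r /andP[er rt]|a b ea ab bt].
      by rewrite mulNr mulVf// gt_eqF// cp.
    have ca := cp a ea (le_trans ab bt); have cb := cp b (le_trans ea ab) bt.
    split => //; rewrite lerN2 lef_pV2 ?posrE//.
    by apply: c_ndecr => //; exact: le_trans bt ts.
  by rewrite (mulrC (P ^+ 2)); lra.
have cV t : e <= t -> t <= s0 -> 1 <= (c t)^-1.
  move=> et ts; have /andP[_ ?] := c01 t.
  by rewrite invf_ge1// (lt_le_trans del0)// cge.
have sqc t x : c t * x ^+ 2 <= x ^+ 2.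
  by rewrite ler_piMl ?sqr_ge0//; have /andP[] := c01 t.
have s0e : s0 <= s0 by [].
pose K := M / m.
have c_lip' t a b : s0 <= a -> a <= b -> b <= t -> m <= c a /\ m <= c b /\ `|c a - c b| <= M * (b - a).
  by move=> ? ? _; exact: c_lip.
have K0 : 0 <= K by rewrite divr_ge0// ltW.
have expK (a b : R) : 0 <= a -> a <= b -> b <= 1 -> expR (K * b) <= expR K * expR (K * a).
  move=> a0 ab b1; rewrite -expRD ler_expR.
  have : K * b <= K by rewrite ler_piMr.
  by have := mulr_ge0 K0 a0; lra.
have e_ge0' : 0 <= s0 by exact: le_trans e_ge0 es0.
pose E t := u' t ^+ 2 + lam ^+ 2 * c t * u t ^+ 2.
(* After [s0] the coefficient is only Lipschitz and at least [m]; the weights [expR (K * t)] and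
   [expR (- (K * t))] bound [E] from both sides, at the price of a factor [expR K] on [[0, 1]]. *)
have low2 t : s0 <= t -> t <= 1 -> expR (K * s0) * E s0 <= expR (K * t) * E t.
  move=> st t1; have := @energy_monotone R (lam ^+ 2) c u u' (fun t => expR (K * t))
    (fun t => expR (K * t) * c t) s0 t L0 st (du1 _ _ es0) (du1' _ _ es0) (fun _ _ => erefl).
  rewrite /E => H; move: (H) => /(_ _) h.
  have {h} : expR (K * s0) * u' s0 ^+ 2 + lam ^+ 2 * (expR (K * s0) * c s0) * u s0 ^+ 2
    <= expR (K * t) * u' t ^+ 2 + lam ^+ 2 * (expR (K * t) * c t) * u t ^+ 2.
    apply: h => a b sa ab bt; split.
      by rewrite ler_expR ler_wpM2l.
    by have [] := exp_weight_monotone m0 (c_lip' t) sa ab bt.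
  by rewrite !mulrDr; lra.
have up2 t : s0 <= t -> t <= 1 -> expR (- (K * t)) * E t <= expR (- (K * s0)) * E s0.
  move=> st t1; have := @energy_monotone R (lam ^+ 2) c u u' (fun t => - expR (- (K * t)))
    (fun t => - expR (- (K * t)) * c t) s0 t L0 st (du1 _ _ es0) (du1' _ _ es0) (fun _ _ => erefl).
  move=> h.
  have {h} : - expR (- (K * s0)) * u' s0 ^+ 2 + lam ^+ 2 * (- expR (- (K * s0)) * c s0) * u s0 ^+ 2
    <= - expR (- (K * t)) * u' t ^+ 2 + lam ^+ 2 * (- expR (- (K * t)) * c t) * u t ^+ 2.
    apply: h => a b sa ab bt; split.
      by rewrite lerN2 ler_expR lerN2 ler_wpM2l.
    by have [_] := exp_weight_monotone m0 (c_lip' t) sa ab bt; rewrite !mulNr lerN2.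
  by rewrite !mulrDr; lra.
have Es0 : P ^+ 2 <= E s0 <= P ^+ 2 / del.
  rewrite lowE//=; apply: le_trans (upE s0 es0 s0e); rewrite /E lerD//.
    by rewrite ler_peMl ?sqr_ge0// cV.
  by rewrite -mulrA ler_wpM2l.
have El t : s0 <= t -> t <= 1 -> P ^+ 2 * expR (- K) <= E t <= P ^+ 2 / del * expR K.
  move=> st t1; have /andP[h1 h2] := Es0.
  have E0 : 0 <= E s0 by rewrite (le_trans _ h1)// ltW.
  apply/andP; split.
    have := low2 t st t1; have := expK s0 t e_ge0' st t1 => k1 k2.
    rewrite -(ler_pM2l (expR_gt0 (K * t))); apply: le_trans k2.
    rewrite mulrA; apply: le_trans (_ : expR (K * s0) * P ^+ 2 <= _).
      rewrite mulrAC ler_wpM2r ?sqr_ge0//.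
      rewrite expRN ler_pdivrMr ?expR_gt0// [leRHS]mulrC//.
    by rewrite ler_wpM2l ?expR_ge0.
  have := up2 t st t1; have := expK s0 t e_ge0' st t1 => k1 k2.
  rewrite -(ler_pM2l (expR_gt0 (- (K * t)))); apply: (le_trans k2).
  apply: le_trans (_ : expR (- (K * s0)) * (P ^+ 2 / del) <= _).
    by rewrite ler_wpM2l ?expR_ge0.
  have q : expR (- (K * s0)) <= expR (- (K * t)) * expR K.
    rewrite -expRD ler_expR; have : K * t <= K by rewrite ler_piMr.
    by have := mulr_ge0 K0 e_ge0'; lra.
  rewrite [P ^+ 2 / del * _]mulrC [leRHS]mulrA ler_wpM2r// divr_ge0 ?sqr_ge0//.
  exact: ltW.
have Pd0 : 0 <= P ^+ 2 / del by rewrite divr_ge0 ?sqr_ge0// ltW.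
have Kge : 1 <= expR K by rewrite -expR0 ler_expR.
have scale t : (u' t ^+ 2 + lam ^+ 2 * u t ^+ 2) * del <= u' t ^+ 2 + sig ^+ 2 * u t ^+ 2.
  have -> : sig ^+ 2 * u t ^+ 2 = lam ^+ 2 * u t ^+ 2 * del by rewrite -lamE; ring.
  by rewrite mulrDl lerD2r ler_piMr ?sqr_ge0.
exists u, u'; split => //.
- move=> t /andP[t0 ts].
  (* Before the block [c <= 2 * del], so the energy with the constant weight [sig ^+ 2] changes at
     rate at most [sig]; it is estimated backwards from [s]. *)
  have Lc (r : R) : t <= r <= s -> 0 <= lam ^+ 2 * c r <= 2 * sig ^+ 2.
    move=> /andP[tr rs]; have /andP[cr _] := c01 r.
    rewrite mulr_ge0//= -lamE.
    have : c r <= 2 * del by apply: c_before; rewrite (le_trans t0 tr).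
    by move=> /(ler_wpM2l L0); lra.
  have [_] := energy_growth sig0 ts (fun r H => du r (le_trans t0 (proj1 (andP H))))
    (fun r H => du' r (le_trans t0 (proj1 (andP H)))) Lc.
  rewrite us u's expr0n/= mulr0 addr0 => H.
  have : expR (sig * (s - t)) <= expR (sig * s).
    by rewrite ler_expR ler_wpM2l ?(ltW sig0)// gerBl.
  have -> : sig * s - n / 8 = - (n / 16) + (- (n / 16)) + sig * s by field.
  rewrite !expRD expRN => Hs.
  have AE : (A * sig) ^+ 2 = P ^+ 2 * ((expR (n / 16))^-1 * (expR (n / 16))^-1).
    by rewrite -AP; field; rewrite gt_eqF// expR_gt0.
  have H2 : u' t ^+ 2 + sig ^+ 2 * u t ^+ 2 <=
     P ^+ 2 * ((expR (n / 16))^-1 * (expR (n / 16))^-1 * expR (sig * s)).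
    by apply: (le_trans H); rewrite mulrA -AE ler_wpM2l ?sqr_ge0.
  rewrite [P ^+ 2 / del * _]mulrAC ler_pdivlMr//.
  exact: le_trans (scale t) H2.
- move=> t /andP[st t1]; rewrite -/K.
  have [te|et] := leP t e.
    apply: le_trans (ge3 _ Pd0).
    have := onblock t; rewrite st te => /(_ isT) => H.
    by rewrite [leRHS]mulrA ler_pdivlMr// (le_trans (scale t)).
  have [ts|st0] := leP t s0.
    apply: le_trans (ge3 _ Pd0).
    have := upE t (ltW et) ts => H.
    have : u' t ^+ 2 <= (c t)^-1 * u' t ^+ 2 by rewrite ler_peMl ?sqr_ge0// cV// ltW.
    lra.
  have /andP[_ H] := El t (ltW st0) t1.
  have [mt _] := c_lip (ltW st0) (lexx t).
  have h1 : m * (u' t ^+ 2 + lam ^+ 2 * u t ^+ 2) <= E t.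
    rewrite /E mulrDr lerD//; first by rewrite ler_piMl ?sqr_ge0.
    by rewrite mulrCA mulrA ler_wpM2r ?sqr_ge0// ler_wpM2l.
  rewrite mulrA ler_pdivlMr// mulrC (le_trans h1)// (le_trans H)//.
  by rewrite ler_wpM2l// ler_peMl ?expR_ge0//; lra.
split.
  move=> t /andP[et t1]; rewrite -/K.
  have cE : E t <= u' t ^+ 2 + lam ^+ 2 * u t ^+ 2.
    by rewrite /E lerD2l -mulrA ler_wpM2l.
  apply: le_trans cE; have [ts|st0] := leP t s0.
    apply: le_trans (lowE t et ts); rewrite ler_piMr ?sqr_ge0//.
    by rewrite -expR0 ler_expR oppr_le0.
  by have /andP[] := El t (ltW st0) t1.
(* The last phase of the block with [sin x ^+ 2 = 1]. The growth exponent is there only [pi / 32]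
   below its final value, and [expR (- (pi / 16)) >= 1 - pi / 16 >= 3 / 4]. *)
pose x := n - pi / 2.
have x0 : 0 <= x.
  have : (1 : R) <= N.+1%:R by rewrite ler1n.
  by have := pi_gt0 R; rewrite /x /n; nra.
have cosx : cos x = 0.
  rewrite /x cosB cos_pihalf sin_pihalf mulr0 add0r mulr1 /n; exact: sin_natpi.
have ste : s <= s + x / sig <= e.
  apply/andP; split; first by rewrite lerDl divr_ge0// ltW.
  by rewrite eE lerD2l ler_pM2r ?invr_gt0// -/n /x gerBl divr_ge0// pi_ge0.
exists (s + x / sig) => //.
have [-> _] := uf _ ste.
rewrite /f addrAC subrr add0r [sig * _]mulrC divfK ?gt_eqF//.
have sinx : sin x ^+ 2 = 1 by have := cos2Dsin2 x; rewrite cosx expr0n/= add0r.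
have gx : growth x = n / 16 + - (pi / 32).
  by rewrite /growth cosx mulr0 subr0 /x; field.
rewrite /resonant gx expRD.
have lE : lam ^+ 2 = sig ^+ 2 / del by rewrite -lamE mulfK// gt_eqF.
set X := expR (- (pi / 32)).
have -> : lam ^+ 2 * (A * (sin x * (expR (n / 16) * X))) ^+ 2 =
    P ^+ 2 / del * (sin x ^+ 2 * X ^+ 2).
  by rewrite lE -AP; field; rewrite gt_eqF.
rewrite sinx mul1r ler_wpM2l//.
rewrite -expRM_natl; apply: le_trans (expR_ge1Dx _).
by have := pihalf_lt2 R; lra.
Qed.

End component.

(** * Choice of the frequencies *)

Section modes.
Variables (R : realType) (lam : nat -> R) (omega phi : R -> R).
Hypothesis lam_gt0 : forall k, 0 < lam k.
Hypothesis lam_unbounded : forall M : R, exists k, M < lam k.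
Hypothesis omega_ge0 : forall s, 0 <= s -> 0 <= omega s.
Hypothesis omega_cont : {within `[0, +oo[, continuous omega}.
Hypothesis omega_increasing : forall a b, 0 <= a -> a < b -> omega a < omega b.
Hypothesis omega0 : omega 0 = 0.
Hypothesis omega_ratio : forall a b, 0 < a -> a <= b -> a / omega a <= b / omega b.
Hypothesis phi_ge1 : forall s, 0 <= s -> 1 <= phi s.
Hypothesis phi_lim :
  s * (phi (s / Num.sqrt (omega (1 / s))))^-1 @[s --> +oo] --> +oo.

Let omega_gt0 (s : R) : 0 < s -> 0 < omega s.
Proof. by move=> s0; rewrite -omega0 omega_increasing. Qed.

Let omega_ndecr (a b : R) : 0 <= a -> a <= b -> omega a <= omega b.
Proof.
by move=> a0; rewrite le_eqVlt => /predU1P[->//|ab]; rewrite ltW// omega_increasing.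
Qed.

Lemma omega_small (e : R) : 0 < e -> exists2 d, 0 < d & omega d < e.
Proof.
move=> e0; have [_] := proj1 (continuous_within_itvcyP 0 omega) omega_cont.
rewrite omega0 => /cvgrPdist_lt /(_ e e0) /= H.
near (0 : R)^'+ => d; exists d; first by near: d; exact: nbhs_right_gt.
rewrite (le_lt_trans (ler_norm _))// -normrN -sub0r.
by near: d.
Unshelve. all: by end_near. Qed.

(** On its block a mode [l] sees a coefficient close to [omega (1 / s)], so it resonates at the
    frequency [s] solving this implicit equation. With [x = 1 / s] the equation reads
    [x * Num.sqrt (omega x) = 1 / l], which the intermediate value theorem solves. *)
Lemma frequency (l : R) : 0 < l ->
  exists s, 0 < s /\ s = l * Num.sqrt (omega (1 / s)).
Proof.
move=> l0; have w1 := omega_gt0 ltr01.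
have sw1 : 0 < Num.sqrt (omega 1) by rewrite sqrtr_gt0.
pose X := Num.max 1 (1 / (l * Num.sqrt (omega 1))).
have X1 : 1 <= X by rewrite le_max lexx.
have X0 : 0 <= X by rewrite (le_trans ler01).
have fc : {within `[0, X], continuous (fun x => x * Num.sqrt (omega x) : R)}.
  have cw : {within `[0, X], continuous omega}.
    apply: continuous_subspaceW omega_cont => x /=.
    by rewrite !in_itv/= andbT => /andP[].
  apply/subspace_continuousP => x xX; apply: cvgM; first exact: cvg_within.
  apply: (@continuous_cvg _ _ _ _ _ _ Num.sqrt); first exact: sqrt_continuous.
  exact: (proj1 (subspace_continuousP _ _) cw).
have sX : Num.sqrt (omega 1) <= Num.sqrt (omega X).
  by rewrite ler_wsqrtr// omega_ndecr.
have [|x] := @IVT R (fun x => x * Num.sqrt (omega x)) 0 X (1 / l) X0 fc.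
  rewrite mul0r ge_min (ltW (divr_gt0 ltr01 l0))/= le_max; apply/orP; right.
  have : 1 / (l * Num.sqrt (omega 1)) <= X by rewrite le_max lexx orbT.
  rewrite ler_pdivrMr ?mulr_gt0// => h.
  rewrite ler_pdivrMr//; apply: (le_trans h).
  rewrite mulrAC -mulrA; apply: ler_wpM2l => //.
  by rewrite ler_wpM2l// ltW.
rewrite in_itv/= => /andP[x0 _] xl.
have x_gt0 : 0 < x.
  rewrite lt_neqAle x0 andbT; apply/eqP => z; move: xl; rewrite -z mul0r => /esym/eqP.
  by rewrite mulf_eq0 oner_eq0/= invr_eq0 gt_eqF.
exists (1 / x); split; first by rewrite divr_gt0.
have -> : 1 / (1 / x) = x by rewrite !div1r invrK.
have -> : Num.sqrt (omega x) = 1 / l / x by rewrite -xl mulrC mulKf// gt_eqF.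
by field; rewrite !gt_eqF.
Qed.

Let freq_ex : exists f : R -> R, forall l, 0 < l ->
  0 < f l /\ f l = l * Num.sqrt (omega (1 / f l)).
Proof.
have /choice[f Hf] l : exists s, 0 < l -> 0 < s /\ s = l * Num.sqrt (omega (1 / s)).
  have [l0|l0] := ltP 0 l; last by exists 0.
  by have [s Hs] := frequency l0; exists s.
by exists f.
Qed.

Definition freq : R -> R := sval (cid freq_ex).

Lemma freq_gt0 l : 0 < l -> 0 < freq l.
Proof. by move=> /(svalP (cid freq_ex) l)[]. Qed.

Lemma freqE l : 0 < l -> freq l = l * Num.sqrt (omega (1 / freq l)).
Proof. by move=> /(svalP (cid freq_ex) l)[]. Qed.

Lemma freqV l : 0 < l -> l = freq l / Num.sqrt (omega (1 / freq l)).
Proof.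
move=> l0; have := freqE l0.
have : 0 < Num.sqrt (omega (1 / freq l)).
  by rewrite sqrtr_gt0 omega_gt0// divr_gt0// freq_gt0.
by set w := Num.sqrt _ => w0 ->; rewrite mulfK// gt_eqF.
Qed.

(** If [freq l <= S] then [l * Num.sqrt (omega (1 / S)) <= freq l <= S], which bounds [l]. *)
Lemma freq_large S : exists M, forall l, M < l -> 0 < l -> S < freq l.
Proof.
have [S0|S0] := ltP 0 S; last first.
  by exists 0 => l _ /freq_gt0; exact: le_lt_trans.
exists (S / Num.sqrt (omega (1 / S))) => l Ml l0; rewrite ltNge; apply/negP => lS.
have w0 : 0 < Num.sqrt (omega (1 / S)) by rewrite sqrtr_gt0 omega_gt0// divr_gt0.
move: Ml; rewrite ltr_pdivrMr// ltNge => /negP; apply; apply: (le_trans _ lS).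
rewrite (freqE l0) ler_wpM2l ?(ltW l0)// ler_wsqrtr// omega_ndecr//.
  by rewrite divr_ge0// ltW.
by have f0 := freq_gt0 l0; rewrite !div1r lef_pV2 ?posrE.
Qed.

(* The total amplification and loss of a mode after its block, which is governed
   by the frequency [s] of the preceding mode. *)
Definition gain (s : R) : R :=
  6 * expR ((1 + 2 * s) * 2 / omega (1 / s)) / omega (1 / s).

(* Requirements on the frequency [s] of the [k]-th mode; [Q] is the [gain] of the
   preceding one. *)
Definition admissible (k : nat) (Q s : R) : Prop :=
  let d := omega (1 / s) in let l := s / Num.sqrt d in
  [/\ d <= (1 / 64) ^+ k.+1, pi <= s * (1 / 64) ^+ k / 2,
      32 * k%:R * phi l <= s * (1 / 64) ^+ k,
      Q ^+ 2 <= l * d / (8 * 2 ^+ k) &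
      (Q * (8 * 2 ^+ k) + k%:R) ^+ k <= l /\ 1 <= l].

(** In order, the conditions fit the staircase under the time scales, leave room for a half-period
    in the block, beat the Gevrey weight, keep the mode large in [V_1] after its block, and make the
    loss smaller than a small power of [l]. Each is a largeness condition on [s]. The third is the
    limit assumed on [phi]. The fourth rests on [(l * d) ^+ 2 = s ^+ 2 * omega (1 / s) >= s * omega
    1], which comes from the monotonicity of [s / omega s]. *)
Lemma admissible_eventually k Q : exists S, forall s, S <= s -> 0 < s -> admissible k Q s.
Proof.
have w1 := omega_gt0 ltr01.
have r0 : 0 < (1 / 64 : R) ^+ k by rewrite exprn_gt0// divr_gt0.
have [x0 x00 wx0] := omega_small (exprn_gt0 k.+1 (divr_gt0 ltr01 (ltr0n R 64))).
have [M HM] : exists M, forall s, M < s -> 32 * k%:R / (1 / 64) ^+ k <=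
    s * (phi (s / Num.sqrt (omega (1 / s))))^-1.
  have /cvgryPge /(_ (32 * k%:R / (1 / 64) ^+ k)) [M [_ HM]] := phi_lim.
  by exists M => s /HM.
have growth s : 1 <= s -> s <= (s / Num.sqrt (omega (1 / s))) * Num.sqrt (omega 1) /\
    s * omega 1 <= ((s / Num.sqrt (omega (1 / s))) * omega (1 / s)) ^+ 2.
  move=> s1; have s0 : 0 < s by rewrite (lt_le_trans ltr01).
  have sV : 1 / s <= 1 by rewrite ler_pdivrMr ?mul1r.
  have sV0 : 0 < 1 / s by rewrite divr_gt0.
  have w0 := omega_gt0 sV0.
  split.
    rewrite mulrAC ler_pdivlMr ?sqrtr_gt0// ler_wpM2l ?(ltW s0)// ler_wsqrtr//.
    by rewrite omega_ndecr// ltW.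
  have -> : (s / Num.sqrt (omega (1 / s)) * omega (1 / s)) ^+ 2 = s ^+ 2 * omega (1 / s).
    by rewrite exprMn expr_div_n sqr_sqrtr ?(ltW w0)//; field; rewrite gt_eqF.
  have := omega_ratio sV0 sV.
  rewrite ler_pdivrMr// mulrAC ler_pdivlMr// !mul1r ler_pdivrMl//.
  by move=> h; rewrite expr2 -mulrA ler_wpM2l ?(ltW s0).
pose C6 := (Q * (8 * 2 ^+ k) + k%:R) ^+ k.
pose C5 := (Q ^+ 2 * (8 * 2 ^+ k)) ^+ 2 / omega 1.
(* The sum of absolute values dominates every threshold in the list and replaces an iterated
   maximum. *)
pose S := \sum_(x <- [:: 1; 1 / x0; 2 * pi / (1 / 64) ^+ k; M + 1; C5;
                       C6 * Num.sqrt (omega 1); Num.sqrt (omega 1)]) `|x| : R.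
have HS x : x \in [:: 1; 1 / x0; 2 * pi / (1 / 64) ^+ k; M + 1; C5;
                       C6 * Num.sqrt (omega 1); Num.sqrt (omega 1)] -> x <= S.
  move=> xin; apply: (le_trans (ler_norm x)).
  by rewrite /S (big_rem x)//= lerDl sumr_ge0.
exists S => s Ss s0.
have ge x xin : x <= s := le_trans (HS x xin) Ss.
have s1 : 1 <= s by apply: ge; rewrite !inE eqxx ?orbT.
have [g1 g2] := growth s s1.
have d0 : 0 < omega (1 / s) by rewrite omega_gt0// divr_gt0.
set d := omega (1 / s) in g1 g2 d0 *; set l := s / Num.sqrt d in g1 g2 *.
have l0 : 0 < l by rewrite divr_gt0// sqrtr_gt0.
have sw1 : 0 < Num.sqrt (omega 1) by rewrite sqrtr_gt0.
have ld0 : 0 < 8 * 2 ^+ k :> R by rewrite mulr_gt0// exprn_gt0.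
rewrite /admissible -/d -/l; split.
- apply: le_trans (ltW wx0); rewrite omega_ndecr ?divr_ge0 ?(ltW s0)//.
  rewrite ler_pdivrMr// mulrC -ler_pdivrMr//.
  by apply: ge; rewrite !inE eqxx ?orbT.
- rewrite ler_pdivlMr// mulrC -ler_pdivrMr//.
  by apply: ge; rewrite !inE eqxx ?orbT.
- have : M < s.
    apply: lt_le_trans (_ : M + 1 <= _); first by rewrite ltrDl.
    by apply: ge; rewrite !inE eqxx ?orbT.
  move=> /HM; rewrite -/d -/l.
  have p0 : 0 < phi l by rewrite (lt_le_trans ltr01)// phi_ge1// ltW.
  by rewrite ler_pdivrMr// mulrAC ler_pdivlMr.
- rewrite ler_pdivlMr// -(ler_pXn2r (ltn0Sn 1)) ?nnegrE; last 2 first.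
  + by rewrite mulr_ge0 ?sqr_ge0// ltW.
  + by rewrite mulr_ge0// ltW.
  apply: le_trans g2; rewrite -ler_pdivrMr//.
  by apply: ge; rewrite !inE eqxx ?orbT.
- split; rewrite -(ler_pM2r sw1) ?mul1r; apply: le_trans g1;
  by apply: ge; rewrite !inE eqxx ?orbT.
Qed.

Lemma frequency_sequence : exists n : nat -> nat,
  [/\ forall j k, (j < k)%N -> freq (lam (n j)) < freq (lam (n k)),
      forall k, exists Q, admissible k Q (freq (lam (n k))) &
      forall k, admissible k.+1 (gain (freq (lam (n k)))) (freq (lam (n k.+1)))].
Proof.
have /choice[f Hf] (p : nat * nat) : exists n', freq (lam p.2) < freq (lam n') /\
    admissible p.1 (gain (freq (lam p.2))) (freq (lam n')).
  have [S HS] := admissible_eventually p.1 (gain (freq (lam p.2))).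
  have [M HM] := freq_large (Num.max S (freq (lam p.2))).
  have [n' Hn'] := lam_unbounded M.
  have := HM _ Hn' (lam_gt0 n'); rewrite gt_max => /andP[h1 h2].
  by exists n'; split => //; apply: HS; [exact: ltW|exact: freq_gt0].
(* The 0-th index has no predecessor; eigenvalue 0 serves as a dummy one. *)
pose n := fix n k := if k is j.+1 then f (j.+1, n j) else f (0%N, 0%N).
have nS k : n k.+1 = f (k.+1, n k) by [].
exists n; split.
- move=> j k; elim: k => // k IH; rewrite ltnS leq_eqVlt => /predU1P[->|/IH].
    by rewrite nS; have [] := Hf (k.+1, n k).
  by move=> /lt_trans; apply; rewrite nS; have [] := Hf (k.+1, n k).
- case=> [|k]; first by exists (gain (freq (lam 0))); have [] := Hf (0%N, 0%N).
  by exists (gain (freq (lam (n k)))); rewrite nS; have [] := Hf (k.+1, n k).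
- by move=> k; rewrite nS; have [] := Hf (k.+1, n k).
Qed.

Lemma nat_floor (x : R) : 1 <= x -> exists N : nat, N.+1%:R <= x < N.+2%:R.
Proof.
move=> x1; have x0 : 0 <= x by rewrite (le_trans ler01).
have := truncn_itv x0; case: (Num.truncn x) => [|N] H.
  by move: H => /andP[_]; rewrite ltNge x1.
by exists N.
Qed.

(** After block [k.+1], mode [k.+1] meets only the blocks [j <= k], where the constants of [c] are
    known before [l k.+1] is chosen; this makes the recursive choice possible. The bound on [Z] says
    that the loss is at most [l k.+1] to the power [1 / k.+1], hence eventually below any fixed
    positive power. *)
Lemma modes : exists (n : nat -> nat) (c : R -> R) (w w' : nat -> R -> R),
  let l k := lam (n k) in
  [/\ injective n, forall k, 1 <= l k,
      forall t, 0 <= c t <= 1,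
      exists2 C, 0 <= C & forall s t, 0 <= s -> 0 <= t -> `|c s - c t| <= C * omega `|s - t| &
  [/\ forall k (t : R), 0 <= t -> is_derive t 1 (w k) (w' k t) /\
        is_derive t 1 (w' k) (- (l k ^+ 2 * c t * w k t)),
      w 0 0 = 1 /\ w' 0 0 = 1,
      forall k t, 0 <= t <= 1 ->
        l k.+1 * (w' k.+1 t ^+ 2 + l k.+1 ^+ 2 * w k.+1 t ^+ 2) <= 1 / (8 * 2 ^+ k.+1),
      forall k, l k.+1 * (w' k.+1 0 ^+ 2 + l k.+1 ^+ 2 * w k.+1 0 ^+ 2) *
        expR (k.+1%:R * phi (l k.+1)) <= 1 / (8 * 2 ^+ k.+1) &
  (forall t, 0 < t <= 1 -> exists K, forall k, (K <= k)%N ->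
        1 <= l k.+1 ^+ 2 * (w' k.+1 t ^+ 2 + l k.+1 ^+ 2 * w k.+1 t ^+ 2)) /\
  exists tau : nat -> R, [/\ forall k, 0 < tau k <= (1 / 64) ^+ k.+1 &
    forall k, exists2 Z, 0 < Z & (Z + k.+1%:R) ^+ k.+1 <= l k.+1 /\
      3 / 4 <= Z * l k.+1 * (l k.+1 ^+ 2 * w k.+1 (tau k) ^+ 2)]]].
Proof.
have [n [n_incr n_ok adm]] := frequency_sequence.
pose l k := lam (n k); pose sg k := freq (l k); pose dl k := omega (1 / sg k).
have l0 k : 0 < l k by exact: lam_gt0.
have sg0 k : 0 < sg k by exact: freq_gt0.
have sV0 k : 0 < 1 / sg k by rewrite divr_gt0.
have dl0 k : 0 < dl k by exact: omega_gt0.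
have sdl0 k : 0 < Num.sqrt (dl k) by rewrite sqrtr_gt0.
have lE k : l k = sg k / Num.sqrt (dl k) by exact: freqV.
have lsq k : l k ^+ 2 * dl k = sg k ^+ 2.
  by rewrite lE expr_div_n sqr_sqrtr ?(ltW (dl0 k))// divfK// gt_eqF.
have l1 k : 1 <= l k.
  by have [Q []] := n_ok k; rewrite -/(l k) -/(sg k) -/(dl k) -lE => _ _ _ _ [].
have r0 k : 0 < (1 / 64 : R) ^+ k by rewrite exprn_gt0// divr_gt0.
have dl_le k : dl k <= (1 / 64) ^+ k.+1 by have [Q []] := n_ok k.
have sg_le j k : (j <= k)%N -> sg j <= sg k.
  by rewrite leq_eqVlt => /predU1P[->//|/n_incr/ltW].
have dl_nincr j k : (j <= k)%N -> dl k <= dl j.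
  move=> jk; apply: omega_ndecr; first exact: ltW.
  by rewrite !div1r lef_pV2 ?posrE ?sg_le.
have r1 k : (1 / 64 : R) ^+ k <= 1 by rewrite exprn_ile1//; lra.
have dl1 k : dl k <= 1 by rewrite (le_trans (dl_le k)).
have /choice[N HN] k : exists N : nat, N.+1%:R * pi <= sg k * (1 / 64) ^+ k / 2 /\
     sg k * (1 / 64) ^+ k / 2 < N.+2%:R * pi.
  have p0 := pi_gt0 R.
  have [|N /andP[h1 h2]] := @nat_floor (sg k * (1 / 64) ^+ k / 2 / pi).
    by rewrite ler_pdivlMr // [leLHS]mul1r; have [Q []] := n_ok k.
  by exists N; rewrite -ler_pdivlMr// -ltr_pdivrMr.
have N_le k : (N k).+1%:R * pi <= sg k * (1 / 64) ^+ k / 2 by have [] := HN k.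
pose c := coef sg dl (fun k => (N k).+1).
pose st k := @block_start R k; pose en k := block_end sg (fun k => (N k).+1) k.
have c01 t : 0 <= c t <= 1 by exact: coef_bounds.
have cmod s t : 0 <= s -> 0 <= t -> `|c s - c t| <= ((omega 1)^-1 + 2) * omega `|s - t|.
  by apply: coef_modulus => //; exact: omega_gt0.
have C0 : 0 <= (omega 1)^-1 + 2 by rewrite addr_ge0// invr_ge0 omega_ge0.
have cc : cont0 c.
  move=> t; apply/cvgrPdist_lt => e e0.
  have C1 : 0 < (omega 1)^-1 + 2 + 1 by lra.
  have [d d0 Hd] := omega_small (divr_gt0 e0 C1).
  exists d => //= s /= ts.
  have mx (x : R) : 0 <= Num.max 0 x by rewrite le_max lexx.
  apply: (le_lt_trans (cmod _ _ (mx t) (mx s))).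
  have h : `|Num.max 0 t - Num.max 0 s| <= d.
    apply: le_trans (ltW ts).
    have [t0|t0] := leP 0 t; have [s0|s0] := leP 0 s.
    - by [].
    - by rewrite subr0 ger0_norm// (le_trans _ (ler_norm _))//; lra.
    - by rewrite sub0r normrN ger0_norm// distrC (le_trans _ (ler_norm _))//; lra.
    - by rewrite subrr normr0.
  have := omega_ndecr (normr_ge0 _) h => h1.
  apply: (le_lt_trans (ler_wpM2l C0 h1)).
  apply: (@le_lt_trans _ _ (((omega 1)^-1 + 2 + 1) * omega d)).
    by rewrite ler_wpM2r ?omega_ge0 ?(ltW d0)//; lra.
  by rewrite mulrC -ltr_pdivlMr//; lra.
have sub k : en k.+1 <= st k.
  rewrite /en /st /block_start; apply: (le_trans (block_end_le sg0 N_le k.+1)).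
  by have := r0 k.+1; lra.
have st1 k : st k <= 1 by rewrite /st /block_start exprS; have := r1 k; have := r0 k; lra.
have st0 k : 0 <= st k by rewrite /st /block_start mulr_ge0// ltW.
(* Makes the upper bound of [component_exists], multiplied by [l k.+1], exactly the summable
   [1 / (8 * 2 ^+ k.+1)]; this equality is [Pdl] below. *)
pose P k := Num.sqrt (1 / (8 * 2 ^+ k.+1) * dl k.+1 / (gain (sg k) * l k.+1)).
have gain6 s : 0 < s -> omega (1 / s) <= 1 -> expR 1 <= gain s /\
    expR (- ((1 + 2 * s) / (omega (1 / s) / 2))) >= (gain s)^-1.
  move=> s0 w1; have w0 : 0 < omega (1 / s) by rewrite omega_gt0// divr_gt0.
  have e0 : (1 + 2 * s) * 2 / omega (1 / s) = (1 + 2 * s) / (omega (1 / s) / 2).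
    by field; rewrite gt_eqF.
  have e1 : 1 <= (1 + 2 * s) * 2 / omega (1 / s) by rewrite ler_pdivlMr// [leLHS]mul1r; lra.
  have e2 : expR ((1 + 2 * s) * 2 / omega (1 / s)) <= gain s.
    rewrite /gain ler_pdivlMr// mulrC ler_wpM2r ?expR_ge0//; lra.
  split; first by apply: le_trans e2; rewrite ler_expR.
  rewrite expRN -e0 lef_pV2 ?posrE ?expR_gt0//.
  by apply: lt_le_trans e2; exact: expR_gt0.
have gain0 k : 0 < gain (sg k).
  by have [h _] := gain6 _ (sg0 k) (dl1 k); apply: lt_le_trans h; exact: expR_gt0.
have eta0 k : 0 < 8 * 2 ^+ k :> R by rewrite mulr_gt0// exprn_gt0.
have Parg k : 0 < 1 / (8 * 2 ^+ k.+1) * dl k.+1 / (gain (sg k) * l k.+1).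
  by apply: divr_gt0; [apply: mulr_gt0 => //; apply: divr_gt0|apply: mulr_gt0].
have PE k : P k ^+ 2 = 1 / (8 * 2 ^+ k.+1) * dl k.+1 / (gain (sg k) * l k.+1).
  by rewrite /P sqr_sqrtr// ltW.
have comp k : exists uu : (R -> R) * (R -> R), let u := uu.1 in let u' := uu.2 in
  [/\ forall t : R, 0 <= t -> is_derive t 1 u (u' t),
  forall t : R, 0 <= t -> is_derive t 1 u' (- (l k.+1 ^+ 2 * c t * u t)),
  forall t, 0 <= t <= st k.+1 ->
    u' t ^+ 2 + l k.+1 ^+ 2 * u t ^+ 2 <=
    P k ^+ 2 / dl k.+1 * expR (sg k.+1 * st k.+1 - (N k.+1).+1%:R * pi / 8),
  forall t, st k.+1 <= t <= 1 ->
    u' t ^+ 2 + l k.+1 ^+ 2 * u t ^+ 2 <= P k ^+ 2 / dl k.+1 * gain (sg k) &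
  (forall t, en k.+1 <= t <= 1 ->
    P k ^+ 2 / gain (sg k) <= u' t ^+ 2 + l k.+1 ^+ 2 * u t ^+ 2) /\
  exists2 tau, st k.+1 <= tau <= en k.+1 &
    P k ^+ 2 / dl k.+1 * (3 / 4) <= l k.+1 ^+ 2 * u tau ^+ 2].
  (* [gain] is the factor [3 * expR (M / m) / m] of [component_exists] for the lower bound
     [m = dl k / 2] and the Lipschitz constant [M = 1 + 2 * sg k] of [c] after [st k]. *)
  have gE : gain (sg k) =
      3 * expR ((1 + 2 * sg k) / (dl k / 2)) / (dl k / 2).
    rewrite /gain -/(dl k).
    have -> : (1 + 2 * sg k) * 2 / dl k = (1 + 2 * sg k) / (dl k / 2).
      by field; rewrite gt_eqF.
    by field; rewrite gt_eqF.
  have [|||||||||||||||u [u' [h1 h2 h3 h4 [h5 h6]]]] := @component_exists R (l k.+1) (sg k.+1) (dl k.+1) (st k.+1)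
    (en k.+1) (st k) (dl k / 2) (1 + 2 * sg k) (P k) (N k.+1) c cc c01 (sg0 k.+1).
  - exact: dl0.
  - exact: dl1.
  - exact: lsq.
  - exact: st0.
  - by [].
  - exact: sub.
  - exact: st1.
  - by move=> t tin; exact: coef_block.
  - move=> t /andP[t0 ts].
    have /andP[_ h] := coef_profile sg0 dl0 dl_le dl_nincr N_le t.
    apply: (le_trans h).
    have : profile dl t <= dl k.+1.
      apply: profile_le_block => //; apply: (le_trans ts).
      rewrite /st /block_start exprS; have := r0 k.+1; lra.
    have := profile_ge0 dl0 dl_nincr t; lra.
  - move=> a b ea ab bs; rewrite /c.
    have cT t : en k.+1 <= t -> t <= st k -> coef sg dl (fun k => (N k).+1) t = profile dl t.
      by move=> h1 h2; apply: (coef_transition dl sg0 N_le h1 h2).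
    rewrite (cT a ea (le_trans ab bs)) (cT b (le_trans ea ab) bs).
    exact: profile_ndecr.
  - by rewrite divr_gt0.
  - by have := dl1 k; lra.
  - by have := sg0 k; lra.
  - move=> a b sa ab.
    have low t : st k <= t -> dl k / 2 <= c t.
      move=> kt; have /andP[h _] := coef_profile sg0 dl0 dl_le dl_nincr N_le t.
      apply: le_trans h; rewrite ler_pM2r//.
      exact: profile_ge_block.
    split; first exact: low.
    split; first by apply: low; exact: le_trans ab.
    by apply: coef_lip => // j; exact: sg_le.
  - by rewrite sqrtr_gt0.
  exists (u, u'); split => //=; first by rewrite gE.
  split => // t tin; apply: le_trans (h5 t tin).
  rewrite ler_wpM2l ?sqr_ge0//.
  by have [_] := gain6 _ (sg0 k) (dl1 k).
have [uu Huu] := choice comp.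
have c1 (t : R) : 0 <= t -> `|c t| <= 1.
  by move=> _; have /andP[? ?] := c01 t; rewrite ger0_norm.
have [v [v' [v0 v'0 dv dv']]] := linear_ode_exists 1 1 (sqr_ge0 (l 0)) cc c1.
pose w k := if k is j.+1 then (uu j).1 else v.
pose w' k := if k is j.+1 then (uu j).2 else v'.
have Pdl k : l k.+1 * (P k ^+ 2 / dl k.+1 * gain (sg k)) = 1 / (8 * 2 ^+ k.+1).
  by rewrite PE; field; rewrite !gt_eqF ?exprn_gt0.
(* Write [X = sg k.+1 * (1 / 64) ^+ k.+1]. The time before the block costs [X / 32]; the phase of
   the block exceeds [X / 2 - pi] and yields more than [X / 16 - pi / 8], with [pi / 8 <= 1]. The
   surplus [X / 32] is what the third condition of [admissible] compares with the Gevrey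
   exponent. *)
have expo k : sg k.+1 * st k.+1 - (N k.+1).+1%:R * pi / 8 <=
    1 - sg k.+1 * (1 / 64) ^+ k.+1 / 32.
  have [_] := HN k.+1; have := pihalf_lt2 R; rewrite /st /block_start (exprS _ k.+1).
  have -> : (N k.+1).+2%:R * pi = (N k.+1).+1%:R * pi + pi :> R.
    by rewrite -[(N k.+1).+2%:R]natr1; ring.
  move=> h1 h2.
  have -> : sg k.+1 * (2 * (1 / 64 * (1 / 64) ^+ k.+1)) = sg k.+1 * (1 / 64) ^+ k.+1 / 32.
    by field.
  by move: h2; set X := sg k.+1 * _; lra.
have X0 k : 0 <= sg k.+1 * (1 / 64) ^+ k.+1 / 32.
  by rewrite divr_ge0// mulr_ge0// ltW.
have PdlN k : 0 <= P k ^+ 2 / dl k.+1 by rewrite divr_ge0 ?sqr_ge0// ltW.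
have n_inj : injective n.
  by move=> i j ij; case: (ltngtP i j) => // /n_incr; rewrite ij ltxx.
exists n, c, w, w'; split.
- exact: n_inj.
- exact: l1.
- exact: c01.
- by exists ((omega 1)^-1 + 2).
split.
- case=> [|k] t t0; first by split; [exact: dv|exact: dv'].
  by have [h1 h2 _ _ _] := Huu k; split; [exact: h1|exact: h2].
- by [].
- move=> k t /andP[t0 t1]; rewrite -/(l k.+1) -(Pdl k) ler_wpM2l ?(ltW (l0 _))//.
  have [_ _ h3 h4 _] := Huu k.
  have [ts|st_] := leP t (st k.+1); last by apply: h4; rewrite ltW.
  have := h3 t; rewrite t0 ts => /(_ isT) /le_trans; apply.
  rewrite ler_wpM2l//; have [h _] := gain6 _ (sg0 k) (dl1 k); apply: le_trans h.
  by rewrite ler_expR (le_trans (expo k))//; have := X0 k; lra.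
- move=> k; rewrite -/(l k.+1) -(Pdl k) -mulrA ler_wpM2l ?(ltW (l0 _))//.
  have [_ _ h3 _ _] := Huu k.
  have := h3 0; rewrite lexx st0 => /(_ isT) h.
  apply: (le_trans (ler_wpM2r (expR_ge0 _) h)).
  rewrite -[leLHS]mulrA ler_wpM2l// -expRD.
  have [hg _] := gain6 _ (sg0 k) (dl1 k); apply: le_trans hg; rewrite ler_expR.
  have [_ _ + _ _] := adm k; rewrite -/(l k.+1) -/(sg k.+1) -/(dl k.+1) -lE => hphi.
  have := expo k; lra.
split.
- move=> t /andP[t0 t1].
  have [K HK] : exists K : nat, (1 / 64 : R) ^+ K < t.
    have [K HK] := geometric_small 1 t0; exists K; apply: le_lt_trans HK.
    by rewrite expr_div_n expr1n ler_pM2l// lef_pV2 ?posrE ?exprn_gt0// lerXn2r ?nnegrE// ler_nat.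
  exists K => k Kk; rewrite -/(l k.+1).
  have [_ _ _ _ [h5 _]] := Huu k.
  have ekt : en k.+1 <= t.
    apply: le_trans (ltW HK); apply: (le_trans (block_end_le sg0 N_le k.+1)).
    by rewrite ler_wiXn2l//; [lra|rewrite ltnW].
  have := h5 t; rewrite ekt t1 => /(_ isT) /(ler_wpM2l (sqr_ge0 (l k.+1))).
  apply: le_trans; rewrite PE.
  have [_ _ _ + _] := adm k; rewrite -/(l k.+1) -/(sg k) -/(sg k.+1) -/(dl k.+1) -lE.
  have -> : l k.+1 ^+ 2 * (1 / (8 * 2 ^+ k.+1) * dl k.+1 / (gain (sg k) * l k.+1) / gain (sg k))
    = (l k.+1 * dl k.+1 / (8 * 2 ^+ k.+1)) / gain (sg k) ^+ 2.
    by field; rewrite !gt_eqF ?exprn_gt0.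
  by move=> h; rewrite ler_pdivlMr ?exprn_gt0// mul1r.
have /choice[tau Htau] k : exists tau, st k.+1 <= tau <= en k.+1 /\
    P k ^+ 2 / dl k.+1 * (3 / 4) <= l k.+1 ^+ 2 * (uu k).1 tau ^+ 2.
  by have [_ _ _ _ [_ [tau]]] := Huu k; exists tau.
exists tau; split.
  move=> k; have [/andP[h1 h2] _] := Htau k.
  rewrite (lt_le_trans _ h1)/=; last by rewrite /st /block_start mulr_gt0.
  by rewrite (le_trans h2)// (block_end_le sg0 N_le k.+1).
(* By the choice of [P], this is the reciprocal of [l k.+1 * (P k ^+ 2 / dl k.+1)], so that the
   lower bound at [tau k] becomes [3 / 4]. *)
move=> k; exists (gain (sg k) * (8 * 2 ^+ k.+1)); first exact: mulr_gt0.
rewrite -/(l k.+1); split.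
  by have [_ _ _ _ []] := adm k; rewrite -/(l k.+1) -/(sg k) -/(sg k.+1) -/(dl k.+1) -lE.
have [_ h] := Htau k; have h0 : 0 <= gain (sg k) * (8 * 2 ^+ k.+1) * l k.+1.
  exact: ltW (mulr_gt0 (mulr_gt0 (gain0 k) (eta0 k.+1)) (l0 k.+1)).
apply: le_trans (ler_wpM2l h0 h); rewrite PE le_eqVlt; apply/orP; left; apply/eqP.
by field; rewrite !gt_eqF ?exprn_gt0.
Qed.

End modes.

(** * Orthonormal series *)

Section inner_product_theory.
Variables (R : realType) (H : completeNormedModType R) (ip : H -> H -> R).
Hypothesis ip_inner : inner_product ip.
Implicit Types x y z : H.

Lemma ipC x y : ip x y = ip y x. Proof. by case: ip_inner. Qed.

Lemma ip_norm x : ip x x = `|x| ^+ 2. Proof. by case: ip_inner. Qed.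

Lemma ipDl x y z : ip (x + y) z = ip x z + ip y z.
Proof. by case: ip_inner => /(_ 1 x y z); rewrite scale1r mul1r. Qed.

Lemma ip0l z : ip 0 z = 0.
Proof. by have := ipDl 0 0 z; rewrite addr0 => /eqP; rewrite -subr_eq subrr eq_sym => /eqP. Qed.

Lemma ipZl a x z : ip (a *: x) z = a * ip x z.
Proof. by case: ip_inner => /(_ a x 0 z); rewrite addr0 ip0l addr0. Qed.

Lemma ipNl x z : ip (- x) z = - ip x z.
Proof. by rewrite -scaleN1r ipZl mulN1r. Qed.

Lemma ipBl x y z : ip (x - y) z = ip x z - ip y z.
Proof. by rewrite ipDl ipNl. Qed.

Lemma ip0r z : ip z 0 = 0. Proof. by rewrite ipC ip0l. Qed.

Lemma ipDr x y z : ip z (x + y) = ip z x + ip z y.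
Proof. by rewrite ![ip z _]ipC ipDl. Qed.

Lemma ipZr a x z : ip z (a *: x) = a * ip z x.
Proof. by rewrite ![ip z _]ipC ipZl. Qed.

Lemma ipNr x z : ip z (- x) = - ip z x.
Proof. by rewrite ![ip z _]ipC ipNl. Qed.

Definition ipE := (ipDl, ipDr, ipNl, ipNr, ipZl, ipZr).

Lemma ip_suml I (r : seq I) (F : I -> H) z :
  ip (\sum_(i <- r) F i) z = \sum_(i <- r) ip (F i) z.
Proof. exact: (big_morph (ip^~ z) (fun x y => ipDl x y z) (ip0l z)). Qed.

Lemma ip_sumr I (r : seq I) (F : I -> H) z :
  ip z (\sum_(i <- r) F i) = \sum_(i <- r) ip z (F i).
Proof. by rewrite ipC ip_suml; apply: eq_bigr => i _; exact: ipC. Qed.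

Lemma normD_sqr x y : `|x + y| ^+ 2 = `|x| ^+ 2 + 2 * ip x y + `|y| ^+ 2.
Proof. by rewrite -!ip_norm !ipE (ipC y x); ring. Qed.

Lemma normB_sqr x y : `|x - y| ^+ 2 = `|x| ^+ 2 - 2 * ip x y + `|y| ^+ 2.
Proof. by rewrite -!ip_norm !ipE (ipC y x); ring. Qed.

Lemma cauchy_schwarz x y : `|ip x y| <= `|x| * `|y|.
Proof.
have [->|y0] := eqVneq y 0; first by rewrite ip0r !normr0 mulr0.
have ny : 0 < `|y| by rewrite normr_gt0.
rewrite -(ler_pXn2r (ltn0Sn 1)) ?nnegrE ?mulr_ge0// exprMn real_normK ?num_real//.
pose a := ip x y / `|y| ^+ 2.
have := sqr_ge0 `|x - a *: y|.
rewrite normB_sqr ipZr normrZ exprMn real_normK ?num_real//.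
have -> : `|x| ^+ 2 - 2 * (a * ip x y) + a ^+ 2 * `|y| ^+ 2
    = (`|x| ^+ 2 * `|y| ^+ 2 - ip x y ^+ 2) / `|y| ^+ 2.
  by rewrite /a; field; rewrite normr_eq0.
by rewrite pmulr_lge0 ?invr_gt0 ?exprn_gt0// subr_ge0.
Qed.

Lemma cvg_ip (T : Type) (F : set_system T) (FF : Filter F) (u : T -> H) x z :
  u @ F --> x -> ip (u t) z @[t --> F] --> ip x z.
Proof.
move=> /cvgrPdist_lt ux; apply/cvgrPdist_lt => e e0.
have z1 : 0 < `|z| + 1 by rewrite ltr_wpDl.
apply: filterS (ux _ (divr_gt0 e0 z1)) => t xt.
rewrite -ipBl (le_lt_trans (cauchy_schwarz _ _))//.
apply: (@le_lt_trans _ _ (`|x - u t| * (`|z| + 1))).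
  by rewrite ler_wpM2l// lerDl.
by rewrite -ltr_pdivlMr.
Qed.

(** The squared distances are bounded by increments of a bounded nondecreasing real sequence, so the
    supremum of [a] controls the tails. It serves both orthonormal series and the approximations of
    spectral integrals. *)
Lemma hilbert_cvg (x : nat -> H) (a : nat -> R) :
  (forall n m, (n <= m)%N -> `|x m - x n| ^+ 2 <= a m - a n) ->
  (exists B, forall n, a n <= B) -> cvgn x.
Proof.
move=> xa [B aB]; apply/cauchy_cvgP/cauchy_exP => eps eps0.
have hS : has_sup (range a) by split; [exists (a 0%N), 0%N | exists B => _ [n _ <-]].
have [_ [N _ <-] HN] := sup_adherent (exprn_gt0 2 eps0) hS.
exists (x N); exists N => // n /= Nn.
rewrite -ball_normE /ball_/= -(ltr_pXn2r (ltn0Sn 1)) ?nnegrE ?(ltW eps0)//.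
rewrite distrC (le_lt_trans (xa _ _ Nn))//.
have : a n <= sup (range a) by apply: ub_le_sup; [case: hS|exists n].
by move: HN; lra.
Qed.

Section orthonormal.
Variable e : nat -> H.
Hypothesis e_orthonormal : forall i j, ip (e i) (e j) = (i == j)%:R.

Definition partial_vec (xi : nat -> R) (n : nat) : H := \sum_(0 <= k < n) xi k *: e k.
Definition vec (xi : nat -> R) : H := limn (partial_vec xi).

Lemma ip_partial_e xi n k : ip (partial_vec xi n) (e k) = if (k < n)%N then xi k else 0.
Proof.
rewrite ip_suml; under eq_bigr do rewrite ipZl e_orthonormal.
have [kn|nk] := ltnP k n.
  rewrite (bigD1_seq k) ?mem_index_iota ?iota_uniq//= eqxx mulr1 big1 ?addr0// => i ik.
  by rewrite (negbTE ik) mulr0.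
rewrite big_seq big1// => i; rewrite mem_index_iota => /andP[_ iN].
by rewrite (ltn_eqF (leq_trans iN nk)) mulr0.
Qed.

Lemma ip_partial xi n z : ip (partial_vec xi n) z = \sum_(0 <= k < n) xi k * ip (e k) z.
Proof. by rewrite ip_suml; apply: eq_bigr => k _; rewrite ipZl. Qed.

Lemma norm_partial xi n : `|partial_vec xi n| ^+ 2 = \sum_(0 <= k < n) xi k ^+ 2.
Proof.
rewrite -ip_norm ip_partial; rewrite !big_seq; apply: eq_bigr => k.
rewrite mem_index_iota => /andP[_ kn].
by rewrite ipC ip_partial_e kn expr2.
Qed.

Lemma bessel x n : \sum_(0 <= k < n) ip x (e k) ^+ 2 <= `|x| ^+ 2.
Proof.
pose xi k := ip x (e k).
have := sqr_ge0 `|x - partial_vec xi n|; rewrite normB_sqr norm_partial.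
rewrite ipC ip_partial.
have -> : \sum_(0 <= k < n) xi k * ip (e k) x = \sum_(0 <= k < n) xi k ^+ 2.
  by apply: eq_bigr => k _; rewrite expr2 ipC.
by rewrite -/(\sum_(0 <= k < n) xi k ^+ 2); lra.
Qed.

Definition l2 (xi : nat -> R) := exists B, forall n, \sum_(0 <= k < n) xi k ^+ 2 <= B.

Lemma vec_cvg xi : l2 xi -> partial_vec xi n @[n --> \oo] --> vec xi.
Proof.
move=> [B HB].
suff : cvgn (partial_vec xi) by [].
apply: (@hilbert_cvg _ (fun n => \sum_(0 <= k < n) xi k ^+ 2)); last by exists B.
move=> n m nm; rewrite distrC normB_sqr !norm_partial ipC ip_partial.
suff -> : \sum_(0 <= k < m) xi k * ip (e k) (partial_vec xi n) = \sum_(0 <= k < n) xi k ^+ 2.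
  by rewrite le_eqVlt; apply/orP; left; apply/eqP; ring.
rewrite (big_cat_nat (n:=n))//= [X in _ + X]big_nat_cond [X in _ + X]big1.
  rewrite addr0 !big_nat; apply: eq_bigr => k /andP[_ kn].
  by rewrite ipC ip_partial_e kn expr2.
move=> k /andP[/andP[nk _] _].
by rewrite ipC ip_partial_e ltnNge nk mulr0.
Qed.

Lemma ip_vec_cvg xi z : l2 xi ->
  \sum_(0 <= k < n) xi k * ip (e k) z @[n --> \oo] --> ip (vec xi) z.
Proof.
move=> xi2; have h := @cvg_ip _ _ eventually_filter (partial_vec xi) _ z (vec_cvg xi2).
suff -> : (fun n => \sum_(0 <= k < n) xi k * ip (e k) z) = (fun n => ip (partial_vec xi n) z) by exact: h.
by apply/funext => n; rewrite ip_partial.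
Qed.

Lemma ip_vec_e xi k : l2 xi -> ip (vec xi) (e k) = xi k.
Proof.
move=> xi2; have h := @cvg_ip _ _ eventually_filter (partial_vec xi) _ (e k) (vec_cvg xi2).
rewrite -(cvg_lim _ h)//.
apply: (@lim_near_cst R) => //.
by exists k.+1 => // n /= kn; rewrite ip_partial_e kn.
Qed.

Lemma norm_vec_cvg xi : l2 xi ->
  \sum_(0 <= k < n) xi k ^+ 2 @[n --> \oo] --> `|vec xi| ^+ 2.
Proof.
move=> xi2; rewrite -ip_norm; have := ip_vec_cvg (z := vec xi) xi2.
suff -> : (fun n => \sum_(0 <= k < n) xi k * ip (e k) (vec xi)) =
  (fun n => \sum_(0 <= k < n) xi k ^+ 2) by [].
by apply/funext => n; apply: eq_bigr => k _; rewrite ipC ip_vec_e// expr2.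
Qed.

Lemma norm_vec_le xi B : (forall n, \sum_(0 <= k < n) xi k ^+ 2 <= B) -> `|vec xi| ^+ 2 <= B.
Proof.
move=> HB; have h := @norm_vec_cvg xi (ex_intro _ B HB).
rewrite -(cvg_lim _ h)//; apply: limr_le; first by apply/cvg_ex; exists (`|vec xi| ^+ 2).
by near=> n.
Unshelve. all: by end_near. Qed.

Lemma norm_vec_ge xi n : l2 xi -> \sum_(0 <= k < n) xi k ^+ 2 <= `|vec xi| ^+ 2.
Proof.
move=> xi2; have := bessel (vec xi) n; apply: le_trans.
by rewrite le_eqVlt; apply/orP; left; apply/eqP; apply: eq_bigr => k _; rewrite ip_vec_e.
Qed.

(** The system may be incomplete, so the coefficients determine [y] only up to a vector orthogonal
    to it; the norm bound leaves no room for that part. *)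
Lemma vec_unique xi y : l2 xi -> (forall k, ip y (e k) = xi k) ->
  `|y| ^+ 2 <= `|vec xi| ^+ 2 -> y = vec xi.
Proof.
move=> xi2 yk yn; apply/eqP; rewrite -subr_eq0 -normr_eq0 -sqrf_eq0.
rewrite eq_le sqr_ge0 andbT normB_sqr.
suff -> : ip y (vec xi) = `|vec xi| ^+ 2 by lra.
rewrite ipC; have h1 := ip_vec_cvg (z := y) xi2; have h2 := norm_vec_cvg xi2.
apply: cvg_unique h1 _; first exact: Rhausdorff.
suff -> : (fun n => \sum_(0 <= k < n) xi k * ip (e k) y) =
  (fun n => \sum_(0 <= k < n) xi k ^+ 2) by exact: h2.
by apply/funext => n; apply: eq_bigr => k _; rewrite ipC yk expr2.
Qed.

Lemma l2_lin a xi zeta : l2 xi -> l2 zeta -> l2 (fun k => a * xi k + zeta k).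
Proof.
move=> [B HB] [C HC]; exists (2 * a ^+ 2 * B + 2 * C) => n.
apply: (@le_trans _ _ (2 * a ^+ 2 * \sum_(0 <= k < n) xi k ^+ 2 + 2 * \sum_(0 <= k < n) zeta k ^+ 2)).
  rewrite !big_distrr/= -big_split/=; apply: ler_sum => k _.
  by have := sqr_ge0 (a * xi k - zeta k); rewrite sqrrB sqrrD exprMn; lra.
by apply: lerD; apply: ler_wpM2l; rewrite ?(mulr_ge0 (ler0n _ 2) (sqr_ge0 a)) ?HB ?HC ?ler0n.
Qed.

Lemma vec_lin a xi zeta : l2 xi -> l2 zeta ->
  vec (fun k => a * xi k + zeta k) = a *: vec xi + vec zeta.
Proof.
move=> x2 z2; apply: (@cvg_unique _ _ (partial_vec (fun k => a * xi k + zeta k) @ \oo)).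
- exact: norm_hausdorff.
- exact: vec_cvg (l2_lin a x2 z2).
- have h := cvgD (cvgZ (cvg_cst a) (vec_cvg x2)) (vec_cvg z2).
  suff -> : partial_vec (fun k => a * xi k + zeta k) =
    (fun n => a *: partial_vec xi n + partial_vec zeta n) by exact: h.
  apply/funext => n; rewrite /partial_vec /= scaler_sumr -big_split/=.
  by apply: eq_bigr => k _; rewrite scalerDl scalerA.
Qed.

End orthonormal.
End inner_product_theory.

(** * Functional calculus of a spectral resolution *)

Section functional_calculus.
Variables (R : realType) (H : completeNormedModType R) (ip : H -> H -> R).
Variable E : set (measurableTypeR R) -> H -> H.
Hypothesis ip_inner : inner_product ip.
Hypothesis E_pvm : projection_valued_measure ip E.
Local Notation ipE := (ipE ip_inner).
Local Notation T := (measurableTypeR R).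
Implicit Types x y z v : H.

Lemma pvm_lin (B : set T) a x y : measurable B -> E B (a *: x + y) = a *: E B x + E B y.
Proof. by case: E_pvm => + _ _ _ => /(_ B) + mB => /(_ mB)[]. Qed.

Lemma pvm_sym B x y : measurable B -> ip (E B x) y = ip x (E B y).
Proof. by case: E_pvm => + _ _ _ => /(_ B) + mB => /(_ mB)[]. Qed.

Lemma pvm_setI B C x : measurable B -> measurable C -> E (B `&` C) x = E B (E C x).
Proof. by case: E_pvm => _ + _ _; exact. Qed.

Lemma pvmT x : E setT x = x.
Proof. by case: E_pvm. Qed.

Lemma ip_pvm B C x y : measurable B -> measurable C ->
  ip (E B x) (E C y) = ip (E (B `&` C) x) y.
Proof. by move=> mB mC; rewrite -pvm_sym// -pvm_setI// setIC. Qed.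

Lemma pvm_mass B x : measurable B -> ip (E B x) x = `|E B x| ^+ 2.
Proof. by move=> mB; rewrite -(ip_norm ip_inner) ip_pvm// setIid. Qed.

(** Countable additivity for the constant empty sequence: the partial sums converge, so their
    increments [E set0 x] tend to 0. *)
Lemma pvm_set0 x : E set0 x = 0.
Proof.
case: E_pvm => _ _ _ /(_ (fun=> set0) x (fun=> measurable0)).
have tr : trivIset setT (fun _ : nat => set0 : set T) by apply/trivIsetP => i j _ _ _; rewrite set0I.
move=> /(_ tr); rewrite bigcup0// => h.
have h1 : (fun n => \sum_(i < n.+1) E set0 x - \sum_(i < n) E set0 x) @ \oo --> E set0 x - E set0 x.
  by apply: cvgB => //; rewrite (cvg_shiftS (fun n => \sum_(i < n) E set0 x)).
rewrite subrr in h1; apply: (@cvg_unique _ _ ((fun=> E set0 x) @ \oo)).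
- exact: norm_hausdorff.
- exact: cvg_cst.
- suff <- : (fun n => \sum_(i < n.+1) E set0 x - \sum_(i < n) E set0 x) = fun=> E set0 x by [].
  by apply/funext => n; rewrite big_ord_recr/= addrAC subrr add0r.
Qed.

(* Nothing is known of [E] off the measurable sets, where
   [spectral_scalar_measure] may even be negative. *)
Definition scalar_measure x (B : set T) : \bar R :=
  if pselect (measurable B) then spectral_scalar_measure ip E x B else 0%E.

Lemma scalar_measureE x B : measurable B -> scalar_measure x B = (ip (E B x) x)%:E.
Proof. by rewrite /scalar_measure; case: pselect. Qed.

Let scalar_measure0 x : scalar_measure x set0 = 0%E.
Proof. by rewrite scalar_measureE// pvm_set0 (ip0l ip_inner). Qed.

Let scalar_measure_ge0 x B : (0 <= scalar_measure x B)%E.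
Proof.
rewrite /scalar_measure; case: pselect => // mB.
by rewrite lee_fin pvm_mass// sqr_ge0.
Qed.

Let scalar_measure_sigma_additive x : semi_sigma_additive (scalar_measure x).
Proof.
move=> F mF tF mU; case: E_pvm => _ _ _ /(_ F x mF tF) h.
have h1 := @cvg_ip _ _ _ ip_inner _ _ eventually_filter _ _ x h.
rewrite scalar_measureE//.
have -> : (fun n => (\sum_(0 <= i < n) scalar_measure x (F i))%E) =
    EFin \o (fun n => ip (\sum_(i < n) E (F i) x) x).
  apply/funext => n /=; rewrite (ip_suml ip_inner) -sumEFin big_mkord.
  by apply: eq_bigr => i _; rewrite scalar_measureE.
apply: cvg_EFin; last exact: h1.
exact: nearW.
Qed.

HB.instance Definition _ x := isMeasure.Build _ T R (scalar_measure x)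
  (scalar_measure0 x) (scalar_measure_ge0 x) (@scalar_measure_sigma_additive x).

(** The integral is built from simple functions, which evaluate the set function on measurable
    preimages only; there the two set functions agree. Integration theory thus becomes available for
    the raw scalar measure. *)
Lemma spectral_integralE x (f : T -> \bar R) :
  (\int[spectral_scalar_measure ip E x]_s f s = \int[scalar_measure x]_s f s)%E.
Proof.
have sE (g : {nnsfun T >-> R}) :
    sintegral (spectral_scalar_measure ip E x) g = sintegral (scalar_measure x) g.
  rewrite /sintegral; apply: eq_fsbigr => r _.
  by rewrite scalar_measureE.
by rewrite /integral; congr (ereal_sup _ - ereal_sup _)%E; apply/seteqP;
  split => _ [g /= gf <-]; exists g.
Qed.

(** The functional calculus of [E] on nonnegative simple functions; the operators for other
    functions are obtained as its monotone limits. *)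
Definition simple_op (g : {nnsfun T >-> R}) x : H :=
  \sum_(r <- fset_set (range g)) r *: E (g @^-1` [set r]) x.

Lemma simple_op_lin g a x y :
  simple_op g (a *: x + y) = a *: simple_op g x + simple_op g y.
Proof.
rewrite /simple_op scaler_sumr -big_split/=; apply: eq_bigr => r _.
by rewrite pvm_lin// scalerDr !scalerA mulrC.
Qed.

Lemma simple_opD g x y : simple_op g (x + y) = simple_op g x + simple_op g y.
Proof. by have := simple_op_lin g 1 x y; rewrite !scale1r. Qed.

Lemma simple_opB g x y : simple_op g (x - y) = simple_op g x - simple_op g y.
Proof. by have := simple_op_lin g (-1) y x; rewrite !scaleN1r addrC [RHS]addrC. Qed.

Lemma simple_op_sym g x y : ip (simple_op g x) y = ip x (simple_op g y).
Proof.
rewrite (ip_suml ip_inner) (ip_sumr ip_inner); apply: eq_bigr => r _.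
by rewrite !ipE pvm_sym.
Qed.

Lemma integral_simple_indic (g : {nnsfun T >-> R}) C x : measurable C ->
  (\int[scalar_measure x]_s (g s * \1_C s)%:E = (ip (simple_op g x) (E C x))%:E)%E.
Proof.
move=> mC.
have fg : finite_set (range g) by exact: fimfunP.
have gE s : (g s * \1_C s)%:E =
   (\sum_(r <- fset_set (range g)) (r * \1_(g @^-1` [set r] `&` C) s)%:E)%E.
  rewrite sumEFin fimfunE fsbig_finite//= mulr_suml; congr EFin.
  by apply: eq_bigr => r _; rewrite indicI/= mulrA.
(* The nonnegativity side conditions below range over all real [r], not only over the values of
   [g]. *)
have neg r : (r < 0) -> g @^-1` [set r] `&` C = set0.
  by move=> r0; rewrite preimage_nnfun0// set0I.
under eq_integral do rewrite gE.
rewrite ge0_integral_sum//; last 2 first.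
- by move=> r; apply/measurable_EFinP/measurable_funM => //; apply: measurable_indic; exact: measurableI.
- move=> r s _; rewrite lee_fin; have [r0|r0] := ltP r 0.
    by rewrite neg// indic0 mulr0.
  by rewrite mulr_ge0.
rewrite (ip_suml ip_inner) -sumEFin; apply: eq_bigr => r _.
rewrite (@integralZl_indic _ _ _ _ _ measurableT (fun r => g @^-1` [set r] `&` C))//; last 2 first.
- exact: neg.
- exact: measurableI.
rewrite integral_indic// ?setIT; last exact: measurableI.
by rewrite /= scalar_measureE ?ipE ?ip_pvm//; exact: measurableI.
Qed.

(** Multiplicativity of the calculus on simple functions, read on scalar measures. Order between
    functions thereby becomes order between inner products. *)
Lemma integral_simple_mul (g h : {nnsfun T >-> R}) x :
  (\int[scalar_measure x]_s (g s * h s)%:E = (ip (simple_op g x) (simple_op h x))%:E)%E.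
Proof.
have fh : finite_set (range h) by exact: fimfunP.
have hE s : (g s * h s)%:E =
   (\sum_(r <- fset_set (range h)) r%:E * (g s * \1_(h @^-1` [set r]) s)%:E)%E.
  under [RHS]eq_bigr do rewrite -EFinM.
  rewrite sumEFin [h s]fimfunE fsbig_finite//= mulr_sumr; congr EFin.
  by apply: eq_bigr => r _; rewrite mulrCA.
have ge0 r s : (0 <= r%:E * (g s * \1_(h @^-1` [set r]) s)%:E)%E.
  rewrite -EFinM lee_fin; have [r0|r0] := ltP r 0.
    by rewrite preimage_nnfun0// indic0 !mulr0.
  by rewrite !mulr_ge0.
have mg r : measurable_fun setT (fun s : T => (g s * \1_(h @^-1` [set r]) s)%:E).
  by apply/measurable_EFinP/measurable_funM => //; exact: measurable_indic.
under eq_integral do rewrite hE.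
rewrite ge0_integral_sum//; last first.
  by move=> r; apply: measurable_funeM.
rewrite (ip_sumr ip_inner) -sumEFin; apply: eq_bigr => r _.
have [r0|r0] := ltP r 0.
  rewrite preimage_nnfun0// pvm_set0 scaler0 (ip0r ip_inner).
  by rewrite integral0_eq// => s _; rewrite indic0 mulr0 mule0.
rewrite ge0_integralZl//; last by move=> s _; rewrite lee_fin mulr_ge0.
by rewrite integral_simple_indic// ipE EFinM.
Qed.

Lemma integral_simple (g : {nnsfun T >-> R}) x :
  (\int[scalar_measure x]_s (g s)%:E = (ip (simple_op g x) x)%:E)%E.
Proof.
rewrite -[X in ip _ X](pvmT x) -integral_simple_indic//.
by apply: eq_integral => s _; rewrite indicT mulr1.
Qed.

Lemma simple_op_point g p v : E [set p] v = v -> simple_op g v = g p *: v.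
Proof.
move=> pv; rewrite /simple_op -(@fsbig_finite _ _ _ _ _ (fun r => r *: E (g @^-1` [set r]) v))//.
rewrite (fsbigD1 (g p))//=.
  rewrite fsbig1 ?addr0.
    congr (_ *: _); rewrite -[X in E _ X]pv -pvm_setI//.
    by rewrite (_ : _ `&` _ = [set p])//; apply/seteqP; split => [s []//|s /= ->].
  move=> r [_ /= rp]; rewrite -[X in E _ X]pv -pvm_setI//.
  rewrite (_ : _ `&` _ = set0) ?pvm_set0 ?scaler0//.
  by apply/seteqP; split => // s [/= gs sp]; apply: rp; rewrite -gs sp.
by exists p.
Qed.

Section measurable_function.
Variable f : T -> R.
Hypothesis f_ge0 : forall s, 0 <= f s.
Hypothesis f_meas : measurable_fun setT f.

Let mf : measurable_fun setT (EFin \o f). Proof. exact/measurable_EFinP. Qed.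
Let g : nat -> {nnsfun T >-> R} := nnsfun_approx measurableT mf.
Let S n x := simple_op (g n) x.

Let g_nd s n m : (n <= m)%N -> g n s <= g m s.
Proof. by move=> nm; have /lefP /(_ s) := nd_nnsfun_approx measurableT mf nm. Qed.

Let g_cvg s : (EFin \o g^~ s) @ \oo --> (f s)%:E.
Proof. by apply: cvg_nnsfun_approx => // t _; rewrite lee_fin. Qed.

Let g_cvgr s : g^~ s @ \oo --> f s.
Proof. exact: (fine_cvg (@g_cvg s)). Qed.

Let S_mul n m x : (\int[scalar_measure x]_s (g n s * g m s)%:E = (ip (S n x) (S m x))%:E)%E.
Proof. exact: integral_simple_mul. Qed.

Let S_mul_le n m x : (n <= m)%N -> ip (S n x) (S n x) <= ip (S n x) (S m x).
Proof.
move=> nm; rewrite -lee_fin -!S_mul; apply: ge0_le_integral => //.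
- by move=> s _; rewrite lee_fin mulr_ge0.
- by apply/measurable_EFinP/measurable_funM.
- by apply/measurable_EFinP/measurable_funM.
- by move=> s _; rewrite lee_fin ler_wpM2l// g_nd.
Qed.

(** From [g n <= g m] the inner product of [S n x] and [S m x] is at least the squared norm of
    [S n x]; expanding the square puts the increments in the form that [hilbert_cvg] takes. *)
Let S_nd n m x : (n <= m)%N -> `|S m x - S n x| ^+ 2 <= `|S m x| ^+ 2 - `|S n x| ^+ 2.
Proof.
move=> nm; rewrite (normB_sqr ip_inner) (ipC ip_inner).
by have := S_mul_le x nm; rewrite (ip_norm ip_inner); lra.
Qed.

Let S_norm_nd n m x : (n <= m)%N -> `|S n x| ^+ 2 <= `|S m x| ^+ 2.
Proof. by move=> nm; rewrite -subr_ge0 (le_trans _ (S_nd x nm))// sqr_ge0. Qed.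

Let int_cvg x (G : nat -> T -> R) (F : T -> R) :
  (forall n, measurable_fun setT (G n)) -> (forall n s, 0 <= G n s) ->
  (forall s n m, (n <= m)%N -> G n s <= G m s) -> (forall s, G ^~ s @ \oo --> F s) ->
  (\int[scalar_measure x]_s (G n s)%:E @[n --> \oo] --> \int[scalar_measure x]_s (F s)%:E)%E.
Proof.
move=> mG G0 Gnd GF.
rewrite (_ : (\int[scalar_measure x]_s (F s)%:E)%E =
  (\int[scalar_measure x]_s limn (fun n => (G n s)%:E))%E).
  apply: cvg_monotone_convergence => //.
  - by move=> n; apply/measurable_EFinP.
  - by move=> n s _; rewrite lee_fin.
  - by move=> s _ n m nm; rewrite lee_fin Gnd.
apply: eq_integral => s _; apply/esym/cvg_lim => //.
by apply: cvg_EFin; [exact: nearW|exact: GF].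
Qed.

Let S_int_cvg x : (ip (S n x) x)%:E @[n --> \oo] --> (\int[scalar_measure x]_s (f s)%:E)%E.
Proof.
rewrite [X in X @ _ --> _](_ : _ = (fun n => \int[scalar_measure x]_s (g n s)%:E)%E); last first.
  by apply/funext => n; rewrite integral_simple.
by apply: int_cvg => //; exact: g_cvgr.
Qed.

Let S_int2_cvg x : (`|S n x| ^+ 2)%:E @[n --> \oo] -->
  (\int[scalar_measure x]_s (f s ^+ 2)%:E)%E.
Proof.
rewrite [X in X @ _ --> _](_ : _ =
  (fun n => \int[scalar_measure x]_s ((fun s => g n s * g n s) s)%:E)%E); last first.
  by apply/funext => n; rewrite S_mul (ip_norm ip_inner).
apply: int_cvg => //.
- by move=> n; apply: measurable_funM.
- by move=> n s; rewrite mulr_ge0.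
- by move=> s n m nm; rewrite ler_pM// g_nd.
- by move=> s; rewrite expr2; apply: cvgM; exact: g_cvgr.
Qed.

Lemma spectral_domain_le x (B : R) : (forall n, `|S n x| ^+ 2 <= B) ->
  (\int[spectral_scalar_measure ip E x]_s (f s ^+ 2)%:E <= B%:E)%E.
Proof.
move=> SB; rewrite spectral_integralE -(cvg_lim _ (@S_int2_cvg x))//.
apply: lime_le; first by apply/cvg_ex; eexists; exact: S_int2_cvg.
by apply: nearW => n; rewrite lee_fin.
Qed.

Let S_int2_ge n x :
  ((`|S n x| ^+ 2)%:E <= \int[spectral_scalar_measure ip E x]_s (f s ^+ 2)%:E)%E.
Proof.
rewrite spectral_integralE -(cvg_lim _ (@S_int2_cvg x))//.
apply: lime_ge; first by apply/cvg_ex; eexists; exact: S_int2_cvg.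
by exists n => // m /= nm; rewrite lee_fin S_norm_nd.
Qed.

Let domain_bound x : spectral_domain ip E f x -> exists B, forall n, `|S n x| ^+ 2 <= B.
Proof.
rewrite /spectral_domain/= => fx.
exists (fine (\int[spectral_scalar_measure ip E x]_s (f s ^+ 2)%:E)) => n.
rewrite -lee_fin fineK ?S_int2_ge// ge0_fin_numE//.
by apply: le_trans (S_int2_ge 0 x); rewrite lee_fin sqr_ge0.
Qed.

Let bound_domain x (B : R) : (forall n, `|S n x| ^+ 2 <= B) -> spectral_domain ip E f x.
Proof. by move=> SB; rewrite /spectral_domain/= (le_lt_trans (spectral_domain_le SB))// ltry. Qed.

Let domain_addB x z a : `|a| = 1 -> spectral_domain ip E f x -> spectral_domain ip E f z ->
  spectral_domain ip E f (x + a *: z).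
Proof.
move=> a1 /domain_bound[B HB] /domain_bound[C HC].
apply: (@bound_domain _ (2 * B + 2 * C)) => n.
rewrite /S addrC simple_op_lin addrC (normD_sqr ip_inner) normrZ a1 mul1r.
rewrite (ipZr ip_inner); have := HB n; have := HC n.
have : 0 <= `|S n x - a *: S n z| ^+ 2 by exact: sqr_ge0.
rewrite (normB_sqr ip_inner) normrZ a1 mul1r (ipZr ip_inner) /S; lra.
Qed.

(** Square integrability makes the integral of [f] itself finite: by Cauchy-Schwarz it is at most
    [Num.sqrt B * |x|]. Only then is [fine] compatible with the limit. *)
Let S_form_cvg x : spectral_domain ip E f x ->
  ip (S n x) x @[n --> \oo] --> fine (\int[spectral_scalar_measure ip E x]_s (f s)%:E)%E.
Proof.
move=> /domain_bound[B HB]; rewrite spectral_integralE.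
set I := (\int[scalar_measure x]_s (f s)%:E)%E.
have B0 : 0 <= B by apply: le_trans (HB 0%N); exact: sqr_ge0.
have le : (I <= (Num.sqrt B * `|x|)%:E)%E.
  rewrite /I -(cvg_lim _ (@S_int_cvg x))//.
  apply: lime_le; first by apply/cvg_ex; eexists; exact: S_int_cvg.
  apply: nearW => n; rewrite lee_fin (le_trans (ler_norm _))//.
  rewrite (le_trans (cauchy_schwarz ip_inner _ _))// ler_wpM2r//.
  by rewrite -(ler_pXn2r (ltn0Sn 1)) ?nnegrE ?sqrtr_ge0// sqr_sqrtr.
have fin : I \is a fin_num.
  rewrite ge0_fin_numE ?(le_lt_trans le) ?ltry//.
  by apply: integral_ge0 => s _; rewrite lee_fin.
have h : (ip (S n x) x)%:E @[n --> \oo] --> (fine I)%:E by rewrite fineK//; exact: S_int_cvg.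
exact: (fine_cvg h).
Qed.

(** The value is the strong limit of the simple operators applied to [v]. Polarization, the norm
    formula and the action on vectors fixed by [E [set p]] hold for each approximation and pass to
    the limit. *)
Lemma spectral_integral_exists v : spectral_domain ip E f v ->
  exists y, [/\ spectral_integral_graph ip E f v y,
    ((`|y| ^+ 2)%:E = \int[spectral_scalar_measure ip E v]_s (f s ^+ 2)%:E)%E &
    forall p e, E [set p] e = e -> ip y e = f p * ip v e].
Proof.
move=> fv; have [B HB] := domain_bound fv.
have cS : cvgn (S ^~ v).
  by apply: (hilbert_cvg (a := fun n => `|S n v| ^+ 2)) => [n m|]; [exact: S_nd|exists B].
have Sz z := @cvg_ip _ _ _ ip_inner _ _ eventually_filter _ _ z cS.
exists (limn (S ^~ v)); split.
- split => // z fz; apply: cvg_unique (Sz z) _; first exact: Rhausdorff.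
  rewrite /spectral_form.
  have dp : spectral_domain ip E f (v + z).
    by rewrite -[z]scale1r; apply: domain_addB => //; exact: normr1.
  have dm : spectral_domain ip E f (v - z).
    by rewrite -scaleN1r; apply: domain_addB => //; rewrite normrN normr1.
  have h := cvgM (@cvg_cst _ (4%:R^-1 : R) _ \oo _) (cvgB (@S_form_cvg _ dp) (@S_form_cvg _ dm)).
  suff -> : (fun n => ip (S n v) z) = (fun n => 4^-1 *
      (ip (S n (v + z)) (v + z) - ip (S n (v - z)) (v - z))) by exact: h.
  apply/funext => n; rewrite /S simple_opD simple_opB !ipE.
  by rewrite [ip (simple_op (g n) z) v]simple_op_sym (ipC ip_inner z); field.
- rewrite spectral_integralE; apply: cvg_unique (@S_int2_cvg v); first exact: ereal_hausdorff.
  apply: cvg_EFin; first exact: nearW.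
  by rewrite expr2; under eq_fun do rewrite /= expr2; apply: cvgM; exact: cvg_norm.
- move=> p e pe; apply: cvg_unique (Sz e) _; first exact: Rhausdorff.
  suff -> : (fun n => ip (S n v) e) = (fun n => g n p * ip v e).
    by apply: cvgM; [exact: g_cvgr|exact: cvg_cst].
  by apply/funext => n; rewrite /S simple_op_sym (simple_op_point _ pe) !ipE.
Qed.

(** The difference [w] of two values is orthogonal to the domain, which contains [E (B k) w] for
    [B k] the set where [f <= k]. So the scalar measure of [w] vanishes on every [B k], and these
    sets exhaust the line. *)
Lemma spectral_integral_unique v y y' :
  spectral_integral_graph ip E f v y -> spectral_integral_graph ip E f v y' -> y = y'.
Proof.
move=> [_ hy] [_ hy']; apply/eqP; rewrite -subr_eq0; set w := y - y'.
have hw z : spectral_domain ip E f z -> ip w z = 0.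
  by move=> fz; rewrite /w !ipE hy// hy'// subrr.
pose B (k : nat) := f @^-1` `]-oo, k%:R].
have mB k : measurable (B k).
  by rewrite -[B k]setTI; apply: f_meas => //; exact: measurable_itv.
have dB k : spectral_domain ip E f (E (B k) w).
  rewrite /spectral_domain/= spectral_integralE.
  have mf2 : measurable_fun setT (fun s : T => (f s ^+ 2)%:E).
    by apply/measurable_EFinP/measurable_funX.
  have m0 : scalar_measure (E (B k) w) (~` B k) = 0%E.
    rewrite scalar_measureE; last exact: measurableC.
    rewrite -pvm_setI//; last exact: measurableC.
    by rewrite setICl pvm_set0 (ip0l ip_inner).
  rewrite (@ge0_negligible_integral _ _ _ (scalar_measure (E (B k) w)) setT (~` B k))//; last 2 first.
  - exact: measurableC.
  - by move=> s _; rewrite lee_fin sqr_ge0.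
  rewrite setTD setCK.
  have le : (\int[scalar_measure (E (B k) w)]_(s in B k) (f s ^+ 2)%:E <=
      \int[scalar_measure (E (B k) w)]_(s in B k) (k%:R ^+ 2)%:E)%E.
    apply: ge0_le_integral => //.
    - by move=> s _; rewrite lee_fin sqr_ge0.
    - exact: measurable_funTS.
    - move=> s; rewrite /B/= in_itv/= => sk.
      by rewrite lee_fin lerXn2r ?nnegrE// f_ge0.
  apply: (le_lt_trans le).
  by rewrite integral_cst//= scalar_measureE// -EFinM ltry.
have EB k : scalar_measure w (B k) = 0%E.
  by rewrite scalar_measureE// pvm_sym// hw.
have BT : \bigcup_k B k = setT.
  apply/seteqP; split => // s _; exists (Num.bound (f s)) => //=.
  by rewrite /B/= in_itv/= ltW// archi_boundP.
have := @nondecreasing_cvg_mu _ _ _ (scalar_measure w) B mB.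
rewrite BT => /(_ measurableT) h.
have {}h := h _.
have ndB : nondecreasing_seq B.
  apply/nondecreasing_seqP => k; apply/subsetPset => s; rewrite /B/= !in_itv/=.
  by move=> /le_trans; apply; rewrite ler_nat.
have := h ndB; rewrite (_ : _ \o B = fun=> 0%E); last by apply/funext => k /=; exact: EB.
move=> /(cvg_unique (@ereal_hausdorff R) (@cvg_cst _ 0%E _ \oo _)).
rewrite /= scalar_measureE// pvmT (ip_norm ip_inner) => h2.
have /eqP : `|w| ^+ 2 = 0 by apply: EFin_inj; rewrite -h2.
by rewrite sqrf_eq0 normr_eq0.
Qed.

(** For the function sending [s] to its [b]-th power this is [Apow ip E b], by conversion. *)
Definition spectral_op v := xget 0 [set y | spectral_integral_graph ip E f v y].

Lemma spectral_opP v : spectral_domain ip E f v ->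
  [/\ spectral_integral_graph ip E f v (spectral_op v),
    ((`|spectral_op v| ^+ 2)%:E = \int[spectral_scalar_measure ip E v]_s (f s ^+ 2)%:E)%E &
    forall p e, E [set p] e = e -> ip (spectral_op v) e = f p * ip v e].
Proof.
move=> fv; have [y [h1 h2 h3]] := spectral_integral_exists fv.
have h : spectral_integral_graph ip E f v (spectral_op v).
  by apply: (@xgetPex _ 0 [set y | spectral_integral_graph ip E f v y]); exists y.
by rewrite (spectral_integral_unique h h1).
Qed.

End measurable_function.

(** * Eigenvectors and the resolution of the identity *)

Let scalar_measure_split a (B C : set T) x : measurable B -> measurable C ->
  scalar_measure (a *: E B x + E (~` B) x) C =
  ((a ^+ 2)%:E * scalar_measure (E B x) C + scalar_measure (E (~` B) x) C)%E.
Proof.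
move=> mB mC; have mN := measurableC mB; rewrite !scalar_measureE// -EFinM -EFinD.
congr EFin; rewrite pvm_lin// !ipE.
have -> : ip (E C (E B x)) (E (~` B) x) = 0.
  rewrite -pvm_setI// ip_pvm//; last exact: measurableI.
  by rewrite -setIA setICr setI0 pvm_set0 (ip0l ip_inner).
have -> : ip (E C (E (~` B) x)) (E B x) = 0.
  rewrite -pvm_setI// ip_pvm//; last exact: measurableI.
  by rewrite -setIA setICl setI0 pvm_set0 (ip0l ip_inner).
ring.
Qed.

Let integral_split a (B : set T) x (f : T -> \bar R) : measurable B ->
  measurable_fun setT f -> (forall s, 0 <= f s)%E ->
  (\int[scalar_measure (a *: E B x + E (~` B) x)%R]_s f s =
  (a ^+ 2)%:E * \int[scalar_measure (E B x)]_s f s +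
  \int[scalar_measure (E (~` B) x)]_s f s)%E.
Proof.
move=> mB mf f0.
have a2 : 0 <= a ^+ 2 by exact: sqr_ge0.
rewrite (@eq_measure_integral _ _ _ setT
  (measure_add (mscale (NngNum a2) (scalar_measure (E B x))) (scalar_measure (E (~` B) x)))).
  by rewrite ge0_integral_measure_add// ge0_integral_mscale.
move=> C mC _; rewrite /= /measure_add/= /msum/= !big_ord_recl big_ord0 adde0 /= /mscale/=.
exact: scalar_measure_split.
Qed.

(** The two pieces are orthogonal and their squared norms add up to that of [x], so the squared norm
    of the remainder expands to 0. *)
Let pvm_cut (B : set T) x : measurable B -> x = 1 *: E B x + E (~` B) x.
Proof.
move=> mB; have mN := measurableC mB; rewrite scale1r.
have h : `|E B x| ^+ 2 + `|E (~` B) x| ^+ 2 = `|x| ^+ 2.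
  apply: EFin_inj; rewrite EFinD -!pvm_mass// -!scalar_measureE//.
  rewrite -(measureU (scalar_measure x))//; last by rewrite setICr.
  by rewrite setUCr /= scalar_measureE// pvmT (ip_norm ip_inner).
have o : ip (E B x) (E (~` B) x) = 0 by rewrite ip_pvm// setICr pvm_set0 (ip0l ip_inner).
apply/eqP; rewrite -subr_eq0 -normr_eq0 -sqrf_eq0.
rewrite (normB_sqr ip_inner) (normD_sqr ip_inner) ipE o.
have -> : ip x (E B x) = `|E B x| ^+ 2 by rewrite (ipC ip_inner) pvm_mass.
have -> : ip x (E (~` B) x) = `|E (~` B) x| ^+ 2 by rewrite (ipC ip_inner) pvm_mass.
by apply/eqP; lra.
Qed.

Let int_pos x := (\int[scalar_measure x]_s (Num.max s 0)%:E)%E.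
Let int_neg x := (\int[scalar_measure x]_s (Num.max (- s) 0)%:E)%E.
Let int_sqr x := (\int[scalar_measure x]_s (s ^+ 2)%:E)%E.

Let mpos : measurable_fun setT (fun s : T => (Num.max s 0)%:E).
Proof. by apply/measurable_EFinP; apply: measurable_maxr. Qed.

Let mneg : measurable_fun setT (fun s : T => (Num.max (- s) 0)%:E).
Proof. by apply/measurable_EFinP; apply: measurable_maxr. Qed.

Let msqr : measurable_fun setT (fun s : T => (s ^+ 2)%:E).
Proof. by apply/measurable_EFinP; apply: measurable_funX. Qed.

Let int_idE x : (\int[spectral_scalar_measure ip E x]_s s%:E = int_pos x - int_neg x)%E.
Proof.
rewrite spectral_integralE integralE; congr (_ - _)%E; apply: eq_integral => s _.
  by rewrite funeposE -EFin_max.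
by rewrite funenegE -EFinN -EFin_max.
Qed.

Let sqr_bound (h : R -> R) x : (forall s, 0 <= h s <= 1 + s ^+ 2) ->
  measurable_fun setT (fun s : T => (h s)%:E) -> (int_sqr x < +oo)%E ->
  (\int[scalar_measure x]_s (h s)%:E)%E \is a fin_num.
Proof.
move=> h1 mh fx; rewrite ge0_fin_numE; last first.
  by apply: integral_ge0 => s _; rewrite lee_fin; have /andP[] := h1 s.
apply: (@le_lt_trans _ _ (\int[scalar_measure x]_s (1%:E + (s ^+ 2)%:E))%E).
  apply: ge0_le_integral => //.
  - by move=> s _; rewrite lee_fin; have /andP[] := h1 s.
  - by apply: emeasurable_funD.
  - by move=> s _; rewrite -EFinD lee_fin; have /andP[] := h1 s.
rewrite ge0_integralD//; last by move=> s _; rewrite lee_fin sqr_ge0.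
rewrite integral_cst// mul1e lte_add_pinfty//.
by rewrite /= scalar_measureE// ltry.
Qed.

Let pos_bound (s : R) : 0 <= Num.max s 0 <= 1 + s ^+ 2.
Proof.
rewrite le_max lexx orbT/= ge_max; have := sqr_ge0 s; have := sqr_ge0 (s - 1).
by rewrite sqrrB1 => *; apply/andP; split; lra.
Qed.

Let neg_bound (s : R) : 0 <= Num.max (- s) 0 <= 1 + s ^+ 2.
Proof. by have := pos_bound (- s); rewrite sqrrN. Qed.

(** Testing the eigenvalue relation against [E B x] shows that the integral of [s] over [B] is [mu]
    times the mass of [B]. In the polarization, [x + E B x] and [x - E B x] are [2 *: E B x] and
    [0 *: E B x] plus the same complementary piece, which cancels. The signed integral is handled
    through its positive and negative parts, finite because [s ^+ 2] is integrable. *)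
Let eigen_identity (B : set T) x mu : measurable B ->
  spectral_integral_graph ip E id x (mu *: x) ->
  [/\ int_pos (E B x) \is a fin_num, int_neg (E B x) \is a fin_num &
      fine (int_pos (E B x)) - fine (int_neg (E B x)) = mu * `|E B x| ^+ 2].
Proof.
move=> mB [dx hx]; have mN := measurableC mB.
have dx' : (int_sqr x < +oo)%E by move: dx; rewrite /spectral_domain/= spectral_integralE.
have split1 f := @integral_split 1 B x f mB.
rewrite -pvm_cut// expr1n in split1.
have sq : (int_sqr (E B x) < +oo)%E /\ (int_sqr (E (~` B) x) < +oo)%E.
  have s0 (s : T) : (0 <= (s ^+ 2)%:E :> \bar R)%E by rewrite lee_fin sqr_ge0.
  have h : (int_sqr x = int_sqr (E B x) + int_sqr (E (~` B) x))%E.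
    by rewrite [LHS](split1 _ msqr s0) mul1e.
  move: dx'; rewrite h => dx'.
  have i0 z : (0 <= int_sqr z)%E by apply: integral_ge0 => s _.
  by split; apply: le_lt_trans dx'; [exact: leeDl|exact: leeDr].
have dz : spectral_domain ip E id (E B x).
  by rewrite /spectral_domain/= spectral_integralE; case: sq.
have fP z : (int_sqr z < +oo)%E -> int_pos z \is a fin_num.
  by apply: sqr_bound => //; exact: pos_bound.
have fN z : (int_sqr z < +oo)%E -> int_neg z \is a fin_num.
  by apply: sqr_bound => //; exact: neg_bound.
have [sB sN] := sq.
split; [exact: fP|exact: fN|].
have := hx _ dz; rewrite /spectral_form.
have -> : x + E B x = 2 *: E B x + E (~` B) x.
  by rewrite {1}(pvm_cut x mB) scale1r addrAC -[2]/(1 + 1 : R) scalerDl scale1r.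
have -> : x - E B x = 0 *: E B x + E (~` B) x.
  by rewrite {1}(pvm_cut x mB) !scale1r scale0r add0r addrAC subrr add0r.
have pos0 (s : T) : (0 <= (Num.max s 0)%:E)%E by rewrite lee_fin le_max lexx orbT.
have neg0 (s : T) : (0 <= (Num.max (- s) 0)%:E)%E by rewrite lee_fin le_max lexx orbT.
have PE a : int_pos (a *: E B x + E (~` B) x) =
    (a ^+ 2 * fine (int_pos (E B x)) + fine (int_pos (E (~` B) x)))%:E.
  by rewrite [LHS]integral_split// EFinD [(_ * fine _)%:E]EFinM !fineK ?fP//.
have NE a : int_neg (a *: E B x + E (~` B) x) =
    (a ^+ 2 * fine (int_neg (E B x)) + fine (int_neg (E (~` B) x)))%:E.
  by rewrite [LHS]integral_split// EFinD [(_ * fine _)%:E]EFinM !fineK ?fN//.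
rewrite !int_idE !PE !NE -!EFinB /= ipE (ipC ip_inner) pvm_mass// => ->.
by field.
Qed.

(** By [eigen_identity] the mean of [s - mu] over [B] is 0, which is impossible for positive mass
    when [B] lies strictly on one side of [mu]. *)
Let eigen_null (B : set T) x mu c : measurable B ->
  spectral_integral_graph ip E id x (mu *: x) ->
  (c > mu /\ (forall s, B s -> c <= s)) \/ (c < mu /\ (forall s, B s -> s <= c)) ->
  E B x = 0.
Proof.
move=> mB gx hB; have mN := measurableC mB.
have [fP fN E1] := eigen_identity mB gx.
have m0 : scalar_measure (E B x) (~` B) = 0%E.
  by rewrite scalar_measureE// -pvm_setI// setICl pvm_set0 (ip0l ip_inner).
have mBE : scalar_measure (E B x) setT = (`|E B x| ^+ 2)%:E.
  by rewrite scalar_measureE// pvmT (ip_norm ip_inner).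
have key (h1 h2 : R -> R) (a1 a2 : R) :
    measurable_fun setT (fun s : T => (h1 s)%:E) -> measurable_fun setT (fun s : T => (h2 s)%:E) ->
    (forall s, 0 <= h1 s) -> (forall s, 0 <= h2 s) -> 0 <= a1 -> 0 <= a2 ->
    (forall s, B s -> h1 s + a1 <= h2 s + a2) ->
    (\int[scalar_measure (E B x)]_s (h1 s)%:E)%E \is a fin_num ->
    (\int[scalar_measure (E B x)]_s (h2 s)%:E)%E \is a fin_num ->
    fine (\int[scalar_measure (E B x)]_s (h1 s)%:E)%E + a1 * `|E B x| ^+ 2 <=
    fine (\int[scalar_measure (E B x)]_s (h2 s)%:E)%E + a2 * `|E B x| ^+ 2.
  move=> mh1 mh2 h10 h20 a10 a20 h12 f1 f2.
  rewrite -lee_fin !EFinD !fineK// [(a1 * _)%:E]EFinM [(a2 * _)%:E]EFinM -mBE.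
  have intD (h : R -> R) (a : R) : measurable_fun setT (fun s : T => (h s)%:E) ->
      (forall s, 0 <= h s) -> 0 <= a ->
      (\int[scalar_measure (E B x)]_s (h s)%:E + a%:E * scalar_measure (E B x) setT =
       \int[scalar_measure (E B x)]_(s in B) (h s + a)%:E)%E.
    move=> mh h0 a0.
    have -> : (a%:E * scalar_measure (E B x) setT = \int[scalar_measure (E B x)]_s a%:E)%E.
      by rewrite integral_cst.
    rewrite -ge0_integralD//; last by move=> s _; rewrite lee_fin.
    rewrite (@ge0_negligible_integral _ _ _ (scalar_measure (E B x)) setT (~` B))//.
    - by rewrite setTD setCK; apply: eq_integral => s _; rewrite EFinD.
    - by apply: emeasurable_funD.
    - by move=> s _; rewrite -EFinD lee_fin addr_ge0.
  rewrite !intD//; apply: ge0_le_integral => //.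
  - by move=> s _; rewrite lee_fin addr_ge0.
  - apply: measurable_funTS; under eq_fun do rewrite EFinD.
    by apply: emeasurable_funD.
  - apply: measurable_funTS; under eq_fun do rewrite EFinD.
    by apply: emeasurable_funD.
have p0 (s : R) : 0 <= Num.max s 0 by rewrite le_max lexx orbT.
have n0 (s : R) : 0 <= Num.max (- s) 0 by rewrite le_max lexx orbT.
have sE (s : R) : s = Num.max s 0 - Num.max (- s) 0.
  have [s0|s0] := leP s 0; have [t0|t0] := leP (- s) 0; lra.
have cE := sE c.
have N0 : 0 <= `|E B x| ^+ 2 by exact: sqr_ge0.
suff : `|E B x| ^+ 2 <= 0.
  by move=> h; apply/eqP; rewrite -normr_eq0 -sqrf_eq0 eq_le h N0.
case: hB => -[cmu hB].
  have := key (fun s => Num.max (- s) 0) (fun s => Num.max s 0) (Num.max c 0) (Num.max (- c) 0)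
    mneg mpos n0 p0 (p0 c) (n0 c) _ fN fP.
  have hh s : B s -> Num.max (- s) 0 + Num.max c 0 <= Num.max s 0 + Num.max (- c) 0.
    by move=> /hB; have := sE s; lra.
  by move=> /(_ hh); rewrite -/(int_neg _) -/(int_pos _) => ?; nra.
have := key (fun s => Num.max s 0) (fun s => Num.max (- s) 0) (Num.max (- c) 0) (Num.max c 0)
    mpos mneg p0 n0 (n0 c) (p0 c) _ fP fN.
have hh s : B s -> Num.max s 0 + Num.max (- c) 0 <= Num.max (- s) 0 + Num.max c 0.
  by move=> /hB; have := sE s; lra.
by move=> /(_ hh); rewrite -/(int_neg _) -/(int_pos _) => ?; nra.
Qed.

(** The complement of [mu] is the union of the sets at distance at least [1 / k.+1] from it, each
    negligible by [eigen_null]. This carries eigenvectors of [A] over to the spectral resolution,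
    where spectral integrals act on them by scalars. *)
Lemma eigen_pvm x mu : spectral_integral_graph ip E id x (mu *: x) -> E [set mu] x = x.
Proof.
move=> gx.
pose F (k : nat) := (`[mu + k.+1%:R^-1, +oo[ `|` `]-oo, mu - k.+1%:R^-1])%classic : set T.
have mF k : measurable (F k) by apply: measurableU; exact: measurable_itv.
have k0 k : 0 < (k.+1%:R^-1 : R) by rewrite invr_gt0.
have F0 k : (scalar_measure x).-negligible (F k).
  apply: negligibleU; apply/negligibleP; try exact: measurable_itv.
    rewrite /= scalar_measureE; last exact: measurable_itv.
    rewrite (@eigen_null _ x mu (mu + k.+1%:R^-1)) ?(ip0l ip_inner)//.
    by left; split=> [|s]; [rewrite ltrDl | rewrite /= in_itv/= andbT].
  rewrite /= scalar_measureE; last exact: measurable_itv.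
  rewrite (@eigen_null _ x mu (mu - k.+1%:R^-1)) ?(ip0l ip_inner)//.
  by right; split=> [|s]; [rewrite ltrBlDr ltrDl | rewrite /= in_itv/=].
have FU : \bigcup_k F k = ~` [set mu].
  apply/seteqP; split => [s [k _ []]|s /= smu].
  - by rewrite /= in_itv/= andbT => h /= E1; move: h; rewrite E1 gerDl leNgt k0.
  - by rewrite /= in_itv/= => h /= E1; move: h; rewrite E1 lerBrDl gerDr leNgt k0.
  have d0 : 0 < `|s - mu| by rewrite normr_gt0 subr_eq0; apply/eqP.
  have [k Hk] : exists k : nat, k.+1%:R^-1 < `|s - mu|.
    exists (Num.bound (`|s - mu|^-1)); rewrite invf_plt ?posrE//.
    by rewrite (lt_trans (archi_boundP _)) ?invr_ge0// ltr_nat.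
  exists k => //; have [h|h] := leP mu s.
    left; rewrite /= in_itv/= andbT; move: Hk; rewrite ger0_norm ?subr_ge0//.
    by rewrite ltrBrDl => /ltW.
  right; rewrite /= in_itv/=; move: Hk; rewrite ltr0_norm ?subr_lt0// opprB.
  by rewrite ltrBrDl => /ltW h1; rewrite lerBrDr.
have mmu : measurable ([set mu] : set T) by exact: measurable_set1.
have := negligible_bigcup F0; rewrite FU => /measure_negligible => h.
have {}h := h (measurableC mmu).
have z : E (~` [set mu]) x = 0.
  apply/eqP; rewrite -normr_eq0 -sqrf_eq0 -pvm_mass; last exact: measurableC.
  apply/eqP/EFin_inj; move: h; rewrite /= scalar_measureE//; exact: measurableC.
by rewrite [RHS](pvm_cut x mmu) z addr0 scale1r.
Qed.

(** The integral is treated as a supremum over simple functions below [h], since in the Gevrey norm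
    [h] contains an arbitrary [phi] and may fail to be measurable. Each simple function acts
    diagonally on the series. *)
Lemma integral_vec_le (e : nat -> H) (p : nat -> T) (xi : nat -> R) (h : T -> R) (B : R) :
  (forall i j, ip (e i) (e j) = (i == j)%:R) -> (forall k, E [set p k] (e k) = e k) ->
  l2 xi -> (forall s, 0 <= h s) ->
  (forall n, \sum_(0 <= k < n) h (p k) * xi k ^+ 2 <= B) ->
  (\int[spectral_scalar_measure ip E (vec e xi)]_s (h s)%:E <= B%:E)%E.
Proof.
move=> e_on pe xi2 h0 hB; rewrite spectral_integralE ge0_integralTE; last first.
  by move=> s; rewrite lee_fin.
apply: ge_ereal_sup => _ [g /= gh <-].
rewrite -integralT_nnsfun integral_simple lee_fin (ipC ip_inner).
have hc := ip_vec_cvg ip_inner e_on (z := simple_op g (vec e xi)) xi2.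
rewrite -(cvg_lim _ hc)//; apply: limr_le; first by apply/cvg_ex; eexists; exact: hc.
apply: nearW => n; apply: le_trans (hB n); apply: ler_sum => k _.
rewrite -simple_op_sym (simple_op_point _ (pe k)) !ipE (ipC ip_inner) ip_vec_e//.
rewrite mulrCA -expr2 ler_wpM2r ?sqr_ge0//.
by have := gh (p k); rewrite lee_fin.
Qed.

End functional_calculus.

(** * Series with a summable majorant, and powers of the operator on them *)

Lemma sum_tail_bounded (R : realType) (a M : nat -> R) (K : nat) (B : R) :
  (forall k, 0 <= a k) -> (forall k, 0 <= M k) ->
  (forall k, (K <= k)%N -> a k <= M k) -> (forall n, \sum_(0 <= k < n) M k <= B) ->
  exists C, forall n, \sum_(0 <= k < n) a k <= C.
Proof.
move=> a0 M0 aM MB; exists (\sum_(0 <= k < K) a k + B) => n.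
apply: (@le_trans _ _ (\sum_(0 <= k < K) a k + \sum_(0 <= k < n) M k)); last by rewrite lerD2l.
elim: n => [|n IH]; first by rewrite [leLHS]big_geq// [X in _ + X]big_geq// addr0 sumr_ge0.
have [nK|Kn] := ltnP n K.
  rewrite (big_cat_nat (n := n.+1) (p := K))//= -addrA lerDl addr_ge0 ?sumr_ge0//.
by rewrite !(big_nat_recr n)//= addrA lerD// aM.
Qed.

(** Dominated convergence for series: the tail of [M] is small uniformly in [s], and the head is a
    finite sum. The conclusion bounds all partial sums, the form in which norms of [vec] are
    estimated. *)
Lemma tannery (R : realType) (T : Type) (F : set_system T) (FF : Filter F)
    (a : T -> nat -> R) (M : nat -> R) (B : R) :
  (forall n, \sum_(0 <= k < n) M k <= B) ->
  (\forall s \near F, forall k, 0 <= a s k <= M k) ->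
  (forall k, a s k @[s --> F] --> 0) ->
  forall e, 0 < e -> \forall s \near F, forall n, \sum_(0 <= k < n) a s k <= e.
Proof.
move=> MB aM a0 e e0.
pose S := range (fun n => \sum_(0 <= k < n) M k).
have hS : has_sup S by split; [exists (\sum_(0 <= k < 0) M k), 0%N | exists B => _ [n _ <-]].
have [_ [K _ <-] HK] := sup_adherent (divr_gt0 e0 (ltr0n _ 2)) hS.
have cK : \sum_(0 <= k < K) a s k @[s --> F] --> 0.
  elim: (K) => [|j IH].
    by under eq_fun do rewrite big_geq//; exact: cvg_cst.
  under eq_fun do rewrite big_nat_recr//=.
  have h := cvgD IH (a0 j); rewrite addr0 in h; exact: h.
move/cvgrPdist_lt : cK => /(_ _ (divr_gt0 e0 (ltr0n _ 2))) cK.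
near=> s => n.
have as0 : forall k, 0 <= a s k <= M k by near: s.
have sK : `|0 - \sum_(0 <= k < K) a s k| < e / 2 by near: s.
have a_ge0 k : 0 <= a s k by case/andP: (as0 k).
apply: (@le_trans _ _ (\sum_(0 <= k < K + n) a s k)).
  by rewrite (big_cat_nat (n := n) (p := K + n))//= ?leq_addl// lerDl sumr_ge0.
rewrite (big_cat_nat (n := K))//= ?leq_addr//.
have h1 : \sum_(0 <= k < K) a s k <= e / 2.
  by move: sK; rewrite sub0r normrN => /(le_lt_trans (ler_norm _)) /ltW.
have h2 : \sum_(K <= k < K + n) a s k <= \sum_(K <= k < K + n) M k.
  by apply: ler_sum => k _; case/andP: (as0 k).
have h3 : \sum_(0 <= k < K + n) M k <= sup S.
  by apply: ub_le_sup; [case: hS|exists (K + n)%N].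
move: h3; rewrite (big_cat_nat (n := K))//= ?leq_addr// => h3.
by move: HK h1 h2 h3; lra.
Unshelve. all: by end_near. Qed.

Lemma mean_value (R : realType) (f f' : R -> R) (s t : R) :
  (forall r : R, 0 <= r -> is_derive r 1 f (f' r)) -> 0 <= s <= 1 -> 0 <= t <= 1 ->
  exists2 r, 0 <= r <= 1 & f s - f t = f' r * (s - t).
Proof.
move=> df; wlog st : s t / t <= s.
  move=> H s01 t01; have [/H|/ltW/H] := leP t s; first exact.
  move=> /(_ t01 s01)[r r01 E]; exists r => //.
  by apply: oppr_inj; rewrite opprB E; ring.
move=> /andP[s0 s1] /andP[t0 t1].
have [||r] := @MVT_segment R f f' t s st.
- by move=> x /[!in_itv]/= /andP[/ltW tx _]; apply: df; exact: le_trans tx.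
- apply: derivable_within_continuous => x /[!in_itv]/= /andP[tx _].
  by have [] := df x (le_trans t0 tx).
rewrite in_itv/= => /andP[tr rs] E; exists r => //.
by rewrite (le_trans t0 tr) (le_trans rs s1).
Qed.

Section powers.
Variables (R : realType) (H : completeNormedModType R) (ip : H -> H -> R).
Variable E : set (measurableTypeR R) -> H -> H.
Hypothesis ip_inner : inner_product ip.
Hypothesis E_pvm : projection_valued_measure ip E.
Variables (f : nat -> H) (l : nat -> R).
Hypothesis f_orthonormal : forall i j, ip (f i) (f j) = (i == j)%:R.
Hypothesis l_ge1 : forall k, 1 <= l k.
Hypothesis f_eigen : forall k, E [set l k ^+ 2] (f k) = f k.

Local Notation vec := (vec f).

Let l_gt0 k : 0 < l k. Proof. exact: lt_le_trans (l_ge1 k). Qed.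

Lemma powR_sqr b k : (l k ^+ 2) `^ b = l k `^ (2 * b).
Proof. by rewrite -powR_mulrn ?(ltW (l_gt0 k))// -powRrM. Qed.

Lemma powR_sqr_sqr b k : ((l k ^+ 2) `^ b) ^+ 2 = l k `^ (4 * b).
Proof.
rewrite powR_sqr -powR_mulrn ?powR_ge0// -powRrM; congr (_ `^ _); ring.
Qed.

Lemma powR_ge1 b k : 0 <= b -> 1 <= l k `^ b.
Proof. by move=> b0; rewrite -(powRr0 (l k)); apply: ler_powR. Qed.

Let mpow (b : R) : measurable_fun setT (fun s : measurableTypeR R => s `^ b).
Proof. exact: measurable_powR. Qed.

Let Apow_spec b v : Apow_dom ip E b v ->
  [/\ spectral_integral_graph ip E (fun s => s `^ b) v (Apow ip E b v),
    ((`|Apow ip E b v| ^+ 2)%:E = \int[spectral_scalar_measure ip E v]_s ((s `^ b) ^+ 2)%:E)%E &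
    forall p e, E [set p] e = e -> ip (Apow ip E b v) e = p `^ b * ip v e].
Proof. by apply: spectral_opP => // s; exact: powR_ge0. Qed.

Lemma ip_Apow b v k : Apow_dom ip E b v ->
  ip (Apow ip E b v) (f k) = l k `^ (2 * b) * ip v (f k).
Proof. by move=> /Apow_spec[_ _ h]; rewrite (h _ _ (f_eigen k)) powR_sqr. Qed.

Lemma Apow_vec_le b xi B : l2 xi ->
  (forall n, \sum_(0 <= k < n) l k `^ (4 * b) * xi k ^+ 2 <= B) ->
  Apow_dom ip E b (vec xi) /\ `|Apow ip E b (vec xi)| ^+ 2 <= B.
Proof.
move=> xi2 hB.
have h : (\int[spectral_scalar_measure ip E (vec xi)]_s ((s `^ b) ^+ 2)%:E <= B%:E)%E.
  apply: (@integral_vec_le _ _ _ _ ip_inner E_pvm f (fun k => l k ^+ 2)) => //.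
    by move=> s; exact: sqr_ge0.
  by move=> n; under eq_bigr do rewrite powR_sqr_sqr.
have d : Apow_dom ip E b (vec xi).
  by rewrite /Apow_dom /spectral_domain/= (le_lt_trans h)// ltry.
by split => //; have [_ n2 _] := Apow_spec d; rewrite -lee_fin n2.
Qed.

Lemma Apow_vec_ge b xi n : l2 xi -> Apow_dom ip E b (vec xi) ->
  \sum_(0 <= k < n) l k `^ (4 * b) * xi k ^+ 2 <= `|Apow ip E b (vec xi)| ^+ 2.
Proof.
move=> xi2 d; have := bessel ip_inner f_orthonormal (Apow ip E b (vec xi)) n.
apply: le_trans; rewrite le_eqVlt; apply/orP; left; apply/eqP; apply: eq_bigr => k _.
by rewrite ip_Apow// (ip_vec_e ip_inner f_orthonormal)// exprMn -powR_sqr powR_sqr_sqr.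
Qed.

(** The coefficients on both sides agree; as the system may be incomplete, [vec_unique] also needs
    the norm bound, which [Apow_vec_le] supplies. *)
Lemma Apow_vec b xi B : l2 xi ->
  (forall n, \sum_(0 <= k < n) l k `^ (4 * b) * xi k ^+ 2 <= B) ->
  Apow ip E b (vec xi) = vec (fun k => l k `^ (2 * b) * xi k).
Proof.
move=> xi2 hB; have [d _] := Apow_vec_le xi2 hB.
have E4 n : \sum_(0 <= k < n) (l k `^ (2 * b) * xi k) ^+ 2 =
    \sum_(0 <= k < n) l k `^ (4 * b) * xi k ^+ 2.
  by apply: eq_bigr => k _; rewrite exprMn -powR_sqr powR_sqr_sqr.
have z2 : l2 (fun k => l k `^ (2 * b) * xi k) by exists B => n; rewrite E4.
apply: (vec_unique ip_inner f_orthonormal) => // [k|].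
  by rewrite ip_Apow// (ip_vec_e ip_inner f_orthonormal).
have [_ h] : Apow_dom ip E b (vec xi) /\
    `|Apow ip E b (vec xi)| ^+ 2 <= `|vec (fun k => l k `^ (2 * b) * xi k)| ^+ 2.
  by apply: Apow_vec_le => // n; rewrite -E4; exact: (norm_vec_ge ip_inner f_orthonormal n z2).
exact: h.
Qed.

Lemma l2_weight b xi B : 0 <= b ->
  (forall n, \sum_(0 <= k < n) l k `^ (4 * b) * xi k ^+ 2 <= B) ->
  forall n, \sum_(0 <= k < n) xi k ^+ 2 <= B.
Proof.
move=> b0 hB n; apply: le_trans (hB n); apply: ler_sum => k _.
by rewrite ler_peMl ?sqr_ge0// powR_ge1// mulr_ge0.
Qed.

Lemma graph_norm_vec b xi B : 0 <= b ->
  (forall n, \sum_(0 <= k < n) l k `^ (4 * b) * xi k ^+ 2 <= B) ->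
  graph_norm ip E b (vec xi) \is a fin_num /\
  0 <= fine (graph_norm ip E b (vec xi)) <= 2 * Num.sqrt B.
Proof.
move=> b0 hB; have hB1 := l2_weight b0 hB.
have xi2 : l2 xi by exists B.
have [d n2] := Apow_vec_le xi2 hB.
have n1 := norm_vec_le ip_inner f_orthonormal hB1.
have sq (x : R) : 0 <= x -> x ^+ 2 <= B -> x <= Num.sqrt B.
  by move=> x0 xB; rewrite -(ger0_norm x0) -sqrtr_sqr ler_wsqrtr.
rewrite /graph_norm /Apow_norm; case: asboolP => // _.
rewrite -EFinD; split => //=; rewrite addr_ge0//=.
by have := sq _ (normr_ge0 _) n1; have := sq _ (normr_ge0 _) n2; lra.
Qed.

(** All continuity and differentiability in [D(A^b)] reduces to this: convergence of each
    coefficient plus a summable majorant uniform in the parameter. *)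
Lemma graph_norm_cvg (T : Type) (F : set_system T) (FF : Filter F) b
    (xi : T -> nat -> R) (M : nat -> R) (B : R) (x : T -> H) : 0 <= b ->
  (forall n, \sum_(0 <= k < n) M k <= B) ->
  (\forall s \near F, forall k, l k `^ (4 * b) * xi s k ^+ 2 <= M k) ->
  (forall k, xi s k @[s --> F] --> 0) ->
  (\forall s \near F, x s = vec (xi s)) ->
  graph_norm ip E b (x s) @[s --> F] --> 0%E.
Proof.
move=> b0 MB xM xi0 xE.
have xM' : \forall s \near F, forall k, 0 <= l k `^ (4 * b) * xi s k ^+ 2 <= M k.
  by apply: filterS xM => s h k; rewrite mulr_ge0 ?powR_ge0 ?sqr_ge0//=.
have cv k : l k `^ (4 * b) * xi s k ^+ 2 @[s --> F] --> 0.
  rewrite [X in _ --> X](_ : _ = l k `^ (4 * b) * (0 * 0)); last by rewrite !mulr0.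
  by apply: cvgM; [exact: cvg_cst|rewrite -expr2; apply: cvgM].
have tan := tannery FF MB xM' cv.
apply: cvg_EFin.
  near=> s; have -> : x s = vec (xi s) by near: s.
  have h : forall n, \sum_(0 <= k < n) l k `^ (4 * b) * xi s k ^+ 2 <= 1.
    by near: s; exact: tan.
  by have [] := graph_norm_vec b0 h.
apply/cvgrPdist_le => e e0.
have e2 : 0 < (e / 2) ^+ 2 by rewrite exprn_gt0// divr_gt0.
near=> s; rewrite /=; have -> : x s = vec (xi s) by near: s.
have h : forall n, \sum_(0 <= k < n) l k `^ (4 * b) * xi s k ^+ 2 <= (e / 2) ^+ 2.
  by near: s; exact: tan.
have [_ /andP[h1 h2]] := graph_norm_vec b0 h.
rewrite sub0r normrN ger0_norm// (le_trans h2)// sqrtr_sqr ger0_norm ?divr_ge0 ?(ltW e0)//.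
lra.
Unshelve. all: by end_near. Qed.

End powers.

(** * Solutions of the Kirchhoff equation *)

Lemma quotient_cvg (R : realType) (h : R -> R) (t d : R) (I : set R) :
  is_derive t 1 h d ->
  (s - t)^-1 * (h s - h t) - d @[s --> within I t^'] --> 0.
Proof.
move=> dh; apply/cvgrPdist_le => e e0; have [r r0 Hr] := is_derive_local dh e0.
exists r => //= s /= ts st _.
have st0 : s - t != 0 by rewrite subr_eq0.
rewrite distrC in ts; have := Hr s ts.
rewrite sub0r normrN -ler_pdivrMr ?normr_gt0// -normfV -normrM => le_e; apply: le_trans le_e.
by rewrite le_eqVlt; apply/orP; left; apply/eqP; congr (`|_|); field.
Qed.

Lemma is_derive_cvg (R : realType) (h : R -> R) (t d : R) (I : set R) :
  is_derive t 1 h d -> h s - h t @[s --> within I (nbhs t)] --> 0.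
Proof.
move=> dh; have ch : h s @[s --> within I (nbhs t)] --> h t.
  apply: cvg_within_filter; apply/differentiable_continuous/derivable1_diffP.
  by case: dh.
have := cvgB ch (@cvg_cst _ (h t) _ (within I (nbhs t)) _).
by rewrite subrr; exact.
Qed.

Section kirchhoff.
Variables (R : realType) (H : completeNormedModType R) (ip : H -> H -> R).
Variable E : set (measurableTypeR R) -> H -> H.
Hypothesis ip_inner : inner_product ip.
Hypothesis E_pvm : projection_valued_measure ip E.
Variables (f : nat -> H) (l : nat -> R).
Hypothesis f_orthonormal : forall i j, ip (f i) (f j) = (i == j)%:R.
Hypothesis l_ge1 : forall k, 1 <= l k.
Hypothesis f_eigen : forall k, E [set l k ^+ 2] (f k) = f k.
Variables (c : R -> R) (w w' : nat -> R -> R).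
Hypothesis c01 : forall t, 0 <= c t <= 1.
Hypothesis dw : forall k (t : R), 0 <= t -> is_derive t 1 (w k) (w' k t) /\
        is_derive t 1 (w' k) (- (l k ^+ 2 * c t * w k t)).
Hypothesis w_small : forall k t, 0 <= t <= 1 ->
  l k.+1 * (w' k.+1 t ^+ 2 + l k.+1 ^+ 2 * w k.+1 t ^+ 2) <= 1 / (8 * 2 ^+ k.+1).

Local Notation vec := (vec f).
Local Notation u := (fun t => vec (fun k => w k t)).
Local Notation u' := (fun t => vec (fun k => w' k t)).

Let l_gt0 k : 0 < l k. Proof. exact: lt_le_trans (l_ge1 k). Qed.

(** The 0-th mode is bounded by compactness of [[0, 1]], the others by [w_small]. The result is one
    summable majorant, uniform in time, for every limit taken below. *)
Lemma mode_bound : exists M B, [/\ forall k t, 0 <= t <= 1 ->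
    l k * (w' k t ^+ 2 + l k ^+ 2 * w k t ^+ 2) <= M k,
  forall k, 0 <= M k, forall k, M k.+1 = 1 / (8 * 2 ^+ k.+1) &
  forall n, \sum_(0 <= k < n) M k <= B].
Proof.
pose h t := l 0 * (w' 0 t ^+ 2 + l 0 ^+ 2 * w 0 t ^+ 2).
have ch : {within `[0, 1], continuous h}.
  apply: derivable_within_continuous => t; rewrite in_itv/= => /andP[t0 _].
  have [d1 d2] := dw 0 t0.
  have : is_derive t 1 h (l 0 * (2 * w' 0 t * (- (l 0 ^+ 2 * c t * w 0 t)) +
      l 0 ^+ 2 * (2 * w 0 t * w' 0 t))).
    by rewrite /h; apply: is_derive_eq; rewrite /GRing.scale/=; ring.
  by case.
have [t0 t01 Ht0] := EVT_max ler01 ch.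
pose C0 := h t0.
pose M k := if k is j.+1 then 1 / (8 * 2 ^+ j.+1) else C0 : R.
have M0 k : 0 <= M k.
  case: k => [|k]; last by rewrite /M divr_ge0// mulr_ge0// exprn_ge0.
  apply: mulr_ge0; first exact: ltW.
  by rewrite addr_ge0 ?sqr_ge0// (mulr_ge0 (sqr_ge0 _) (sqr_ge0 _)).
exists M, (C0 + 1 / 8); split => //.
- move=> [|k] t tin; last exact: w_small.
  by apply: Ht0; rewrite in_itv.
- move=> n; apply: (@le_trans _ _ (\sum_(0 <= k < n.+1) M k)).
    by rewrite big_nat_recr//= lerDl.
  suff -> : \sum_(0 <= k < n.+1) M k = C0 + 1 / 8 - 1 / (8 * 2 ^+ n).
    have : 0 <= 1 / (8 * 2 ^+ n) :> R by rewrite divr_ge0// mulr_ge0// exprn_ge0.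
    lra.
  elim: n => [|n IH]; first by rewrite big_nat1 expr0 mulr1 /=; ring.
  rewrite big_nat_recr//= IH exprS; field; exact: expf_neq0.
Qed.

Let M := sval (cid mode_bound).
Let B := sval (cid (svalP (cid mode_bound))).
Let MB_spec := svalP (cid (svalP (cid mode_bound))).

Let M_bound k t : 0 <= t <= 1 -> l k * (w' k t ^+ 2 + l k ^+ 2 * w k t ^+ 2) <= M k.
Proof. by case: MB_spec => h _ _ _; exact: h. Qed.
Let M_ge0 k : 0 <= M k. Proof. by case: MB_spec => _ h _ _; exact: h. Qed.
Let M_sum n : \sum_(0 <= k < n) M k <= B. Proof. by case: MB_spec => _ _ _ h; exact: h. Qed.
Let M4_sum n : \sum_(0 <= k < n) 4 * M k <= 4 * B.
Proof. by rewrite -big_distrr/= ler_wpM2l. Qed.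

Let w_bound3 k t : 0 <= t <= 1 -> l k ^+ 3 * w k t ^+ 2 <= M k.
Proof.
move=> t01; apply: le_trans (M_bound k t01); rewrite exprS -mulrA ler_wpM2l ?(ltW (l_gt0 k))//.
by rewrite lerDr sqr_ge0.
Qed.

Let w'_bound k t : 0 <= t <= 1 -> l k * w' k t ^+ 2 <= M k.
Proof.
move=> t01; apply: le_trans (M_bound k t01); rewrite ler_wpM2l ?(ltW (l_gt0 k))//.
by rewrite lerDl (mulr_ge0 (sqr_ge0 _) (sqr_ge0 _)).
Qed.

Let l_le3 k : l k <= l k ^+ 3.
Proof. by rewrite -[leLHS]expr1 ler_weXn2l. Qed.

Let w_bound k t : 0 <= t <= 1 -> l k * w k t ^+ 2 <= M k.
Proof.
by move=> t01; apply: le_trans (w_bound3 k t01); rewrite ler_wpM2r ?sqr_ge0.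
Qed.

Let powR1 k : l k `^ (4 * (1 / 4)) = l k.
Proof. by rewrite mulrC divfK ?powRr1 ?(ltW (l_gt0 k)). Qed.

Let powR3 k : l k `^ (4 * (3 / 4)) = l k ^+ 3.
Proof.
rewrite (_ : 4 * (3 / 4) = 3%:R); last by field.
by rewrite powR_mulrn// ltW.
Qed.

Let powR2 k : l k `^ (4 * (1 / 2)) = l k ^+ 2.
Proof.
rewrite (_ : 4 * (1 / 2) = 2%:R); last by field.
by rewrite powR_mulrn// ltW.
Qed.

Let sqrB_le (a x y m : R) : 0 <= a -> a * x ^+ 2 <= m -> a * y ^+ 2 <= m -> a * (x - y) ^+ 2 <= 4 * m.
Proof.
move=> a0 h1 h2; have := mulr_ge0 a0 (sqr_ge0 (x + y)); rewrite sqrrD sqrrB; lra.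
Qed.

Lemma position_l2 t : 0 <= t <= 1 -> l2 (fun k => w k t).
Proof.
move=> t01; exists B; apply: (@l2_weight _ _ l_ge1 (1 / 4)) => // n.
apply: le_trans (M_sum n); apply: ler_sum => k _.
by rewrite powR1 w_bound.
Qed.

Lemma velocity_l2 t : 0 <= t <= 1 -> l2 (fun k => w' k t).
Proof.
move=> t01; exists B; apply: (@l2_weight _ _ l_ge1 (1 / 4)) => // n.
apply: le_trans (M_sum n); apply: ler_sum => k _.
by rewrite powR1 w'_bound.
Qed.

Variable T0 : R.
Hypothesis T0_le1 : T0 <= 1.
Let I : set R := `[0, T0]%classic.

Let I01 t : I t -> 0 <= t <= 1.
Proof. by rewrite /I/= in_itv/= => /andP[-> /le_trans]; apply. Qed.

Let vecB xi zeta : l2 xi -> l2 zeta -> vec xi - vec zeta = vec (fun k => xi k - zeta k).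
Proof.
move=> h1 h2; rewrite -scaleN1r addrC -(vec_lin ip_inner f_orthonormal _ h2 h1).
by congr vec; apply/funext => k; ring.
Qed.

Lemma C0_position b : b = 1 / 4 \/ b = 3 / 4 -> C0_dom ip E I b u.
Proof.
move=> b34; have b0 : 0 <= b by case: b34 => ->.
have bound k t : I t -> l k `^ (4 * b) * w k t ^+ 2 <= M k.
  by move=> /I01 t01; case: b34 => ->; rewrite ?powR1 ?powR3; [exact: w_bound|exact: w_bound3].
split => [t It|t It].
  have [] := @Apow_vec_le _ _ _ _ ip_inner E_pvm f l f_orthonormal l_ge1 f_eigen b (fun k => w k t) B.
  - exact: position_l2 (I01 It).
  - by move=> n; apply: le_trans (M_sum n); apply: ler_sum => k _; exact: bound.
  - by [].
apply: (@graph_norm_cvg _ _ _ _ ip_inner E_pvm f l f_orthonormal l_ge1 f_eigen _ _ _ b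
  (fun s k => w k s - w k t) (fun k => 4 * M k) (4 * B)) => //.
- near=> s => k; have Is : I s by near: s; exact: withinT.
  by apply: sqrB_le; [exact: powR_ge0|exact: bound|exact: bound].
- move=> k; have /andP[t0 _] := I01 It; have [d _] := dw k t0; exact: is_derive_cvg.
- near=> s; have Is : I s by near: s; exact: withinT.
  by rewrite vecB//; apply: position_l2; exact: I01.
Unshelve. all: by end_near. Qed.

Lemma C0_velocity : C0_dom ip E I (1 / 4) u'.
Proof.
have b0 : 0 <= 1 / 4 :> R by [].
have bound k t : I t -> l k `^ (4 * (1 / 4)) * w' k t ^+ 2 <= M k.
  by move=> /I01 t01; rewrite powR1; exact: w'_bound.
split => [t It|t It].
  have [] := @Apow_vec_le _ _ _ _ ip_inner E_pvm f l f_orthonormal l_ge1 f_eigen (1 / 4) (fun k => w' k t) B.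
  - exact: velocity_l2 (I01 It).
  - by move=> n; apply: le_trans (M_sum n); apply: ler_sum => k _; exact: bound.
  - by [].
apply: (@graph_norm_cvg _ _ _ _ ip_inner E_pvm f l f_orthonormal l_ge1 f_eigen _ _ _ (1 / 4)
  (fun s k => w' k s - w' k t) (fun k => 4 * M k) (4 * B)) => //.
- near=> s => k; have Is : I s by near: s; exact: withinT.
  by apply: sqrB_le; [exact: powR_ge0|exact: bound|exact: bound].
- move=> k; have /andP[t0 _] := I01 It; have [_ d] := dw k t0; exact: is_derive_cvg.
- near=> s; have Is : I s by near: s; exact: withinT.
  by rewrite vecB//; apply: velocity_l2; exact: I01.
Unshelve. all: by end_near. Qed.

(** The mean value theorem replaces difference quotients by values of the derivative, to which the
    uniform majorant applies. The alternative 0 covers [s = t], where the inverse of 0 is 0. *)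
Let quotient_mean (h h' : R -> R) s t : (forall r : R, 0 <= r -> is_derive r 1 h (h' r)) ->
  I s -> I t -> exists2 r, 0 <= r <= 1 & (s - t)^-1 * (h s - h t) = h' r \/
    (s - t)^-1 * (h s - h t) = 0.
Proof.
move=> dh /I01 s01 /I01 t01; have [r r01 ->] := mean_value dh s01 t01.
exists r => //; have [->|st] := eqVneq s t; first by right; rewrite subrr !mulr0.
by left; field; rewrite subr_eq0.
Qed.

Let vecQ a xi zeta eta : l2 xi -> l2 zeta -> l2 eta ->
  a *: (vec xi - vec zeta) - vec eta = vec (fun k => a * (xi k - zeta k) - eta k).
Proof.
move=> h1 h2 h3.
have h12 : l2 (fun k => xi k - zeta k).
  have := l2_lin (-1) h2 h1; congr l2; apply/funext => k; ring.
rewrite vecB// -[X in _ - X]scale1r.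
have e0 : a *: vec (fun k => xi k - zeta k) - 1 *: vec eta =
   (-1) *: vec eta + (a *: vec (fun k => xi k - zeta k) + vec (fun=> 0)).
  have -> : vec (fun=> 0) = 0.
    apply/eqP; rewrite -normr_eq0 -sqrf_eq0 eq_le sqr_ge0 andbT.
    by apply: (norm_vec_le ip_inner f_orthonormal) => n; rewrite big1// => k _; rewrite expr0n.
  by rewrite addr0 scale1r scaleN1r addrC.
have z2 : l2 (fun _ : nat => 0 : R) by exists 0 => n; rewrite big1// => k _; rewrite expr0n.
rewrite e0 -(vec_lin ip_inner f_orthonormal _ h12 z2).
rewrite -(vec_lin ip_inner f_orthonormal); [|exact: h3|exact: l2_lin].
by congr vec; apply/funext => k; ring.
Qed.

Lemma C1_position : C1_dom ip E I (1 / 4) u u'.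
Proof.
split; [by apply: C0_position; left|exact: C0_velocity|].
move=> t It; have t01 := I01 It.
have b0 : 0 <= 1 / 4 :> R by [].
apply: (@graph_norm_cvg _ _ _ _ ip_inner E_pvm f l f_orthonormal l_ge1 f_eigen _ _ _ (1 / 4)
  (fun s k => (s - t)^-1 * (w k s - w k t) - w' k t) (fun k => 4 * M k) (4 * B)) => //.
- near=> s => k; have Is : I s by near: s; exact: withinT.
  rewrite powR1; have [r r01 hr] := quotient_mean (fun r r0 => proj1 (dw k r0)) Is It.
  apply: sqrB_le; [exact: ltW| |exact: w'_bound].
  by case: hr => ->; [exact: w'_bound|rewrite expr0n/= mulr0].
- move=> k; have /andP[t0 _] := t01; have [d _] := dw k t0; exact: quotient_cvg.
- near=> s; have Is : I s by near: s; exact: withinT.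
  by rewrite vecQ//; [exact: position_l2 (I01 Is)|exact: position_l2|exact: velocity_l2].
Unshelve. all: by end_near. Qed.

(** * The energy as a clock, and the nonlinearity read on it *)

Let energy t := `|Apow ip E (1 / 2) (u t)| ^+ 2.

Let energy_cvg t : 0 <= t <= 1 ->
  \sum_(0 <= k < n) (l k * w k t) ^+ 2 @[n --> \oo] --> energy t.
Proof.
move=> t01.
have E2 n : \sum_(0 <= k < n) (l k * w k t) ^+ 2 = \sum_(0 <= k < n) l k `^ (4 * (1 / 2)) * w k t ^+ 2.
  by apply: eq_bigr => k _; rewrite powR2 exprMn.
have hB n : \sum_(0 <= k < n) l k `^ (4 * (1 / 2)) * w k t ^+ 2 <= B.
  apply: le_trans (M_sum n); apply: ler_sum => k _; apply: le_trans (w_bound3 k t01).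
  by rewrite powR2 ler_wpM2r ?sqr_ge0// ler_weXn2l.
rewrite /energy (Apow_vec ip_inner E_pvm f_orthonormal l_ge1 f_eigen (position_l2 t01) hB).
rewrite (_ : (fun k => l k `^ (2 * (1 / 2)) * w k t) = (fun k => l k * w k t)); last first.
  apply/funext => k; rewrite (_ : 2 * (1 / 2) = 1); last by field.
  by rewrite powRr1// ltW.
by apply: (norm_vec_cvg ip_inner f_orthonormal); exists B => n; rewrite E2.
Qed.

Hypothesis T0_gt0 : 0 < T0.
Hypothesis w0_large : forall t, I t -> 1 <= w 0 t /\ 1 / 2 <= w' 0 t.

(** The 0-th term grows at rate [2 * l 0 ^+ 2 * w 0 t * w' 0 t >= 1]. Term [k.+1] decreases at rate
    at most [1 / (8 * 2 ^+ k.+1)] by [w_small], and these rates add up to at most [1 / 8]. Partial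
    sums suffice, since the energy is their limit. *)
Lemma energy_increase a b : I a -> I b -> a <= b -> (b - a) / 2 <= energy b - energy a.
Proof.
move=> Ia Ib ab; have a01 := I01 Ia; have b01 := I01 Ib.
have ba0 : 0 <= b - a by rewrite subr_ge0.
have cD : \sum_(0 <= k < n) (l k * w k b) ^+ 2 - \sum_(0 <= k < n) (l k * w k a) ^+ 2
    @[n --> \oo] --> energy b - energy a.
  by apply: cvgB; exact: energy_cvg.
rewrite -(cvg_lim _ cD)//; apply: limr_ge; first by apply/cvg_ex; eexists; exact: cD.
exists 1%N; first by [].
move=> [|n] n1 /=; first by [].
clear n1.
rewrite /= -sumrB big_nat_recl//.
have h0 : b - a <= (l 0 * w 0 b) ^+ 2 - (l 0 * w 0 a) ^+ 2.
  suff : (l 0 * w 0 a) ^+ 2 - a <= (l 0 * w 0 b) ^+ 2 - b by lra.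
  apply: (@derive_ge0_le _ (fun t => (l 0 * w 0 t) ^+ 2 - t)
    (fun t => 2 * l 0 ^+ 2 * w 0 t * w' 0 t - 1)) => // t /andP[at_ tb].
    have [d _] := dw 0 (le_trans (proj1 (andP a01)) at_).
    by apply: is_derive_eq; rewrite /GRing.scale/=; ring.
  have It : I t.
    move: Ia Ib; rewrite /I/= !in_itv/= => /andP[a0 _] /andP[_ bT].
    by rewrite (le_trans a0 at_) (le_trans tb bT).
  have [w1 w2] := w0_large It.
  have l1 : 1 <= l 0 ^+ 2 by rewrite exprn_ege1.
  have : 1 * (1 / 2) <= w 0 t * w' 0 t by apply: ler_pM.
  move=> h; have : 1 * (1 / 2) <= l 0 ^+ 2 * (w 0 t * w' 0 t) by apply: ler_pM => //; rewrite mul1r in h.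
  by rewrite !mul1r => ?; lra.
have hk k : - (1 / (8 * 2 ^+ k.+1)) * (b - a) <= (l k.+1 * w k.+1 b) ^+ 2 - (l k.+1 * w k.+1 a) ^+ 2.
  have [r r01 ->] := @mean_value _ (fun t => (l k.+1 * w k.+1 t) ^+ 2)
    (fun t => 2 * l k.+1 ^+ 2 * w k.+1 t * w' k.+1 t) b a
    (fun r r0 => ltac:(have [d _] := dw k.+1 r0; apply: is_derive_eq; rewrite /GRing.scale/=; ring)) b01 a01.
  rewrite ler_wpM2r//; have := w_small k r01.
  have : 0 <= l k.+1 * (w' k.+1 r + l k.+1 * w k.+1 r) ^+ 2 by rewrite mulr_ge0 ?sqr_ge0// ltW.
  by rewrite sqrrD exprMn; lra.
have hs : \sum_(0 <= k < n) (1 / (8 * 2 ^+ k.+1)) <= 1 / 8 :> R.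
  suff -> : \sum_(0 <= k < n) (1 / (8 * 2 ^+ k.+1)) = 1 / 8 - 1 / (8 * 2 ^+ n) :> R.
    by rewrite gerBl divr_ge0// mulr_ge0// exprn_ge0.
  elim: n {h0 hk cD} => [|n IH]; first by rewrite big_geq// expr0 mulr1 subrr.
  by rewrite big_nat_recr//= IH exprS; field; exact: expf_neq0.
have h1 : - (\sum_(0 <= k < n) (1 / (8 * 2 ^+ k.+1))) * (b - a) <=
    \sum_(0 <= k < n) ((l k.+1 * w k.+1 b) ^+ 2 - (l k.+1 * w k.+1 a) ^+ 2).
  by rewrite -sumrN big_distrl/=; apply: ler_sum => k _; exact: hk.
have h2 : (\sum_(0 <= k < n) (1 / (8 * 2 ^+ k.+1))) * (b - a) <= 1 / 8 * (b - a).
  by rewrite ler_wpM2r.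
by move: h0 h1 h2; rewrite mulNr; lra.
Qed.

(* The inverse of the energy, extended to all real [x]. *)
Let level x := [set t | I t /\ (t = 0 \/ energy t <= x)].
Let clock x := sup (level x).

Let I0 : I 0. Proof. by rewrite /I/= in_itv/= lexx ltW. Qed.

(** The alternative [t = 0] keeps the level set nonempty when [x] lies below the initial energy. *)
Let level_sup x : has_sup (level x).
Proof.
split; first by exists 0; split; [exact: I0|left].
by exists T0 => t []; rewrite /I/= in_itv/= => /andP[].
Qed.

Let clock_I x : I (clock x).
Proof.
rewrite /I/= in_itv/=; apply/andP; split.
  by apply: ub_le_sup; [case: (level_sup x)|split; [exact: I0|left]].
by apply: ge_sup; [case: (level_sup x)|move=> t []; rewrite /I/= in_itv/= => /andP[]].
Qed.

Let clock_energy t : I t -> clock (energy t) = t.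
Proof.
move=> It; apply/eqP; rewrite eq_le; apply/andP; split; last first.
  by apply: ub_le_sup; [case: (level_sup (energy t))|split => //; right].
apply: ge_sup; first by case: (level_sup (energy t)).
move=> s [Is [->|st]]; first by have /andP[] := I01 It.
rewrite leNgt; apply/negP => ts.
move: st (energy_increase It Is (ltW ts)); move: (energy s) (energy t) => p q; lra.
Qed.

(** Only [energy_increase] is used, not continuity of the energy: a time [a] just after [clock x]
    has energy above [x], and from [a] to [b] the energy rises by at least half the elapsed time. *)
Let clock_lip x y : x <= y -> 0 <= clock y - clock x <= 2 * (y - x).
Proof.
move=> xy; apply/andP; split.
  rewrite subr_ge0; apply: ge_sup; first by case: (level_sup x).
  move=> t [It h]; apply: ub_le_sup; first by case: (level_sup y).
  by split => //; case: h => [->|h]; [left|right; exact: le_trans xy].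
rewrite lerBlDr; apply: ge_sup; first by case: (level_sup y).
move=> b [Ib hb].
have [bx|xb] := leP b (clock x); first by rewrite (le_trans bx)// lerDr; lra.
apply/ler_addgt0Pr => e e0.
pose a := Num.min b (clock x + e).
have ax : clock x < a by rewrite /a lt_min xb ltrDl.
have Ia : I a.
  move: (clock_I x) Ib; rewrite /I/= !in_itv/= => /andP[h0 _] /andP[_ h1].
  by rewrite (le_trans h0 (ltW ax))/= ge_min h1.
have ea : x < energy a.
  rewrite ltNge; apply/negP => h.
  have : a <= clock x by apply: ub_le_sup; [case: (level_sup x)|split => //; right].
  by rewrite leNgt ax.
have hb' : energy b <= y.
  case: hb => // b0; move: xb; rewrite b0 ltNge.
  by have := clock_I x; rewrite /I/= in_itv/= => /andP[-> _].
have ab : a <= b by rewrite /a ge_min lexx.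
have := energy_increase Ia Ib ab.
have : a <= clock x + e by rewrite /a ge_min lexx orbT.
move: ea hb'; move: (energy a) (energy b) (clock x) => p q r; lra.
Qed.

Variables (omega : R -> R) (C : R).
Hypothesis C_ge0 : 0 <= C.
Hypothesis omega_ndecr : forall a b, 0 <= a -> a <= b -> omega a <= omega b.
Hypothesis omega_subadd : forall a b, 0 <= a -> 0 <= b ->
       omega (a + b) <= omega a + omega b.
Hypothesis c_modulus : forall s t, 0 <= s -> 0 <= t -> `|c s - c t| <= C * omega `|s - t|.

(** This is [c (clock x)], spelled out because [clock] is local to the section. *)
Definition nonlinearity x := c (sup [set t | `[0, T0]%classic t /\
  (t = 0 \/ `|Apow ip E (1 / 2) (u t)| ^+ 2 <= x)]).

(** The Lipschitz constant 2 of the clock passes through [omega] by subadditivity: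
    [omega (2 * s) <= 2 * omega s]. *)
Lemma nonlinearity_modulus x y :
  `|nonlinearity x - nonlinearity y| <= (2 * C) * omega `|x - y|.
Proof.
wlog xy : x y / x <= y.
  by move=> h; have [/h//|/ltW/h] := leP x y; rewrite distrC (distrC x).
have p z : 0 <= clock z by have /andP[] := I01 (clock_I z).
apply: (le_trans (c_modulus (p x) (p y))).
rewrite -/(clock x) -/(clock y) mulrAC mulrC ler_wpM2r//.
have /andP[h1 h2] := clock_lip xy.
rewrite distrC (ger0_norm h1) distrC ger0_norm ?subr_ge0//.
apply: le_trans (omega_ndecr h1 h2) _.
have xy0 : 0 <= y - x by rewrite subr_ge0.
have -> : 2 * (y - x) = (y - x) + (y - x) by ring.
apply: le_trans (omega_subadd xy0 xy0) _; lra.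
Qed.

(** The clock returns [t] at the energy of time [t], so the nonlinear coefficient is [c t]. The
    error of the difference quotient of [u'], tested on [v], is the inner product of one series
    [vec (xi s)] with the [1 / 4]-th power of [A] at [v]; its dual norm is therefore at most the
    norm of that series, which tends to 0 by [tannery]. *)
Lemma weak_solution : weak_kirchhoff_solution ip E I nonlinearity u u'.
Proof.
move=> t It; have t01 := I01 It.
exists (fun v => - (c t) * A_weak ip E (u t) v); last first.
  move=> v _; rewrite (_ : nonlinearity _ = c t); first by ring.
  by rewrite /nonlinearity; congr c; exact: clock_energy.
have b0 : 0 <= 1 / 4 :> R by [].
(* [zeta] is the coefficientwise error. The eigenvalue of [A] being [l k ^+ 2], the weight [-1 / 2]
   on [l k] is the power [-1 / 4] of [A], and turns the dual norm into an [l2] norm. *)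
pose zeta s k := (s - t)^-1 * (w' k s - w' k t) + l k ^+ 2 * c t * w k t.
pose xi s k := l k `^ (- (1 / 2)) * zeta s k.
have powh k : l k `^ (- (1 / 2)) ^+ 2 = (l k)^-1.
  rewrite -powR_mulrn ?powR_ge0// -powRrM (_ : - (1 / 2) * 2%:R = -1); last by field.
  by rewrite powRN powRr1// ltW.
have cbound k (r q : R) : 0 <= r <= 1 -> 0 <= q <= 1 ->
    (l k)^-1 * (l k ^+ 2 * c q * w k r) ^+ 2 <= M k.
  move=> r01 q01; apply: le_trans (w_bound3 k r01).
  have -> : (l k)^-1 * (l k ^+ 2 * c q * w k r) ^+ 2 = l k ^+ 3 * (c q ^+ 2 * w k r ^+ 2).
    by field; rewrite gt_eqF.
  rewrite ler_wpM2l ?exprn_ge0 ?(ltW (l_gt0 k))//.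
  by rewrite ler_piMl ?sqr_ge0// expr_le1//; have /andP[] := c01 q.
have cbound0 s k : I s -> xi s k ^+ 2 <= 4 * M k.
  move=> Is; rewrite /xi exprMn powh /zeta -[_ * c t * _]opprK.
  have lV0 : 0 <= (l k)^-1 by rewrite invr_ge0 ltW.
  have [r r01 hr] := quotient_mean (fun r r0 => proj2 (dw k r0)) Is It.
  apply: sqrB_le => //; last by rewrite sqrrN cbound.
  by case: hr => ->; [rewrite sqrrN cbound|rewrite expr0n/= mulr0].
have xiB s : I s -> forall n, \sum_(0 <= k < n) xi s k ^+ 2 <= 4 * B.
  by move=> Is n; apply: le_trans (M4_sum n); apply: ler_sum => k _; exact: cbound0.
have xi_l2 s : I s -> l2 (xi s) by move=> /xiB ?; exists (4 * B).
have dom3 := (proj1 (C0_position (or_intror erefl))) t It.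
have u3 : Apow ip E (3 / 4) (u t) = vec (fun k => l k `^ (2 * (3 / 4)) * w k t).
  apply: (Apow_vec ip_inner E_pvm f_orthonormal l_ge1 f_eigen (position_l2 t01) (B := B)) => n.
  by apply: le_trans (M_sum n); apply: ler_sum => k _; rewrite powR3 w_bound3.
have l2_32 : l2 (fun k => l k `^ (2 * (3 / 4)) * w k t).
  exists B => n; apply: le_trans (M_sum n); apply: ler_sum => k _.
  apply: le_trans (w_bound3 k t01); by rewrite exprMn -(powR_sqr l_ge1) (powR_sqr_sqr l_ge1) powR3.
have pair s v : I s -> Apow_dom ip E (1 / 4) v ->
    ip ((s - t)^-1 *: (u' s - u' t)) v - - c t * A_weak ip E (u t) v =
    ip (vec (xi s)) (Apow ip E (1 / 4) v).
  move=> Is dv; rewrite /A_weak u3.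
  have h1 := ip_vec_cvg ip_inner f_orthonormal (z := v) (velocity_l2 (I01 Is)).
  have h2 := ip_vec_cvg ip_inner f_orthonormal (z := v) (velocity_l2 t01).
  have h3 := ip_vec_cvg ip_inner f_orthonormal (z := Apow ip E (1 / 4) v) l2_32.
  have h4 := ip_vec_cvg ip_inner f_orthonormal (z := Apow ip E (1 / 4) v) (xi_l2 _ Is).
  rewrite (ipZl ip_inner) (ipBl ip_inner).
  have h5 : (s - t)^-1 * (\sum_(0 <= k < n) w' k s * ip (f k) v -
      \sum_(0 <= k < n) w' k t * ip (f k) v) - - c t *
      (\sum_(0 <= k < n) l k `^ (2 * (3 / 4)) * w k t * ip (f k) (Apow ip E (1 / 4) v))
      @[n --> \oo] --> (s - t)^-1 * (ip (u' s) v - ip (u' t) v) -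
      - c t * ip (vec (fun k => l k `^ (2 * (3 / 4)) * w k t)) (Apow ip E (1 / 4) v).
    apply: cvgB; apply: cvgM; [exact: cvg_cst|exact: (cvgB h1 h2)|exact: cvg_cst|exact: h3].
  apply: (cvg_unique _ h5); first exact: norm_hausdorff.
  move: h4; apply: cvg_trans; apply: near_eq_cvg; apply: nearW => n /=; apply/esym.
  rewrite -sumrB !big_distrr/= -sumrB; apply: eq_bigr => k _.
  rewrite ![ip (f k) _](ipC ip_inner) (ip_Apow ip_inner E_pvm l_ge1 f_eigen _ dv).
  rewrite /xi /zeta.
  have p1 : l k `^ (- (1 / 2)) * l k `^ (2 * (1 / 4)) = 1.
    rewrite -powRD; last by apply/implyP => _; rewrite gt_eqF.
    by rewrite (_ : - (1 / 2) + 2 * (1 / 4) = 0) ?powRr0//; field.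
  have p2 : l k `^ (2 * (3 / 4)) * l k `^ (2 * (1 / 4)) = l k ^+ 2.
    rewrite -powRD; last by apply/implyP => _; rewrite gt_eqF.
    rewrite (_ : 2 * (3 / 4) + 2 * (1 / 4) = 2%:R); last by field.
    by rewrite powR_mulrn// ltW.
  transitivity ((s - t)^-1 * (w' k s - w' k t) * ip v (f k) +
    c t * w k t * ip v (f k) * (l k `^ (2 * (3 / 4)) * l k `^ (2 * (1 / 4)))); first by ring.
  transitivity (((s - t)^-1 * (w' k s - w' k t) + l k ^+ 2 * c t * w k t) * ip v (f k) *
    (l k `^ (- (1 / 2)) * l k `^ (2 * (1 / 4)))); last by ring.
  by rewrite p1 p2; ring.
(* The zero vector belongs to the unit ball over which the dual norm is a supremum, so the dual norm
   is nonnegative. *)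
have gn0 : (graph_norm ip E (1 / 4) 0%R <= 1)%E.
  have e0 : (0 : H) = vec (fun=> 0).
    apply/esym/eqP; rewrite -normr_eq0 -sqrf_eq0 eq_le sqr_ge0 andbT.
    by apply: (norm_vec_le ip_inner f_orthonormal) => n; rewrite big1// => k _; rewrite expr0n.
  have [fin /andP[_ h]] := @graph_norm_vec _ _ _ _ ip_inner E_pvm f l f_orthonormal l_ge1 f_eigen
    (1 / 4) (fun=> 0) 0 b0 (fun n => ltac:(rewrite big1// => k _; rewrite expr0n/= mulr0//)).
  rewrite e0 -(fineK fin) lee_fin (le_trans h)// sqrtr0; lra.
pose defect s v := ip ((s - t)^-1 *: (u' s - u' t)) v - - c t * A_weak ip E (u t) v.
have dual s : I s -> (0 <= dual_norm ip E (1 / 4) (defect s) <= `|vec (xi s)|%:E)%E.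
  move=> Is; apply/andP; split.
    apply: (@le_trans _ _ `|defect s 0|%:E); first by rewrite lee_fin.
    by apply: ereal_sup_ubound; exists 0.
  apply: ge_ereal_sup => _ [v /= gv <-].
  have [dv av] : Apow_dom ip E (1 / 4) v /\ `|Apow ip E (1 / 4) v| <= 1.
    move: gv; rewrite /graph_norm /Apow_norm; case: asboolP => // dv.
    by rewrite -EFinD lee_fin => h; split => //; apply: le_trans h; rewrite lerDr.
  rewrite /defect pair// lee_fin (le_trans (cauchy_schwarz ip_inner _ _))//.
  by rewrite ler_piMr.
have zc k : xi s k @[s --> within I t^'] --> 0.
  have /andP[t0 _] := t01; have [_ d] := dw k t0.
  have h := cvgM (@cvg_cst _ (l k `^ (- (1 / 2))) _ (within I t^') _) (@quotient_cvg _ _ _ _ I d).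
  rewrite mulr0 in h.
  suff -> : (fun s => xi s k) = (fun s => l k `^ (- (1 / 2)) *
    ((s - t)^-1 * (w' k s - w' k t) - - (l k ^+ 2 * c t * w k t))) by exact: h.
  by apply/funext => s; rewrite /xi /zeta opprK.
have zc2 k : xi s k ^+ 2 @[s --> within I t^'] --> 0.
  by have h := cvgM (zc k) (zc k); rewrite mulr0 in h; exact: h.
have ev : \forall s \near within I t^', forall k, 0 <= xi s k ^+ 2 <= 4 * M k.
  near=> s => k; have Is : I s by near: s; exact: withinT.
  by rewrite sqr_ge0 cbound0.
have tan := @tannery _ _ (within I t^') _ (fun s k => xi s k ^+ 2) _ _ M4_sum ev zc2.
have small e : 0 < e -> \forall s \near within I t^', `|vec (xi s)| <= e.
  move=> e0; near=> s.
  have h : forall n, \sum_(0 <= k < n) xi s k ^+ 2 <= e ^+ 2.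
    by near: s; apply: tan; exact: exprn_gt0.
  rewrite -(ler_pXn2r (ltn0Sn 1)) ?nnegrE ?(ltW e0)//.
  exact: (norm_vec_le ip_inner f_orthonormal h).
rewrite /dual_derivative; apply: cvg_EFin.
  near=> s; have Is : I s by near: s; exact: withinT.
  have /andP[d0 d1] := dual s Is.
  by rewrite ge0_fin_numE// (le_lt_trans d1) ?ltry.
apply/cvgrPdist_le => e e0; near=> s; have Is : I s by near: s; exact: withinT.
have /andP[d0 d1] := dual s Is; have se : `|vec (xi s)| <= e by near: s; exact: small.
rewrite sub0r normrN /= ger0_norm ?fine_ge0//; apply: le_trans se.
rewrite -lee_fin fineK// ge0_fin_numE// (le_lt_trans d1) ?ltry//.
Unshelve. all: by end_near. Qed.

End kirchhoff.

(** * Regularity of the data and of the solution *)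

Section regularity.
Variables (R : realType) (H : completeNormedModType R) (ip : H -> H -> R).
Variable E : set (measurableTypeR R) -> H -> H.
Hypothesis ip_inner : inner_product ip.
Hypothesis E_pvm : projection_valued_measure ip E.
Variables (f : nat -> H) (l : nat -> R).
Hypothesis f_orthonormal : forall i j, ip (f i) (f j) = (i == j)%:R.
Hypothesis l_ge1 : forall k, 1 <= l k.
Hypothesis f_eigen : forall k, E [set l k ^+ 2] (f k) = f k.
Local Notation vec := (vec f).

Let l_gt0 k : 0 < l k. Proof. exact: lt_le_trans (l_ge1 k). Qed.

(** The exponent [k] in front of [phi] grows along the modes: from index [K > r] on it dominates
    [r], and the finitely many earlier terms only change the constant. One family of bounds thus
    serves every radius. *)
Lemma gevrey_vec phi r b xi : (forall s, 0 <= s -> 1 <= phi s) -> l2 xi ->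
  (forall k, l k.+1 `^ (4 * b) * xi k.+1 ^+ 2 * expR (k.+1%:R * phi (l k.+1)) <=
    1 / (8 * 2 ^+ k.+1)) ->
  gevrey ip E phi r b (vec xi).
Proof.
move=> phi_ge1 xi2 hxi.
pose a k := l k `^ (4 * b) * expR (r * phi (l k)) * xi k ^+ 2.
pose K := (Num.truncn r).+1.
have [C hC] : exists C, forall n, \sum_(0 <= k < n) a k <= C.
  apply: (@sum_tail_bounded _ a (fun k => 1 / (8 * 2 ^+ k)) K (1 / 4)).
  - by move=> k; rewrite /a mulr_ge0 ?sqr_ge0// mulr_ge0 ?powR_ge0// expR_ge0.
  - by move=> k; rewrite divr_ge0// mulr_ge0// exprn_ge0.
  - move=> [//|k] Kk; apply: le_trans (hxi k).
    rewrite /a mulrAC ler_wpM2l//; first by rewrite mulr_ge0 ?powR_ge0 ?sqr_ge0.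
    rewrite ler_expR ler_wpM2r//.
      by apply: le_trans (phi_ge1 _ (ltW (l_gt0 _))).
    apply: le_trans (ltW (truncnS_gt r)) _.
    by rewrite ler_nat.
  - move=> n; suff -> : \sum_(0 <= k < n) (1 / (8 * 2 ^+ k)) = 1 / 4 - 1 / (4 * 2 ^+ n) :> R.
      by rewrite gerBl divr_ge0// mulr_ge0// exprn_ge0.
    elim: n => [|n IH]; first by rewrite big_geq// expr0 mulr1 subrr.
    by rewrite big_nat_recr//= IH exprS; field; exact: expf_neq0.
have h := @integral_vec_le _ _ _ _ ip_inner E_pvm f (fun k => l k ^+ 2) xi
  (fun s => Num.sqrt s `^ (4 * b) * expR (r * phi (Num.sqrt s))) C f_orthonormal f_eigen xi2.
rewrite /gevrey/= /gevrey_norm2; apply: (le_lt_trans (h _ _)); last by rewrite ltry.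
  by move=> s; rewrite mulr_ge0 ?powR_ge0// expR_ge0.
move=> n; apply: le_trans (hC n); apply: ler_sum => k _.
by rewrite sqrtr_sqr ger0_norm ?(ltW (l_gt0 k)).
Qed.

(** Since [l k >= 1], membership for any [b >= 1] bounds the sums with the weights of [b = 1], the
    exponent at which the modes are bounded below. *)
Lemma phase_space_bounded b xi zeta : 1 <= b -> l2 xi -> l2 zeta ->
  phase_space ip E b (vec xi, vec zeta) ->
  exists B, forall n, \sum_(0 <= k < n)
    l k ^+ 2 * (zeta k ^+ 2 + l k ^+ 2 * xi k ^+ 2) <= B.
Proof.
move=> b1 xi2 zeta2 [/= dxi dzeta].
have b0 : 0 <= b by lra.
exists (`|Apow ip E ((b + 1) / 2) (vec xi)| ^+ 2 + `|Apow ip E (b / 2) (vec zeta)| ^+ 2) => n.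
apply: le_trans (lerD (Apow_vec_ge ip_inner E_pvm f_orthonormal l_ge1 f_eigen n xi2 dxi)
  (Apow_vec_ge ip_inner E_pvm f_orthonormal l_ge1 f_eigen n zeta2 dzeta)).
rewrite -big_split/=; apply: ler_sum => k _.
rewrite mulrDr addrC mulrA -exprD lerD// ler_wpM2r ?sqr_ge0//.
  rewrite -powR_mulrn ?(ltW (l_gt0 k))// ler_powR//; lra.
rewrite -powR_mulrn ?(ltW (l_gt0 k))// ler_powR//; lra.
Qed.

Lemma unbounded_phase b xi zeta K : 1 <= b -> l2 xi -> l2 zeta ->
  (forall k, (K <= k)%N -> 1 <= l k.+1 ^+ 2 * (zeta k.+1 ^+ 2 + l k.+1 ^+ 2 * xi k.+1 ^+ 2)) ->
  ~ phase_space ip E b (vec xi, vec zeta).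
Proof.
move=> b1 xi2 zeta2 h /(phase_space_bounded b1 xi2 zeta2)[B hB].
have h0 k : 0 <= l k ^+ 2 * (zeta k ^+ 2 + l k ^+ 2 * xi k ^+ 2).
  by apply: (mulr_ge0 (sqr_ge0 _)); rewrite (addr_ge0 (sqr_ge0 _))// (mulr_ge0 (sqr_ge0 _) (sqr_ge0 _)).
have hn n : n%:R <= \sum_(0 <= k < K.+1 + n) l k ^+ 2 * (zeta k ^+ 2 + l k ^+ 2 * xi k ^+ 2).
  elim: n => [|n IH]; first exact: sumr_ge0.
  rewrite addnS big_nat_recr//= -natr1; apply: lerD => //.
  by rewrite addSn h// leq_addr.
have := le_trans (hn (Num.truncn B).+1) (hB _).
by rewrite leNgt truncnS_gt.
Qed.

(** Only the [k]-th term is kept, written as [l k] to the power [2 * b - 1] times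
    [l k ^+ 3 * xi k ^+ 2]. The second factor is at least [3 / (4 * Z)] and the first at least
    [(Z + k%:R) ^+ 2], because [k * (2 * b - 1) >= 2]; the product exceeds [3 / 4 * k%:R]. *)
Lemma Apow_norm_vec_ge b xi k Z : l2 xi -> 1 / 2 < b -> 2 <= (2 * b - 1) * k%:R -> 0 < Z ->
  (Z + k%:R) ^+ k <= l k -> 3 / 4 <= Z * l k * (l k ^+ 2 * xi k ^+ 2) ->
  ((Num.sqrt (3 / 4 * k%:R))%:E <= Apow_norm ip E ((b + 1) / 2) (vec xi))%E.
Proof.
move=> xi2 b_gt kb Z0 lk h; rewrite /Apow_norm; case: asboolP => [d|_]; last exact: leey.
rewrite lee_fin -(ger0_norm (normr_ge0 (Apow _ _ _ _))) -sqrtr_sqr ler_wsqrtr//.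
apply: le_trans (Apow_vec_ge ip_inner E_pvm f_orthonormal l_ge1 f_eigen k.+1 xi2 d).
rewrite big_nat_recr//=; apply: (@le_trans _ _ (l k `^ (4 * ((b + 1) / 2)) * xi k ^+ 2)); last first.
  by rewrite lerDr sumr_ge0// => j _; rewrite mulr_ge0 ?powR_ge0 ?sqr_ge0.
have k0 : 0 <= k%:R :> R by [].
have Zk : 0 <= Z + k%:R by lra.
have hp : (Z + k%:R) ^+ 2 <= l k `^ (2 * b - 1).
  have [Zk1|Zk1] := ltP (Z + k%:R) 1; first by
    apply: (@le_trans _ _ 1); [rewrite expr_le1// ltW|apply: powR_ge1 => //; lra].
  apply: (@le_trans _ _ (((Z + k%:R) ^+ k) `^ (2 * b - 1))).
    rewrite -(powR_mulrn 2)// -(powR_mulrn k)// -powRrM ler_powR//; lra.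
  by apply: ge0_ler_powR => //; rewrite ?nnegrE ?exprn_ge0 ?(ltW (l_gt0 k))//; lra.
have e1 : l k `^ (4 * ((b + 1) / 2)) = l k `^ (2 * b - 1) * (l k * l k ^+ 2).
  rewrite -exprS -(powR_mulrn 3) ?(ltW (l_gt0 k))// -powRD; last first.
    by apply/implyP => _; rewrite gt_eqF.
  by congr (_ `^ _); field.
have X0 : 0 <= l k * l k ^+ 2 * xi k ^+ 2.
  by rewrite mulr_ge0 ?sqr_ge0// mulr_ge0 ?exprn_ge0// ltW.
have h1 : 3 / 4 <= Z * (l k * l k ^+ 2 * xi k ^+ 2).
  by apply: le_trans h _; rewrite le_eqVlt; apply/orP; left; apply/eqP; ring.
rewrite e1 -[leRHS]mulrA.
apply: (@le_trans _ _ ((Z + k%:R) ^+ 2 * (l k * l k ^+ 2 * xi k ^+ 2))); last by rewrite ler_wpM2r.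
move: X0 h1; move: (l k * l k ^+ 2 * xi k ^+ 2) => X X0 h1.
have : 3 / 4 * k%:R <= Z * X * k%:R by rewrite ler_wpM2r.
have : 0 <= X * Z ^+ 2 by rewrite mulr_ge0 ?sqr_ge0.
have : 0 <= X * k%:R ^+ 2 by rewrite mulr_ge0 ?sqr_ge0.
have : 0 <= X * Z * k%:R by rewrite !mulr_ge0// ltW.
by rewrite sqrrD; lra.
Qed.

End regularity.

(** * Short-time behaviour of the dominant mode and assembly of the solution *)

Lemma first_mode_time (R : realType) (w w' g : R -> R) :
  (forall t : R, 0 <= t -> is_derive t 1 w (w' t) /\ is_derive t 1 w' (g t)) ->
  w 0 = 1 -> w' 0 = 1 ->
  exists T0, [/\ 0 < T0, T0 <= 1 & forall t, `[0, T0]%classic t -> 1 <= w t /\ 1 / 2 <= w' t].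
Proof.
move=> dw w0 w'0; have [_ d] := dw 0 (lexx 0).
have [r r0 hr] := is_derive_local d ltr01.
have G0 : 0 < `|g 0| + 1 by rewrite ltr_wpDl.
(* The first bound stays inside the neighbourhood where [w'] differs from [1 + g 0 * t] by at most
   [t]; the last one then keeps [w'] above [1 / 2]. *)
pose T0 := Num.min (r / 2) (Num.min 1 (1 / (2 * (`|g 0| + 1)))).
have T0gt : 0 < T0.
  by rewrite /T0 !lt_min ltr01 divr_gt0//= divr_gt0// mulr_gt0.
have T0r : T0 < r.
  by rewrite gt_min; apply/orP; left; lra.
have T01 : T0 <= 1 by rewrite /T0 !ge_min lexx orbT.
have T0G : T0 * (`|g 0| + 1) <= 1 / 2.
  rewrite -ler_pdivlMr// /T0 !ge_min; apply/orP; right; apply/orP; right.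
  by rewrite le_eqVlt; apply/orP; left; apply/eqP; field; rewrite gt_eqF.
have w'half t : 0 <= t <= T0 -> 1 / 2 <= w' t.
  move=> /andP[t0 tT].
  have := hr t; rewrite subr0 (ger0_norm t0) w'0 mul1r => /(_ (le_lt_trans tT T0r)).
  rewrite ler_norml => /andP[h _].
  have : - `|g 0| * t <= g 0 * t by rewrite ler_wpM2r// lerNnormlW.
  have : t * (`|g 0| + 1) <= T0 * (`|g 0| + 1) by rewrite ler_wpM2r// ltW.
  move: h T0G; rewrite mulrDr mulr1 mulNr; lra.
exists T0; split => // t; rewrite /= in_itv/= => /andP[t0 tT]; split; last by apply: w'half; rewrite t0.
rewrite -w0; apply: (@derive_ge0_le _ w w') => // s /andP[s0 st].
  by have [] := dw s s0.
by apply: le_trans (w'half s _) => //; rewrite s0 (le_trans st).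
Qed.

Theorem theorem3p4 (R : realType) (H : completeNormedModType R)
    (ip : H -> H -> R) (D : set H) (A : H -> H)
    (E : set (measurableTypeR R) -> H -> H)
    (e : nat -> H) (lam : nat -> R) (omega phi : R -> R)
    (ip_inner : inner_product ip)
    (H_separable : separable H)
    (A_linear : linear_operator D A)
    (A_self_adjoint : self_adjoint ip D A)
    (A_nonneg : nonnegative_operator ip D A)
    (E_spectral : spectral_resolution ip D A E)
    (e_orthonormal : forall i j, ip (e i) (e j) = (i == j)%:R)
    (lam_gt0 : forall k, 0 < lam k)
    (lam_increasing : increasing_seq lam)
    (lam_unbounded : forall M : R, exists k, M < lam k)
    (e_eigen : forall k, D (e k) /\ A (e k) = lam k ^+ 2 *: e k)
    (omega_ge0 : forall s, 0 <= s -> 0 <= omega s)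
    (omega_cont : {within `[0, +oo[, continuous omega})
    (omega_increasing : forall a b, 0 <= a -> a < b -> omega a < omega b)
    (omega0 : omega 0 = 0)
    (omega_subadd : forall a b, 0 <= a -> 0 <= b ->
       omega (a + b) <= omega a + omega b)
    (omega_ratio : forall a b, 0 < a -> a <= b ->
       a / omega a <= b / omega b)
    (phi_ge1 : forall s, 0 <= s -> 1 <= phi s)
    (phi_lim :
       s * (phi (s / Num.sqrt (omega (1 / s))))^-1 @[s --> +oo] --> +oo) :
  exists (m : R -> R) (T0 : R) (u u' : R -> H),
    (forall s, 0 <= s -> 0 <= m s <= 3 / 2) /\ 0 < T0 /\
    omega_continuous `[0, +oo[ omega m /\
    (forall r, 0 < r ->
       gevrey ip E phi r (3 / 4) (u 0) /\ gevrey ip E phi r (1 / 4) (u' 0)) /\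
    (C1_dom ip E `[0, T0] (1 / 4) u u' /\
     C0_dom ip E `[0, T0] (3 / 4) u /\
     weak_kirchhoff_solution ip E `[0, T0] m u u') /\
    (forall t, 0 < t <= T0 -> forall b, 1 <= b ->
       ~ phase_space ip E b (u t, u' t)) /\
    (exists tau : nat -> R,
       (forall k, 0 < tau k <= T0) /\ tau @ \oo --> (0 : R) /\
       forall b, 1 / 2 < b -> forall M : R, exists k,
         (M%:E < Apow_norm ip E ((b + 1) / 2) (u (tau k)))%E).
Proof.
have [n [c [w [w' [n_inj l_ge1 c01 [C C0 c_mod]
    [dw w_init w_small w_init_small [w_phase [tau [tau_small w_tau]]]]]]]]] :=
  modes lam_gt0 lam_unbounded omega_ge0 omega_cont omega_increasing omega0 omega_ratio
    phi_ge1 phi_lim.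
have [E_pvm E_graph] := E_spectral.
pose l k := lam (n k); pose f k := e (n k).
have l_gt0 k : 0 < l k := lam_gt0 _.
have f_orthonormal i j : ip (f i) (f j) = (i == j)%:R.
  by rewrite e_orthonormal (inj_eq n_inj).
have f_eigen k : E [set l k ^+ 2] (f k) = f k.
  by apply: (eigen_pvm ip_inner E_pvm); apply/E_graph; exact: e_eigen.
have [T0 [T0_gt0 T0_le1 w0_large]] := first_mode_time (dw 0) (proj1 w_init) (proj2 w_init).
have l2w := position_l2 l_ge1 dw w_small.
have l2w' := velocity_l2 l_ge1 dw w_small.
have omega_ndecr a b : 0 <= a -> a <= b -> omega a <= omega b.
  move=> a0; rewrite le_eqVlt => /orP[/eqP->//|ab]; exact: ltW (omega_increasing _ _ a0 ab).
have z01 : 0 <= (0 : R) <= 1 by rewrite lexx ler01.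
exists (nonlinearity ip E f c w T0), T0, (fun t => vec f (w^~ t)), (fun t => vec f (w'^~ t)).
split.
  move=> s _; rewrite /nonlinearity; have /andP[-> h] := c01 (sup [set t | `[0, T0]%classic t /\
    (t = 0 \/ `|Apow ip E (1 / 2) (vec f (w^~ t))| ^+ 2 <= s)]).
  by rewrite (le_trans h)//; lra.
split=> //; split.
  exists (2 * C) => a b _ _; exact: (nonlinearity_modulus ip_inner E_pvm f_orthonormal l_ge1
    f_eigen dw w_small T0_le1 T0_gt0 w0_large C0 omega_ndecr omega_subadd c_mod).
split.
  move=> r r0; split; apply: (gevrey_vec ip_inner E_pvm f_orthonormal l_ge1 f_eigen r phi_ge1).
  - exact: (l2w _ z01).
  - move=> k; apply: le_trans (w_init_small k); rewrite ler_wpM2r ?expR_ge0//.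
    rewrite (_ : 4 * (3 / 4) = 3%:R); last by field.
    rewrite powR_mulrn ?(ltW (l_gt0 _))// exprS -mulrA ler_wpM2l ?(ltW (l_gt0 _))//.
    by rewrite lerDr sqr_ge0.
  - exact: (l2w' _ z01).
  - move=> k; apply: le_trans (w_init_small k); rewrite ler_wpM2r ?expR_ge0//.
    rewrite (_ : 4 * (1 / 4) = 1); last by field.
    rewrite powRr1 ?(ltW (l_gt0 _))// ler_wpM2l ?(ltW (l_gt0 _))//.
    by rewrite lerDl (mulr_ge0 (sqr_ge0 _) (sqr_ge0 _)).
split; [split; [|split]|split].
- exact: (C1_position ip_inner E_pvm f_orthonormal l_ge1 f_eigen dw w_small T0_le1).
- by apply: (C0_position ip_inner E_pvm f_orthonormal l_ge1 f_eigen dw w_small T0_le1); right.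
- exact: (weak_solution ip_inner E_pvm f_orthonormal l_ge1 f_eigen c01 dw w_small T0_le1 T0_gt0 w0_large).
- move=> t /andP[t0 tT] b b1.
  have t1 : t <= 1 := le_trans tT T0_le1.
  have [K hK] := w_phase t (introT andP (conj t0 t1)).
  have t01 : 0 <= t <= 1 by rewrite ltW.
  exact: (unbounded_phase ip_inner E_pvm f_orthonormal l_ge1 f_eigen b1 (l2w t t01) (l2w' t t01) hK).
- have tau0 : tau @ \oo --> (0 : R).
    apply: (@squeeze_cvgr _ _ _ _ (fun=> 0) (fun k => (1 / 64) ^+ k.+1)).
    + by apply: nearW => k; have /andP[/ltW-> ->] := tau_small k.
    + exact: cvg_cst.
    + rewrite (cvg_shiftS (fun k => (1 / 64 : R) ^+ k)); apply: cvg_expr.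
      by rewrite ger0_norm//; lra.
  have [K0 _ hK0] : \forall k \near \oo, tau k <= T0.
    by near=> k; apply: ltW; near: k; exact: (cvgr_lt 0 tau0).
  (* The shift by [K0] brings all the times below [T0]. *)
  exists (fun k => tau (k + K0)%N); split.
    by move=> k; have /andP[-> _] := tau_small (k + K0)%N; rewrite hK0//= leq_addl.
  split; first by rewrite cvg_shiftn.
  move=> b b_gt M.
  (* Large enough for both [(2 * b - 1) * j.+1 >= 2] and [3 / 4 * j.+1 > M ^+ 2]. The index is
     [j.+1] because [tau j] belongs to mode [j.+1]. *)
  pose k := Num.truncn (2 / (2 * b - 1) + 2 * M ^+ 2).
  have b0 : 0 < 2 * b - 1 by lra.
  exists k; set j := (k + K0)%N.
  have hj : 2 / (2 * b - 1) + 2 * M ^+ 2 < j.+1%:R.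
    by apply: lt_le_trans (truncnS_gt _) _; rewrite ler_nat ltnS leq_addr.
  have M0 := sqr_ge0 M.
  have d0 : 0 <= 2 / (2 * b - 1) by rewrite divr_ge0// ltW.
  have /andP[tj0 tj1] := tau_small j.
  have tj01 : 0 <= tau j <= 1.
    by rewrite ltW//= (le_trans tj1)// expr_le1//; lra.
  have [Z Z0 [lZ hZ]] := w_tau j.
  have jb : 2 <= (2 * b - 1) * j.+1%:R.
    by rewrite mulrC -ler_pdivrMr//; lra.
  apply: lt_le_trans (Apow_norm_vec_ge ip_inner E_pvm f_orthonormal l_ge1 f_eigen
    (l2w _ tj01) b_gt jb Z0 lZ hZ).
  rewrite lte_fin; apply: le_lt_trans (ler_norm M) _.
  by rewrite -sqrtr_sqr ltr_sqrt; lra.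
Unshelve. all: by end_near. Qed.
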